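(* Let $\rho>0$ and $\lambda\in\left[\frac1n,\frac{\rho}{\sqrt k}\right]$. There exist positive universal constants $C_0,C_1,C_2,c_0$ such that, under the sub-Gaussian sampling model with $m>C_2\log n/\lambda^2$, with probability at least $1-C_0\exp(-c_0m)$ the following holds simultaneously for all $x\in\mathbb{R}^n$ satisfying $\|x_\Omega\|_2/\|x_\Omega\|_1\ge\rho$, all $\epsilon_1\ge 0$ and all $\eta\in\mathbb{R}^m$ with $\|\eta\|_1\le\epsilon_1$: letting $y_i=(a_i^\top x)^2+\eta_i$, $i=1,\dots,m$, any minimizer $\hat X$ of $$\min_M\ \operatorname{Tr}(M)+\lambda\|M\|_1\quad\text{subject to}\quad M\succeq0,\ \ \|y-\mathcal A(M)\|_1\le\epsilon_1$$ satisfies $$\|\hat X-xx^\top\|_{\mathrm F}\le C_1\Big\{\|xx^\top-x_\Omega x_\Omega^\top\|_*+\lambda\|xx^\top-x_\Omega x_\Omega^\top\|_1+\frac{\epsilon_1}{m}\Big\}.$$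
   Context: Sub-Gaussian sampling model: $a_1,\dots,a_m\in\mathbb{R}^n$ are i.i.d. copies of $z=(z_1,\dots,z_n)^\top$ with i.i.d. sub-Gaussian entries, $\mathbb{E}[z_j]=0$, $\mathbb{E}[z_j^2]=1$, $\mu_4:=\mathbb{E}[z_j^4]>1$. $\mathcal A(M)=(a_i^\top Ma_i)_{i=1}^m$. $x_\Omega$ denotes a best $k$-sparse approximation of $x$ (keep the $k$ largest-magnitude entries, zero the rest). For a matrix, $\|\cdot\|_1$ is the entrywise $\ell_1$ norm and $\|\cdot\|_*$ the nuclear norm. *)

(* Defs.v *)
From HB Require Import structures.
From mathcomp Require Import all_boot all_order all_algebra.
From mathcomp Require Import all_classical all_reals all_analysis.
Set Implicit Arguments. Unset Strict Implicit. Unset Printing Implicit Defensive.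
Import Order.TTheory GRing.Theory Num.Theory.
Local Open Scope classical_set_scope.
Local Open Scope ring_scope.

Section Defs.
Variable R : realType.

Definition l1v n (x : 'I_n -> R) : R := \sum_(i < n) `|x i|.
Definition l2v n (x : 'I_n -> R) : R := Num.sqrt (\sum_(i < n) x i ^+ 2).

(* Omega is a valid support of a best k-sparse approximation of x:
   #|Omega| = k and every kept entry has magnitude >= every discarded one. *)
Definition best_ksupport n (k : nat) (x : 'I_n -> R) (Om : {set 'I_n}) : Prop :=
  #|Om| = k /\ (forall i j, i \in Om -> j \notin Om -> `|x j| <= `|x i|).

Definition restr n (x : 'I_n -> R) (Om : {set 'I_n}) : 'I_n -> R :=
  fun i => if i \in Om then x i else 0.

Definition outer n (x : 'I_n -> R) : 'M[R]_n := \matrix_(i, j) (x i * x j).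

Definition psd n (M : 'M[R]_n) : Prop :=
  M^T = M /\ forall v : 'cV[R]_n, 0 <= (v^T *m M *m v) ord0 ord0.

Definition mnorm1 n (M : 'M[R]_n) : R := \sum_i \sum_j `|M i j|.
Definition frob n (M : 'M[R]_n) : R := Num.sqrt (\sum_i \sum_j M i j ^+ 2).

(* nuclear (trace) norm: ||A||_* = tr (sqrt (A^T A)), the trace of the
   (unique) positive semidefinite square root of A^T A *)
Definition nucnorm n (A : 'M[R]_n) : R :=
  xget 0 [set t | exists S : 'M[R]_n, psd S /\ S *m S = A^T *m A /\ t = \tr S].

Definition Aop m n (a : 'I_m -> 'I_n -> R) (M : 'M[R]_n) : 'I_m -> R :=
  fun i => \sum_j \sum_l a i j * M j l * a i l.

Definition inner n (u v : 'I_n -> R) : R := \sum_j u j * v j.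

Definition subgaussian_entry_law (mu : probability R R) : Prop :=
  [/\ exists K : R, 0 < K /\
        (\int[mu]_x (expR (x ^+ 2 / K ^+ 2))%:E <= 1 + 1)%E,
      mu.-integrable setT (fun x => x%:E),
      (\int[mu]_x x%:E = 0)%E,
      (\int[mu]_x (x ^+ 2)%:E = 1)%E &
      (1 < \int[mu]_x (x ^+ 4)%:E)%E].

Definition iid_entries d (T : measurableType d) (P : probability T R) m n
  (a : 'I_m -> 'I_n -> T -> R) (mu : probability R R) : Prop :=
  [/\ forall i j, measurable_fun setT (a i j),
      forall i j (B : set R), measurable B -> P (a i j @^-1` B) = mu B &
      forall B : 'I_m -> 'I_n -> set R, (forall i j, measurable (B i j)) ->
        fine (P (\bigcap_(p in [set: 'I_m * 'I_n]) (a p.1 p.2 @^-1` B p.1 p.2)))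
        = \prod_(i < m) \prod_(j < n) fine (P (a i j @^-1` B i j))].

Definition feasible m n (a : 'I_m -> 'I_n -> R) (y : 'I_m -> R) (eps1 : R)
  (M : 'M[R]_n) : Prop :=
  psd M /\ \sum_(i < m) `|y i - Aop a M i| <= eps1.

Definition is_minimizer m n (a : 'I_m -> 'I_n -> R) (y : 'I_m -> R) (eps1 lam : R)
  (X : 'M[R]_n) : Prop :=
  feasible a y eps1 X /\
  forall M, feasible a y eps1 M -> \tr X + lam * mnorm1 X <= \tr M + lam * mnorm1 M.

End Defs.

(* Main.v *)
(* Let z = x_Omega, H = Xh - x x^T and D = x x^T - z z^T.  Optimality of Xh forces, unless
   |H|_F is already below |D|_F + lam |D|_1, that H = S + G with S psd supported on Omega x Omega,
   tr S <= 12 |H|_F and lam |G|_1 <= 12 |H|_F.  As |A(H)|_1 <= 2 eps_1, it remains to bound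
   |A(H)|_1 / m from below by a multiple of |H|_F, uniformly over such H.

   This is Mendelson's small-ball method for the truncated values min(|a^T H a|, 1).  Their mean
   is bounded below because the fourth moment of a^T H a is controlled by the square of the
   second one.  Symmetrization and contraction bound the expected supremum of the deviations by
   that of <W, H> with W = sum_i e_i a_i a_i^T: the part S is handled by a net of k-sparse
   vectors, the part G by the largest entry of W, both through exponential moments, and this is
   where m > C log n / lam^2 enters.  The bounded differences inequality then gives the
   probability 1 - exp(-c m).

   All expectations are finite sums: the entries are first rounded to a grid, fine enough in
   terms of m and n, and recentred so that their mean is still exactly zero. *)
Require Import Defs.
From HB Require Import structures.
From mathcomp Require Import all_boot all_order all_algebra.
From mathcomp Require Import all_classical all_reals all_analysis.
From mathcomp Require Import measurable_realfun.
From mathcomp Require Import ring lra zify.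
Import Order.TTheory GRing.Theory Num.Theory.
Local Open Scope classical_set_scope.
Local Open Scope ring_scope.
Set Implicit Arguments.
Unset Strict Implicit.
Unset Printing Implicit Defensive.

(** The supremum over the whole cone is never formed. Each bad outcome of the rounded sample selects
    one witness matrix, and the empirical process is maximized over these finitely many witnesses;
    thus no net of matrices and no measurability of a supremum is involved, and the good event is
    the complement of a finite union of cylinders. All constants are built from [K] and [v0], which
    the rounded law keeps on every fine grid, so the grid may be chosen after [n], [m] and the
    target probability. Truncation at 1 keeps the summands 1-Lipschitz in the form, as contraction
    asks, and makes them bounded, as bounded differences asks. The ratio condition enters in two
    ways. Since an l2 norm is at most the l1 norm, only [rho <= 1] matters, hence
    [k * lam ^+ 2 <= 1], and the price [k * ln n] of the sparse net is covered by [ln n / lam ^+ 2].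
    It also gives [lam * sqrt k * |z|_1 <= |z|_2], which controls the l1 part of the descent
    cone. *)

Record fdist (R : realType) (V : finType) := FDist {
  fpmf :> V -> R ;
  fpmf_ge0 : forall v, 0 <= fpmf v ;
  fpmf_sum1 : \sum_v fpmf v = 1 }.

Definition ev (R : realType) (V : finType) (P : fdist R V) (f : V -> R) : R :=
  \sum_v P v * f v.

(** Expectation over [n] independent draws. Samples are lists, so that every induction peels off the
    head without casts between tuple types. *)
Fixpoint Ex (R : realType) (V : finType) (P : fdist R V) n (F : seq V -> R) : R :=
  if n is n'.+1 then ev P (fun v => Ex P n' (fun s => F (v :: s))) else F [::].

(** * Expectations over finitely many independent draws *)

Section FiniteExpectation.
Context (R : realType) (V : finType) (P : fdist R V).

Lemma ev_ext (f g : V -> R) : f =1 g -> ev P f = ev P g.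
Proof. by move=> fg; apply: eq_bigr => v _; rewrite fg. Qed.

Lemma ev_le (f g : V -> R) : (forall v, f v <= g v) -> ev P f <= ev P g.
Proof. by move=> fg; apply: ler_sum => v _; rewrite ler_wpM2l ?fpmf_ge0. Qed.

Lemma evD (f g : V -> R) : ev P (fun v => f v + g v) = ev P f + ev P g.
Proof. by rewrite -big_split; apply: eq_bigr => v _; rewrite mulrDr. Qed.

Lemma evZ c (f : V -> R) : ev P (fun v => c * f v) = c * ev P f.
Proof. by rewrite mulr_sumr; apply: eq_bigr => v _; rewrite mulrCA. Qed.

Lemma evZr c (f : V -> R) : ev P (fun v => f v * c) = ev P f * c.
Proof. by rewrite mulr_suml; apply: eq_bigr => v _; rewrite mulrA. Qed.

Lemma evB (f g : V -> R) : ev P (fun v => f v - g v) = ev P f - ev P g.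
Proof.
rewrite -[- ev P g]mulN1r -evZ -evD; apply: ev_ext => v; by rewrite mulN1r.
Qed.

Lemma ev_cst c : ev P (fun=> c) = c.
Proof. by rewrite /ev -mulr_suml fpmf_sum1 mul1r. Qed.

Lemma ev_ge0 (f : V -> R) : (forall v, 0 <= f v) -> 0 <= ev P f.
Proof. by move=> f0; rewrite -(ev_cst 0); apply: ev_le. Qed.

Lemma Ex_le n (F G : seq V -> R) : (forall s, size s = n -> F s <= G s) ->
  Ex P n F <= Ex P n G.
Proof.
elim: n F G => [|n IH] F G FG /=; first exact: FG.
by apply: ev_le => v; apply: IH => s sn; apply: FG; rewrite /= sn.
Qed.

Lemma Ex_ext n (F G : seq V -> R) : (forall s, size s = n -> F s = G s) ->
  Ex P n F = Ex P n G.
Proof. by move=> FG; apply/eqP; rewrite eq_le !Ex_le// => s /FG ->. Qed.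

Lemma ExD n (F G : seq V -> R) : Ex P n (fun s => F s + G s) = Ex P n F + Ex P n G.
Proof.
elim: n F G => [//|n IH] F G /=; rewrite -evD; apply: ev_ext => v; exact: IH.
Qed.

Lemma ExZ n c (F : seq V -> R) : Ex P n (fun s => c * F s) = c * Ex P n F.
Proof.
elim: n F => [//|n IH] F /=; rewrite -evZ; apply: ev_ext => v; exact: IH.
Qed.

Lemma ExZr n c (F : seq V -> R) : Ex P n (fun s => F s * c) = Ex P n F * c.
Proof. by rewrite mulrC -ExZ; apply: Ex_ext => s _; rewrite mulrC. Qed.

Lemma ExB n (F G : seq V -> R) : Ex P n (fun s => F s - G s) = Ex P n F - Ex P n G.
Proof. by rewrite -[- Ex P n G]mulN1r -ExZ -ExD; apply: Ex_ext => s _; rewrite mulN1r. Qed.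

Lemma Ex_cst n c : Ex P n (fun=> c) = c.
Proof. by elim: n => [//|n IH] /=; rewrite IH ev_cst. Qed.

Lemma Ex_ge0 n (F : seq V -> R) : (forall s, 0 <= F s) -> 0 <= Ex P n F.
Proof. by move=> F0; rewrite -(Ex_cst n 0); apply: Ex_le. Qed.

Lemma Ex_sum n (I : Type) (r : seq I) (F : I -> seq V -> R) :
  Ex P n (fun s => \sum_(i <- r) F i s) = \sum_(i <- r) Ex P n (F i).
Proof.
elim: r => [|i r IH].
  by rewrite big_nil -[RHS](Ex_cst n); apply: Ex_ext => s _; rewrite big_nil.
by rewrite big_cons -IH -ExD; apply: Ex_ext => s _; rewrite big_cons.
Qed.

Lemma Ex_ev n (W : finType) (Q : fdist R W) (F : W -> seq V -> R) :
  Ex P n (fun s => ev Q (fun u => F u s)) = ev Q (fun u => Ex P n (F u)).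
Proof. by rewrite /ev Ex_sum; apply: eq_bigr => u _; rewrite ExZ. Qed.

Lemma Ex_prod n (g : V -> R) : Ex P n (fun s => \prod_(v <- s) g v) = ev P g ^+ n.
Proof.
elim: n => [|n IH] /=; first by rewrite big_nil expr0.
rewrite exprS -IH -evZr; apply: ev_ext => v; rewrite -ExZ.
by apply: Ex_ext => s _; rewrite big_cons.
Qed.

Lemma big_tuple_cons n (F : n.+1.-tuple V -> R) :
  \sum_t F t = \sum_v \sum_(t : n.-tuple V) F (cons_tuple v t).
Proof.
rewrite pair_big /= (reindex (fun p : V * n.-tuple V => cons_tuple p.1 p.2))//=.
exists (fun t => (thead t, behead_tuple t)) => [[v t] _|t _] /=.
  by congr (_, _); apply: val_inj.
by rewrite [RHS]tuple_eta; apply: val_inj.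
Qed.

(** Links the recursion with product weights, the form in which the probabilities of cylinders
    arrive from the sampling space. *)
Lemma Ex_tuple n (F : seq V -> R) :
  Ex P n F = \sum_(t : n.-tuple V) (\prod_(v <- t) P v) * F t.
Proof.
elim: n F => [|n IH] F /=.
  rewrite (bigD1 [tuple])//= big_nil mul1r big1 ?addr0// => t /eqP[].
  by apply: val_inj => /=; case: t => -[].
rewrite big_tuple_cons; apply: eq_bigr => v _; rewrite IH mulr_sumr.
by apply: eq_bigr => t _ /=; rewrite big_cons mulrA.
Qed.

Fact tdist_ge0 n (t : n.-tuple V) : 0 <= \prod_(v <- t) P v.
Proof. by apply: prodr_ge0 => v _; exact: fpmf_ge0. Qed.

Fact tdist_sum1 n : \sum_(t : n.-tuple V) \prod_(v <- t) P v = 1.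
Proof.
by rewrite -[RHS](Ex_cst n) Ex_tuple; apply: eq_bigr => t _; rewrite mulr1.
Qed.

(** The law of one measurement vector; [Ex] over it draws the [m] independent rows. *)
Definition tdist n : fdist R (n.-tuple V) := FDist (@tdist_ge0 n) (tdist_sum1 n).

Lemma ev_tdist n (F : seq V -> R) : ev (tdist n) F = Ex P n F.
Proof. by rewrite Ex_tuple. Qed.

Fact sdist_ge0 (p : V * bool) : 0 <= P p.1 / 2.
Proof. by rewrite divr_ge0 ?fpmf_ge0. Qed.

Fact sdist_sum1 : \sum_(p : V * bool) P p.1 / 2 = 1.
Proof.
rewrite -(pair_big xpredT xpredT (fun v b => P v / 2))/= -[RHS](fpmf_sum1 P).
by apply: eq_bigr => v _; rewrite big_bool /=; lra.
Qed.

Definition sdist : fdist R (V * bool)%type := FDist sdist_ge0 sdist_sum1.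

Lemma ev_sdist (F : V * bool -> R) :
  ev sdist F = ev P (fun v => (F (v, true) + F (v, false)) / 2).
Proof.
transitivity (\sum_(p : V * bool) P p.1 / 2 * F (p.1, p.2)).
  by apply: eq_bigr => -[].
rewrite -(pair_big xpredT xpredT (fun v b => P v / 2 * F (v, b)))/=.
by apply: eq_bigr => v _; rewrite big_bool /=; lra.
Qed.

(** For positive bounds, expand the expectation of [(b' * F - a' * G) ^+ 2]. Bounds that may vanish
    are first enlarged by a small [d]. *)
Lemma Ex_cauchy_schwarz n (F G : seq V -> R) (a b : R) : 0 <= a -> 0 <= b ->
  Ex P n (fun s => F s ^+ 2) <= a ^+ 2 -> Ex P n (fun s => G s ^+ 2) <= b ^+ 2 ->
  Ex P n (fun s => F s * G s) <= a * b.
Proof.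
move=> a0 b0 Fa Gb.
have pos (a' b' : R) : 0 < a' -> 0 < b' -> a <= a' -> b <= b' ->
    Ex P n (fun s => F s * G s) <= a' * b'.
  move=> a'0 b'0 aa bb.
  have : 0 <= Ex P n (fun s => (b' * F s - a' * G s) ^+ 2) by apply: Ex_ge0 => s; exact: sqr_ge0.
  have -> : Ex P n (fun s => (b' * F s - a' * G s) ^+ 2) =
      b' ^+ 2 * Ex P n (fun s => F s ^+ 2) + a' ^+ 2 * Ex P n (fun s => G s ^+ 2)
      - 2 * a' * b' * Ex P n (fun s => F s * G s).
    rewrite -!ExZ -ExD -ExB; apply: Ex_ext => s _; ring.
  have := ler_wpM2l (sqr_ge0 b') (le_trans Fa (lerXn2r 2 a0 (ltW a'0) aa)).
  have := ler_wpM2l (sqr_ge0 a') (le_trans Gb (lerXn2r 2 b0 (ltW b'0) bb)).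
  move=> h1 h2 h3; rewrite -(ler_pM2l (mulr_gt0 a'0 b'0)).
  nra.
apply/ler_addgt0Pr => e e0.
(* With [d <= 1], [(a + d) * (b + d)] exceeds [a * b] by at most [d * (a + b + 1) <= e]. *)
pose d := Num.min 1 (e / (a + b + 1)).
have d0 : 0 < d by rewrite lt_min ltr01 divr_gt0// ltr_wpDl// addr_ge0.
have d1 : d <= 1 by rewrite ge_min lexx.
have de : d * (a + b + 1) <= e by rewrite -ler_pdivlMr ?ge_min ?lexx ?orbT// ltr_wpDl// addr_ge0.
have := pos (a + d) (b + d) _ _ _ _.
rewrite !ltr_wpDl// !lerDl (ltW d0) => /(_ isT isT isT isT) /le_trans; apply.
nra.
Qed.

End FiniteExpectation.

Definition fmax (R : realType) (I : finType) (i0 : I) (F : I -> R) : R :=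
  F [arg max_(i > i0) F i]%O.

Definition sg (R : realType) (b : bool) : R := if b then 1 else -1.

Section FiniteMax.
Context (R : realType) (I : finType) (i0 : I).
Implicit Types F G : I -> R.

Lemma fmax_ge F i : F i <= fmax i0 F.
Proof. by rewrite /fmax; case: Order.TotalTheory.arg_maxP => // j _; apply. Qed.

Lemma fmax_attained F : exists i, fmax i0 F = F i.
Proof. by rewrite /fmax; eexists. Qed.

Lemma fmax_le F c : (forall i, F i <= c) -> fmax i0 F <= c.
Proof. by move=> Fc; have [i ->] := fmax_attained F. Qed.

Lemma le_fmax F G : (forall i, F i <= G i) -> fmax i0 F <= fmax i0 G.
Proof. by move=> FG; apply: fmax_le => i; rewrite (le_trans (FG i)) ?fmax_ge. Qed.

Lemma fmax_leD1 F G : (forall i, F i <= G i + 1) -> fmax i0 F <= fmax i0 G + 1.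
Proof. by move=> FG; apply: fmax_le => i; rewrite (le_trans (FG i))// lerD2r fmax_ge. Qed.

End FiniteMax.

(** * Bounded differences, symmetrization and a maximal inequality *)

Section Concentration.
Context (R : realType).

(** Square and invert [1 - x / 2 <= expR (- (x / 2))]. After multiplication by [(1 - x / 2) ^+ 2],
    the slack of the quadratic is half of [x ^+ 2 * ((1 - x) * (5 / 2 - x))]. *)
Lemma expR_le_quadratic (x : R) : x <= 1 -> expR x <= 1 + x + 2 * x ^+ 2.
Proof.
move=> x1.
have h : 0 < 1 - x / 2 by lra.
have e2 : 1 - x / 2 <= expR (- (x / 2)) by apply: expR_ge1Dx.
have : (1 - x / 2) ^+ 2 <= expR (- x).
  have -> : - x = - (x / 2) + - (x / 2) by lra.
  rewrite expRD -expr2; apply: lerXn2r => //; rewrite nnegrE; first exact: ltW.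
  exact: expR_ge0.
rewrite expRN -lef_pV2 ?posrE ?invr_gt0 ?expR_gt0 ?exprn_gt0// invrK => /le_trans; apply.
rewrite -[leLHS]mul1r ler_pdivrMr ?exprn_gt0//.
have : 0 <= x ^+ 2 * ((1 - x) * (5 / 2 - x)) by rewrite mulr_ge0 ?sqr_ge0// mulr_ge0; lra.
nra.
Qed.

Context (V : finType) (P : fdist R V).

(** A Hoeffding lemma: oscillation at most 1 puts [g v - ev P g] in [[-1, 1]], and in the quadratic
    bound the linear term has mean zero. *)
Lemma ev_centered_expR (g : V -> R) (th : R) : 0 <= th <= 1 ->
  (forall v v', g v - g v' <= 1) ->
  ev P (fun v => expR (th * (g v - ev P g))) <= expR (2 * th ^+ 2).
Proof.
move=> /andP[t0 t1] gB.
have gE v : `|g v - ev P g| <= 1.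
  rewrite -[X in X - _](ev_cst P) -evB ler_norml; apply/andP; split.
    rewrite -(ev_cst P (-1)); apply: ev_le => v'; have := gB v' v; lra.
  by rewrite -(ev_cst P 1); apply: ev_le => v'; have := gB v v'; lra.
apply: (@le_trans _ _ (ev P (fun v => (1 + 2 * th ^+ 2) + th * (g v - ev P g)))).
  apply: ev_le => v; have /ler_normlP[h1 h2] := gE v.
  apply: le_trans (expR_le_quadratic _) _; first by nra.
  have : th ^+ 2 * (g v - ev P g) ^+ 2 <= th ^+ 2 * 1.
    rewrite ler_wpM2l ?sqr_ge0//; nra.
  rewrite exprMn; nra.
rewrite evD ev_cst evZ evB ev_cst subrr mulr0 addr0.
exact: expR_ge1Dx.
Qed.

(** The martingale argument as an induction: given the first draw, the mean of [F] is [g], which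
    again has oscillation at most 1; the remaining draws are handled by induction with that draw
    fixed. *)
Lemma bounded_differences_mgf m (F : seq V -> R) (th : R) : 0 <= th <= 1 ->
  (forall s1 v v' s2, (size s1 + size s2).+1 = m ->
     F (s1 ++ v :: s2) - F (s1 ++ v' :: s2) <= 1) ->
  Ex P m (fun s => expR (th * (F s - Ex P m F))) <= expR (2 * m%:R * th ^+ 2).
Proof.
move=> th01; elim: m F => [|m IH] F FB /=.
  by rewrite subrr !mulr0 mul0r.
set g := fun v => Ex P m (fun s => F (v :: s)).
apply: (@le_trans _ _ (ev P (fun v => expR (2 * m%:R * th ^+ 2) *
    expR (th * (g v - ev P g))))).
  apply: ev_le => v.
  have -> : Ex P m (fun s => expR (th * (F (v :: s) - ev P g))) =
    Ex P m (fun s => expR (th * (F (v :: s) - g v))) * expR (th * (g v - ev P g)).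
    rewrite -ExZr; apply: Ex_ext => s _; rewrite -expRD; congr expR; ring.
  rewrite ler_wpM2r ?expR_ge0//; apply: IH => s1 u u' s2 sz.
  by apply: (FB (v :: s1)); rewrite /= addSn sz.
rewrite evZ; apply: le_trans (ler_wpM2l (expR_ge0 _) (ev_centered_expR th01 _)) _.
  move=> v v'; rewrite /g -ExB -(Ex_cst P m 1); apply: Ex_le => s sz.
  by apply: (FB [::]); rewrite /= sz.
by rewrite -expRD ler_expR -natr1; nra.
Qed.

(** Chernoff at [th = tau / 4], the minimizer of [2 * th ^+ 2 - th * tau], whose minimum is
    [- tau ^+ 2 / 8]. *)
Lemma bounded_differences_tail m (F : seq V -> R) (tau : R) : 0 <= tau <= 1 ->
  (forall s1 v v' s2, (size s1 + size s2).+1 = m ->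
     F (s1 ++ v :: s2) - F (s1 ++ v' :: s2) <= 1) ->
  Ex P m (fun s => (Ex P m F + m%:R * tau <= F s)%R%:R) <= expR (- (m%:R * tau ^+ 2 / 8)).
Proof.
move=> /andP[t0 t1] FB.
have h := @bounded_differences_mgf m F (tau / 4) _ FB.
apply: (@le_trans _ _ (expR (- (tau / 4 * (m%:R * tau))) *
    Ex P m (fun s => expR (tau / 4 * (F s - Ex P m F))))).
  rewrite -ExZ; apply: Ex_le => s _; rewrite -expRD.
  case: (lerP (Ex P m F + m%:R * tau) (F s)) => [hs|_] /=; last exact: expR_ge0.
  rewrite -[leLHS]expR0 ler_expR -mulrN -mulrDr; apply: mulr_ge0; lra.
apply: le_trans (ler_wpM2l (expR_ge0 _) (h _)) _; first by lra.
rewrite -expRD ler_expR expr_div_n; nra.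
Qed.

(* Symmetrization and the contraction principle are carried out one sample at a time: for
   fixed [G] both reduce to an inequality between two values of the maximum. *)
Lemma symmetrization_step (I : finType) (i0 : I) (G : I -> R) (h : I -> V -> R)
    (phi : R -> R) : (forall x y, `|phi x - phi y| <= `|x - y|) ->
  ev P (fun v => fmax i0 (fun i => G i + (ev P (fun u => phi (h i u)) - phi (h i v))))
  <= ev (sdist P) (fun p => fmax i0 (fun i => G i + 2 * sg R p.2 * h i p.1)).
Proof.
move=> phiL; rewrite ev_sdist /=.
pose B e v := fmax i0 (fun i => G i + e * phi (h i v)).
(* An independent copy [u] replaces the mean. Then [G + phi u - phi v] is the average of
   [G + 2 * phi u] and [G - 2 * phi v], and the two halves are maximized separately. *)
apply: (@le_trans _ _ (ev P (fun v => ev P (fun u => (B 2 u + B (-2) v) / 2)))).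
  apply: ev_le => v; apply: fmax_le => i.
  have -> : G i + (ev P (fun u => phi (h i u)) - phi (h i v)) =
      ev P (fun u => G i + (phi (h i u) - phi (h i v))).
    by rewrite evD evB !ev_cst.
  apply: ev_le => u.
  have h1 : G i + 2 * phi (h i u) <= B 2 u := fmax_ge i0 (fun i => G i + 2 * phi (h i u)) i.
  have h2 : G i + -2 * phi (h i v) <= B (-2) v :=
    fmax_ge i0 (fun i => G i + -2 * phi (h i v)) i.
  lra.
have -> : ev P (fun v => ev P (fun u => (B 2 u + B (-2) v) / 2)) =
    ev P (fun v => (B 2 v + B (-2) v) / 2).
  rewrite [RHS]evZr evD.
  rewrite (ev_ext _ (fun v => evZr P _ _)) evZr; congr (_ / _).
  rewrite (ev_ext _ (fun v => evD P _ _)) evD ev_cst.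
  by congr (_ + _); apply: ev_ext => v; rewrite ev_cst.
apply: ev_le => v; rewrite ler_pM2r ?invr_gt0// /B.
(* Contraction: for the maximizers [i] and [j], [phi (h i v) - phi (h j v) <= |h i v - h j v|], and
   the sign of [h i v - h j v] decides which of the two indices is tested with the plus sign. *)
have [i ->] := fmax_attained i0 (fun i => G i + 2 * phi (h i v)).
have [j ->] := fmax_attained i0 (fun i => G i + -2 * phi (h i v)).
have ub e k : G k + 2 * sg R e * h k v <= fmax i0 (fun i => G i + 2 * sg R e * h i v).
  exact: (fmax_ge i0 (fun i => G i + 2 * sg R e * h i v)).
have := ub true i; have := ub true j; have := ub false i; have := ub false j.
rewrite /=; set T := fmax i0 _; set U := fmax i0 _.
move: (phiL (h i v) (h j v)) => /ler_normlP[_]; case: ger0P; lra.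
Qed.

Lemma symmetrization m (I : finType) (i0 : I) (G : I -> R) (h : I -> V -> R)
    (phi : R -> R) : (forall x y, `|phi x - phi y| <= `|x - y|) ->
  Ex P m (fun s => fmax i0 (fun i =>
    G i + \sum_(v <- s) (ev P (fun u => phi (h i u)) - phi (h i v))))
  <= Ex (sdist P) m (fun s => fmax i0 (fun i =>
    G i + \sum_(p <- s) 2 * sg R p.2 * h i p.1)).
Proof.
move=> phiL; elim: m G => [|m IH] G /=.
  by apply: le_fmax => i; rewrite !big_nil.
apply: (@le_trans _ _ (ev P (fun v => Ex (sdist P) m (fun s => fmax i0 (fun i =>
    (G i + \sum_(p <- s) 2 * sg R p.2 * h i p.1) +
    (ev P (fun u => phi (h i u)) - phi (h i v))))))).
  apply: ev_le => v; apply: le_trans; last first.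
    apply: le_trans (IH (fun i => G i + (ev P (fun u => phi (h i u)) - phi (h i v)))) _.
    by apply: Ex_le => s _; apply: le_fmax => i; rewrite addrAC.
  by apply: Ex_le => s _; apply: le_fmax => i; rewrite big_cons addrA.
rewrite -Ex_ev -Ex_ev; apply: Ex_le => s _.
apply: le_trans (@symmetrization_step _ i0
  (fun i => G i + \sum_(p <- s) 2 * sg R p.2 * h i p.1) h _ phiL) _.
by apply: ev_le => p; apply: le_fmax => i; rewrite big_cons -addrA [X in _ + X]addrC.
Qed.

(** The tangent line of the exponential at [L + c] gives [th * X <= L + c - 1 + expR (- (L + c)) *
    expR (th * X)]. Enlarging the last term to a sum over [I] makes the bound uniform in [i], and
    its expectation is at most [L + c]. *)
Lemma Ex_fmax_le m (I : finType) (i0 : I) (X : I -> seq V -> R) (th L c : R) :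
  0 < th -> #|I|%:R <= expR L ->
  (forall i, Ex P m (fun s => expR (th * X i s)) <= expR c) ->
  Ex P m (fun s => fmax i0 (fun i => X i s)) <= (L + c) / th.
Proof.
move=> th0 IL Xc.
apply: (@le_trans _ _ (Ex P m (fun s =>
    (L + c - 1 + expR (- (L + c)) * \sum_i expR (th * X i s)) / th))).
  apply: Ex_le => s _; apply: fmax_le => i; rewrite ler_pdivlMr//.
  have : expR (th * X i s) <= \sum_i expR (th * X i s).
    by rewrite (bigD1 i)//= lerDl sumr_ge0// => j _; exact: expR_ge0.
  move=> /(ler_wpM2l (expR_ge0 (- (L + c)))); rewrite -expRD.
  have := expR_ge1Dx (- (L + c) + th * X i s); lra.
rewrite ExZr ler_pM2r ?invr_gt0// ExD Ex_cst ExZ.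
suff : expR (- (L + c)) * Ex P m (fun s => \sum_i expR (th * X i s)) <= 1 by lra.
have <- : expR (- (L + c)) * expR (L + c) = 1 by rewrite -expRD addNr expR0.
rewrite ler_wpM2l ?expR_ge0//.
rewrite Ex_sum expRD; apply: (@le_trans _ _ (\sum_(i : I) expR c)).
  by apply: ler_sum => i _; exact: Xc.
by rewrite sumr_const -mulr_natl ler_wpM2r ?expR_ge0.
Qed.

End Concentration.

Ltac nonneg := repeat first
  [ exact: sqr_ge0 | exact: (exprn_even_ge0 _ (isT : ~~ odd 4)) | assumption
  | (apply: ltW; assumption) | exact: ler0n | apply: mulr_ge0 | apply: addr_ge0 ].

(** * Moments of linear and quadratic forms in independent entries *)

Section PolynomialForms.
Context (R : realType).

(* Coefficients are indexed by [nat] so that the first coordinate can be peeled off; [quad]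
   only reads the entries [H i j] with [i <= j] and doubles the off-diagonal ones. *)

Fixpoint lin (l : nat -> R) (y : seq R) : R :=
  if y is x :: y' then l 0%N * x + lin (l \o succn) y' else 0.

Fixpoint quad (H : nat -> nat -> R) (y : seq R) : R :=
  if y is x :: y' then
    H 0%N 0%N * x ^+ 2 + 2 * x * lin (fun j => H 0%N j.+1) y' +
    quad (fun i j => H i.+1 j.+1) y'
  else 0.

(** [lnorm] and [qnorm] are squared norms; [qnorm] is the squared Frobenius norm of the symmetric
    matrix behind [quad]. *)
Fixpoint lnorm (l : nat -> R) n : R :=
  if n is n'.+1 then l 0%N ^+ 2 + lnorm (l \o succn) n' else 0.

Fixpoint qnorm (H : nat -> nat -> R) n : R :=
  if n is n'.+1 then
    H 0%N 0%N ^+ 2 + 2 * lnorm (fun j => H 0%N j.+1) n' + qnorm (fun i j => H i.+1 j.+1) n'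
  else 0.

Fixpoint qtrace (H : nat -> nat -> R) n : R :=
  if n is n'.+1 then H 0%N 0%N + qtrace (fun i j => H i.+1 j.+1) n' else 0.

Lemma lnorm_ge0 l n : 0 <= lnorm l n.
Proof. by elim: n l => //= n IH l; rewrite addr_ge0 ?sqr_ge0. Qed.

Lemma qnorm_ge0 H n : 0 <= qnorm H n.
Proof. by elim: n H => //= n IH H; rewrite !addr_ge0 ?sqr_ge0 ?mulr_ge0 ?lnorm_ge0. Qed.

(** The [n.+1]-st power of [x / n.+1 <= expR (x / n.+1)]. *)
Lemma exprn_le_expR n (x : R) : 0 <= x -> x ^+ n.+1 <= n.+1%:R ^+ n.+1 * expR x.
Proof.
move=> x0; rewrite -ler_pdivrMl ?exprn_gt0// mulrC -expr_div_n.
have -> : expR x = expR (x / n.+1%:R) ^+ n.+1.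
  by rewrite -expRM_natl mulrCA divff ?mulr1.
apply: lerXn2r; rewrite ?nnegrE ?divr_ge0 ?expR_ge0//.
by apply: le_trans (expR_ge1Dx _); rewrite lerDr.
Qed.

(** Convexity: the tangent line at [s * y], evaluated at 0 and at [y], is averaged with weights
    [1 - s] and [s]. *)
Lemma expR_chord (s y : R) : 0 <= s <= 1 -> 0 <= y ->
  expR (s * y) <= 1 + s * (expR y - 1).
Proof.
move=> /andP[s0 s1] y0.
have e1 := expR_gt0 (s * y).
have h1 := expR_ge1Dx (- (s * y)); have h2 := expR_ge1Dx (y - s * y).
have e2 : expR y = expR (y - s * y) * expR (s * y) by rewrite -expRD subrK.
have e3 : expR (- (s * y)) * expR (s * y) = 1 by rewrite -expRD addNr expR0.
rewrite e2; move: h1 h2 e1 e3.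
set E := expR (s * y); set A := expR (- (s * y)); set B := expR (y - s * y).
move=> h1 h2 E0 AE.
have sAE : s * (A * E) = s by rewrite AE mulr1.
have -> : 1 + s * (B * E - 1) = E * ((1 - s) * A + s * B) by lra.
rewrite -[leLHS]mulr1 ler_pM2l//.
have s1' : 0 <= 1 - s by lra.
have := ler_wpM2l s0 h2; have := ler_wpM2l s1' h1; lra.
Qed.

End PolynomialForms.

(** What survives rounding: the mean stays exactly zero, the variance only needs to exceed [1 / 2],
    and [mu_4 > 1] becomes a lower bound [v0] on the variance of [b ^+ 2], which keeps the forms of
    diagonal matrices from degenerating. [K] is a squared sub-Gaussian scale. *)
Record entry_law (R : realType) (V : finType) (P : fdist R V) (b : V -> R) (K v0 : R) : Prop :=
  EntryLaw {
    entry_K : 0 < K ;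
    entry_v0 : 0 < v0 ;
    entry_mean : ev P b = 0 ;
    entry_var : 1 / 2 <= ev P (fun v => b v ^+ 2) ;
    entry_kurt : v0 <= ev P (fun v => b v ^+ 4) - ev P (fun v => b v ^+ 2) ^+ 2 ;
    entry_exp : ev P (fun v => expR (b v ^+ 2 / K)) <= 2 }.

Section EntryMoments.
Context (R : realType) (V : finType) (P : fdist R V) (b : V -> R) (K v0 : R).
Hypothesis lawb : entry_law P b K v0.

Let K0 : 0 < K := entry_K lawb.
Local Notation s2 := (ev P (fun v => b v ^+ 2)).

Lemma entry_moment n :
  ev P (fun v => b v ^+ (2 * n.+1)) <= 2 * (n.+1%:R * K) ^+ n.+1.
Proof.
apply: (@le_trans _ _ (ev P (fun v => (n.+1%:R * K) ^+ n.+1 * expR (b v ^+ 2 / K)))).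
  apply: ev_le => v; rewrite exprM [X in _ <= X * _]exprMn.
  have := @exprn_le_expR R n (b v ^+ 2 / K) (divr_ge0 (sqr_ge0 _) (ltW K0)).
  rewrite expr_div_n ler_pdivrMr ?exprn_gt0// => /le_trans; apply.
  by rewrite mulrAC.
rewrite evZ mulrC; apply: ler_wpM2r; last exact: entry_exp lawb.
by rewrite exprn_ge0// mulr_ge0 ?ltW.
Qed.

Lemma entry_m2 : s2 <= 2 * K.
Proof. by have := entry_moment 0; rewrite muln1 expr1 mul1r. Qed.

Lemma entry_m4 : ev P (fun v => b v ^+ 4) <= 8 * K ^+ 2.
Proof. by have := entry_moment 1; rewrite (_ : (2 * 2)%N = 4%N)// exprMn; lra. Qed.

Lemma entry_m8 : ev P (fun v => b v ^+ 8) <= 512 * K ^+ 4.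
Proof. by have := entry_moment 3; rewrite (_ : (2 * 4)%N = 8%N)// exprMn; lra. Qed.

(** If [2 * K * t ^+ 2 <= 1], use [expR x <= x + expR (2 * x ^+ 2)]: the linear term has mean zero
    and the chord bound reduces the rest to [entry_exp]. For larger [t], [t * b <= K * t ^+ 2 / 2 +
    b ^+ 2 / (2 * K)], and the remaining factor [3 / 2] is at most [expR (K * t ^+ 2)]. *)
Lemma entry_mgf (t : R) : ev P (fun v => expR (t * b v)) <= expR (2 * K * t ^+ 2).
Proof.
have K2 : 0 < 2 * K by rewrite mulr_gt0.
have b0 v : 0 <= b v ^+ 2 / K by rewrite divr_ge0 ?sqr_ge0 ?ltW.
have Kt0 : 0 <= 2 * K * t ^+ 2 by rewrite mulr_ge0 ?sqr_ge0 ?(ltW K2).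
case: (lerP (2 * K * t ^+ 2) 1) => t1.
  apply: (@le_trans _ _ (ev P (fun v => (1 - 2 * K * t ^+ 2) + t * b v +
      2 * K * t ^+ 2 * expR (b v ^+ 2 / K)))); last first.
    rewrite !evD !ev_cst !evZ (entry_mean lawb) mulr0 addr0.
    apply: le_trans (expR_ge1Dx _).
    have := ler_wpM2l Kt0 (entry_exp lawb); lra.
  apply: ev_le => v.
  have Hx : expR (t * b v) <= t * b v + expR (2 * (t * b v) ^+ 2).
    case: (lerP (t * b v) 1) => h.
      apply: le_trans (expR_le_quadratic h) _.
      have := expR_ge1Dx (2 * (t * b v) ^+ 2); lra.
    rewrite -[leLHS]add0r; apply: lerD; first lra.
    by rewrite ler_expR; nra.
  apply: le_trans Hx _.
  have := @expR_chord _ (2 * K * t ^+ 2) _ _ (b0 v).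
  rewrite t1 Kt0 => /(_ isT).
  have -> : 2 * K * t ^+ 2 * (b v ^+ 2 / K) = 2 * (t * b v) ^+ 2 by field; rewrite gt_eqF.
  lra.
apply: (@le_trans _ _ (ev P (fun v => expR (K * t ^+ 2 / 2) *
    (1 + 1 / 2 * (expR (b v ^+ 2 / K) - 1))))).
  apply: ev_le => v.
  apply: (@le_trans _ _ (expR (K * t ^+ 2 / 2) * expR (1 / 2 * (b v ^+ 2 / K)))).
    rewrite -expRD ler_expR -subr_ge0.
    have -> : K * t ^+ 2 / 2 + 1 / 2 * (b v ^+ 2 / K) - t * b v =
        (K * t - b v) ^+ 2 / (2 * K) by field; rewrite gt_eqF.
    by rewrite divr_ge0 ?sqr_ge0 ?ltW.
  by rewrite ler_pM2l ?expR_gt0//; apply: expR_chord => //; lra.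
rewrite evZ evD ev_cst evZ evB ev_cst.
have Ee := entry_exp lawb.
apply: (@le_trans _ _ (expR (K * t ^+ 2 / 2) * expR (K * t ^+ 2))).
  rewrite ler_pM2l ?expR_gt0//.
  have h1 := expR_ge1Dx (1 / 2 : R).
  have h2 : expR (1 / 2) <= expR (K * t ^+ 2) by rewrite ler_expR; lra.
  lra.
by rewrite -expRD ler_expR; nra.
Qed.

Lemma lin_mgf n l :
  Ex P n (fun s => expR (lin l (map b s))) <= expR (2 * K * lnorm l n).
Proof.
elim: n l => [|n IH] l /=; first by rewrite mulr0.
rewrite (@ev_ext _ _ P _ (fun v => expR (l 0%N * b v) *
    Ex P n (fun s => expR (lin (l \o succn) (map b s))))); last first.
  by move=> v; rewrite -ExZ; apply: Ex_ext => s _; rewrite expRD.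
rewrite evZr mulrDr expRD.
by apply: ler_pM; rewrite ?entry_mgf ?IH ?ev_ge0 ?Ex_ge0// => *; exact: expR_ge0.
Qed.

Lemma ExS n (F : seq V -> R) : Ex P n.+1 F = Ex P n (fun s => ev P (fun v => F (v :: s))).
Proof. by rewrite /= Ex_ev. Qed.

Lemma lin_mean n l : Ex P n (fun s => lin l (map b s)) = 0.
Proof.
elim: n l => [//|n IH] l; rewrite ExS /= -(IH (l \o succn)); apply: Ex_ext => s _.
by rewrite evD ev_cst evZ (entry_mean lawb) mulr0 add0r.
Qed.

Lemma lin_var n l : Ex P n (fun s => lin l (map b s) ^+ 2) = s2 * lnorm l n.
Proof.
elim: n l => [|n IH] l; first by rewrite /= mulr0 expr0n.
rewrite ExS /= mulrDr -IH -[s2 * l 0%N ^+ 2](Ex_cst P n) -ExD; apply: Ex_ext => s _.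
set c := l 0%N; set L := lin _ _.
transitivity (ev P (fun v => c ^+ 2 * b v ^+ 2 + (2 * c * L) * b v + L ^+ 2)).
  by apply: ev_ext => v; ring.
rewrite !evD ev_cst !evZ (entry_mean lawb); ring.
Qed.

(** The term [4 * a * D ^+ 3] is absorbed by [2 * a ^+ 2 * D ^+ 2 + 2 * D ^+ 4], with slack a
    square. Applied to martingale increments [D], this drives both fourth moment inductions. *)
Lemma ev_fourth_step (a : R) (D : V -> R) : ev P D = 0 ->
  ev P (fun v => (D v + a) ^+ 4) <=
  a ^+ 4 + 8 * a ^+ 2 * ev P (fun v => D v ^+ 2) + 3 * ev P (fun v => D v ^+ 4).
Proof.
move=> D0.
apply: (@le_trans _ _ (ev P (fun v => a ^+ 4 + 4 * a ^+ 3 * D v + 8 * a ^+ 2 * D v ^+ 2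
    + 3 * D v ^+ 4))).
  apply: ev_le => v; rewrite -subr_ge0.
  have -> : a ^+ 4 + 4 * a ^+ 3 * D v + 8 * a ^+ 2 * D v ^+ 2 + 3 * D v ^+ 4 -
    (D v + a) ^+ 4 = 2 * (D v * (a - D v)) ^+ 2 by ring.
  by rewrite mulr_ge0 ?sqr_ge0.
by rewrite !evD ev_cst !evZ D0 mulr0 addr0.
Qed.

Lemma lin_fourth n l : Ex P n (fun s => lin l (map b s) ^+ 4) <= (5 * K * lnorm l n) ^+ 2.
Proof.
elim: n l => [|n IH] l; first by rewrite /= mulr0 !expr0n.
rewrite ExS /=; set c := l 0%N; set S := lnorm _ n.
apply: (@le_trans _ _ (Ex P n (fun s => lin (l \o succn) (map b s) ^+ 4 +
    8 * c ^+ 2 * (2 * K) * lin (l \o succn) (map b s) ^+ 2 + 24 * K ^+ 2 * c ^+ 4))).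
  apply: Ex_le => s _; set L := lin _ _.
  apply: le_trans (@ev_fourth_step L (fun v => c * b v) _) _.
    by rewrite evZ (entry_mean lawb) mulr0.
  rewrite (@ev_ext _ _ P _ (fun v => c ^+ 2 * b v ^+ 2)); last by move=> v; rewrite exprMn.
  rewrite [X in _ + 3 * X](@ev_ext _ _ P _ (fun v => c ^+ 4 * b v ^+ 4)); last by move=> v; rewrite exprMn.
  rewrite !evZ.
  have h1 := ler_wpM2l (mulr_ge0 (sqr_ge0 L) (sqr_ge0 c)) entry_m2.
  have h2 := ler_wpM2l (exprn_even_ge0 c (isT : ~~ odd 4)) entry_m4.
  lra.
rewrite !ExD ExZ Ex_cst lin_var.
have S0 : 0 <= S by exact: lnorm_ge0.
have := IH (l \o succn); rewrite -/S.
have h1 := ler_wpM2l (mulr_ge0 (mulr_ge0 (sqr_ge0 c) (ltW K0)) S0) entry_m2.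
have : 0 <= K ^+ 2 * (c ^+ 2 * S) by nonneg.
have : 0 <= K ^+ 2 * c ^+ 4 by nonneg.
rewrite !exprMn; nra.
Qed.

Definition quad0 (H : nat -> nat -> R) n (y : seq R) : R := quad H y - s2 * qtrace H n.

(** The bracket is a martingale increment: for a fixed tail [y], its mean over the first entry is
    zero. *)
Lemma quad0_cons H n x y : quad0 H n.+1 (x :: y) =
  (H 0%N 0%N * (x ^+ 2 - s2) + 2 * x * lin (fun j => H 0%N j.+1) y) +
  quad0 (fun i j => H i.+1 j.+1) n y.
Proof. rewrite /quad0 /=; ring. Qed.

Let increment_mean (c L : R) :
  ev P (fun v => c * (b v ^+ 2 - s2) + 2 * b v * L) = 0.
Proof.
rewrite evD evZ evB ev_cst subrr mulr0 add0r evZr evZ (entry_mean lawb).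
by rewrite mulr0 mul0r.
Qed.

Let centered_square2 : ev P (fun v => (b v ^+ 2 - s2) ^+ 2) = ev P (fun v => b v ^+ 4) - s2 ^+ 2.
Proof.
transitivity (ev P (fun v => b v ^+ 4 - 2 * s2 * b v ^+ 2 + s2 ^+ 2)).
  by apply: ev_ext => v; ring.
by rewrite evD evB evZ ev_cst; ring.
Qed.

Lemma quad0_mean n H : Ex P n (fun s => quad0 H n (map b s)) = 0.
Proof.
elim: n H => [|n IH] H; first by rewrite /= /quad0 /= mulr0 subr0.
rewrite ExS /= -(IH (fun i j => H i.+1 j.+1)); apply: Ex_ext => s _.
rewrite (ev_ext _ (fun v => quad0_cons _ _ _ _)) evD ev_cst.
by rewrite increment_mean add0r.
Qed.

(** Increments are orthogonal, so their second moments add. One of them contributes [c ^+ 2] times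
    the variance of [b ^+ 2], at least [v0], and [4 * s2 ^+ 2 * lnorm l n], at least [lnorm l n];
    the third moment [m3] multiplies a linear form of mean zero. The cap [1 / 2] on [kap] matches
    the factor 2 before [lnorm] in [qnorm]. *)
Lemma quad0_var_ge n H :
  Num.min v0 (1 / 2) * qnorm H n <= Ex P n (fun s => quad0 H n (map b s) ^+ 2).
Proof.
set kap := Num.min _ _.
have kv : kap <= v0 by rewrite ge_min lexx.
have k2 : kap <= 1 / 2 by rewrite ge_min lexx orbT.
elim: n H => [|n IH] H; first by rewrite /= mulr0 sqr_ge0.
rewrite ExS /=; set c := H 0%N 0%N; set l := fun j => H 0%N j.+1.
have {IH} := IH (fun i j => H i.+1 j.+1).
set H' := fun i j => H i.+1 j.+1 => IH.
pose m3 := ev P (fun v => b v * (b v ^+ 2 - s2)).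
apply: (@le_trans _ _ (Ex P n (fun s => c ^+ 2 * ev P (fun v => (b v ^+ 2 - s2) ^+ 2) +
   4 * c * m3 * lin l (map b s) + 4 * s2 * lin l (map b s) ^+ 2 +
   quad0 H' n (map b s) ^+ 2))); last first.
  apply: Ex_le => s _; rewrite /= [leRHS](@ev_ext _ _ P _ (fun v =>
    c ^+ 2 * (b v ^+ 2 - s2) ^+ 2 + 4 * c * lin l (map b s) * (b v * (b v ^+ 2 - s2)) +
    4 * lin l (map b s) ^+ 2 * b v ^+ 2 +
    2 * quad0 H' n (map b s) * (c * (b v ^+ 2 - s2) + 2 * b v * lin l (map b s)) +
    quad0 H' n (map b s) ^+ 2)); last first.
    by move=> v; rewrite quad0_cons -/c -/l -/H'; ring.
  rewrite !evD ev_cst !evZ increment_mean -/m3.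
  by rewrite mulr0 addr0; lra.
rewrite !ExD Ex_cst !ExZ lin_mean lin_var mulr0 addr0 centered_square2.
have := ler_wpM2l (sqr_ge0 c) (entry_kurt lawb).
have := ler_wpM2l (sqr_ge0 c) kv.
have l0 := lnorm_ge0 l n.
have : kap * lnorm l n <= 1 / 2 * lnorm l n by rewrite ler_wpM2r.
have : 1 / 4 * lnorm l n <= s2 ^+ 2 * lnorm l n.
  rewrite ler_wpM2r//; have := entry_var lawb; nra.
rewrite -/(lnorm l n) -/(qnorm H' n) -/H'; lra.
Qed.

(** Induction by [ev_fourth_step] with [a] the form in the tail. Cauchy-Schwarz splits the mixed
    moments into the inductive bound and [lin_fourth]; 320 is generous enough for each coefficient
    to fit in the expanded square. *)
Lemma quad0_fourth n H :
  Ex P n (fun s => quad0 H n (map b s) ^+ 4) <= (320 * K ^+ 2 * qnorm H n) ^+ 2.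
Proof.
elim: n H => [|n IH] H; first by rewrite /= /quad0 /= !mulr0 subr0 !expr0n.
rewrite ExS /=; set c := H 0%N 0%N; set l := fun j => H 0%N j.+1.
have {IH} := IH (fun i j => H i.+1 j.+1).
set H' := fun i j => H i.+1 j.+1 => IH.
have m2 := entry_m2; have m4 := entry_m4; have m8 := entry_m8.
have s20 : 0 <= s2 by apply: ev_ge0 => v; exact: sqr_ge0.
have cs2 : ev P (fun v => (b v ^+ 2 - s2) ^+ 2) <= 8 * K ^+ 2.
  by rewrite centered_square2; have := sqr_ge0 s2; lra.
have cs4 : ev P (fun v => (b v ^+ 2 - s2) ^+ 4) <= (66 * 64) * K ^+ 4.
  apply: (@le_trans _ _ (ev P (fun v => 8 * b v ^+ 8 + 8 * (2 * K) ^+ 4))).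
    apply: ev_le => v.
    have : s2 ^+ 4 <= (2 * K) ^+ 4 by apply: lerXn2r => //; rewrite nnegrE; nonneg.
    have -> : b v ^+ 8 = (b v ^+ 2) ^+ 4 by rewrite -exprM.
    move: (b v ^+ 2) (s2) => x y.
    have : 0 <= 8 * x ^+ 4 + 8 * y ^+ 4 - (x - y) ^+ 4.
      have -> : 8 * x ^+ 4 + 8 * y ^+ 4 - (x - y) ^+ 4 =
        (x + y) ^+ 2 * (7 * x ^+ 2 + 7 * y ^+ 2 - 10 * x * y) by ring.
      rewrite mulr_ge0 ?sqr_ge0//; have := sqr_ge0 (x - y); have := sqr_ge0 x; have := sqr_ge0 y; nra.
    lra.
  by rewrite evD evZ ev_cst exprMn; lra.
apply: (@le_trans _ _ (Ex P n (fun s => quad0 H' n (map b s) ^+ 4 +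
   128 * K ^+ 2 * c ^+ 2 * (quad0 H' n (map b s) ^+ 2 * 1) +
   128 * K * (quad0 H' n (map b s) ^+ 2 * lin l (map b s) ^+ 2) +
   ((24 * 66 * 64) * K ^+ 4 * c ^+ 4 + (24 * 128) * K ^+ 2 * lin l (map b s) ^+ 4)))).
  apply: Ex_le => s _; rewrite /=.
  rewrite (ev_ext P (fun v => congr1 (fun z => z ^+ 4) (quad0_cons _ _ _ _))) -/c -/l -/H'.
  apply: le_trans (@ev_fourth_step _ _ (increment_mean _ _)) _.
  set L := lin _ _; set Q := quad0 _ _ _.
  have h2 : ev P (fun v => (c * (b v ^+ 2 - s2) + 2 * b v * L) ^+ 2) <=
      16 * K ^+ 2 * c ^+ 2 + 16 * K * L ^+ 2.
    apply: (@le_trans _ _ (ev P (fun v => 2 * c ^+ 2 * (b v ^+ 2 - s2) ^+ 2 +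
        8 * L ^+ 2 * b v ^+ 2))).
      apply: ev_le => v; move: (b v) (b v ^+ 2 - s2) => y x.
      have := sqr_ge0 (c * x - 2 * y * L); lra.
    rewrite evD !evZ.
    have := ler_wpM2l (sqr_ge0 c) cs2; have := ler_wpM2l (sqr_ge0 L) m2; lra.
  have h4 : ev P (fun v => (c * (b v ^+ 2 - s2) + 2 * b v * L) ^+ 4) <=
      (8 * 66 * 64) * K ^+ 4 * c ^+ 4 + (8 * 128) * K ^+ 2 * L ^+ 4.
    apply: (@le_trans _ _ (ev P (fun v => 8 * c ^+ 4 * (b v ^+ 2 - s2) ^+ 4 +
        128 * L ^+ 4 * b v ^+ 4))).
      apply: ev_le => v; move: (b v) (b v ^+ 2 - s2) => y x.
      have : 0 <= (c * x - 2 * y * L) ^+ 2 *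
          (7 * (c * x) ^+ 2 + 7 * (2 * y * L) ^+ 2 + 10 * (c * x) * (2 * y * L)).
        rewrite mulr_ge0 ?sqr_ge0//; move: (c * x) (2 * y * L) => u z.
        by have := sqr_ge0 (u + z); have := sqr_ge0 u; have := sqr_ge0 z; nra.
      lra.
    rewrite evD !evZ.
    have := ler_wpM2l (exprn_even_ge0 c (isT : ~~ odd 4)) cs4.
    have := ler_wpM2l (exprn_even_ge0 L (isT : ~~ odd 4)) m4; lra.
  have := ler_wpM2l (sqr_ge0 Q) h2; lra.
rewrite !ExD !ExZ Ex_cst.
have N0 := qnorm_ge0 H' n; have S0 := lnorm_ge0 l n.
set N := qnorm H' n in IH N0 *; set S := lnorm l n in S0 *.
have K2 : 0 <= 320 * K ^+ 2 * N by nonneg.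
have Q4 : Ex P n (fun s => (quad0 H' n (map b s) ^+ 2) ^+ 2) <= (320 * K ^+ 2 * N) ^+ 2.
  by apply: le_trans IH; apply: Ex_le => s _; rewrite -exprM.
have L4 : Ex P n (fun s => (lin l (map b s) ^+ 2) ^+ 2) <= (5 * K * S) ^+ 2.
  by apply: le_trans (lin_fourth n l); apply: Ex_le => s _; rewrite -exprM.
have h1 : Ex P n (fun s => quad0 H' n (map b s) ^+ 2 * 1) <= 320 * K ^+ 2 * N * 1.
  by apply: Ex_cauchy_schwarz => //; rewrite Ex_cst.
have h2 : Ex P n (fun s => quad0 H' n (map b s) ^+ 2 * lin l (map b s) ^+ 2) <=
    320 * K ^+ 2 * N * (5 * K * S).
  by apply: Ex_cauchy_schwarz => //; nonneg.
have h3 := lin_fourth n l.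
have {}h1 := ler_wpM2l (mulr_ge0 (sqr_ge0 K) (sqr_ge0 c)) h1.
have {}h2 := ler_wpM2l (ltW K0) h2.
have {}h3 := ler_wpM2l (sqr_ge0 K) h3.
rewrite -/S in h3.
have p1 : 0 <= K ^+ 4 * (N * c ^+ 2) by nonneg.
have p2 : 0 <= K ^+ 4 * (N * S) by nonneg.
have p3 : 0 <= K ^+ 4 * c ^+ 4 by nonneg.
have p4 : 0 <= K ^+ 4 * S ^+ 2 by nonneg.
have p5 : 0 <= K ^+ 4 * (c ^+ 2 * S) by nonneg.
apply: (@le_trans _ _ ((320 * K ^+ 2 * N) ^+ 2 + 128 * 320 * (K ^+ 4 * (N * c ^+ 2)) +
  128 * 5 * 320 * (K ^+ 4 * (N * S)) + (24 * 66 * 64) * (K ^+ 4 * c ^+ 4) +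
  (24 * 128) * 25 * (K ^+ 4 * S ^+ 2))).
  by rewrite !exprMn in IH h1 h2 h3 *; lra.
have -> : (320 * K ^+ 2 * (c ^+ 2 + 2 * S + N)) ^+ 2 =
   (320 * K ^+ 2 * N) ^+ 2 + (320 * 320) * (K ^+ 4 * c ^+ 4 + 4 * (K ^+ 4 * S ^+ 2) +
   2 * (K ^+ 4 * (N * c ^+ 2)) + 4 * (K ^+ 4 * (N * S)) + 4 * (K ^+ 4 * (c ^+ 2 * S))).
  by ring.
lra.
Qed.

End EntryMoments.

(** * Small-ball estimate and exponential moments of squares *)

Section SmallBall.
Context (R : realType).

Definition kapc (v0 : R) : R := Num.min v0 (1 / 2).
Definition fourc (K v0 : R) : R := 8 + 8 * (320 * K ^+ 2) ^+ 2 / kapc v0 ^+ 2.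
Definition ballc (K v0 : R) : R := Num.min (fourc K v0)^-1 (kapc v0 / 2).
(** If [lnorm l n <= 4], the moment generating function of the linear form is at most
    [expR (8 * K * t ^+ 2)]. At [t = alphac K * k] this uses up half of the decay
    [alphac K * k ^+ 2 / 2] in [lin_sqexp], and the other half leaves the geometric series summed in
    [sqexpc]. *)
Definition alphac (K : R) : R := (32 * K)^-1.
Definition sqexpc (K : R) : R := expR (alphac K / 2) * (2 / (1 - expR (- (alphac K / 4)))).
Definition mgfc (K : R) : R := 32 * sqexpc K / (alphac K / 4) ^+ 2.

Lemma kapc_gt0 v0 : 0 < v0 -> 0 < kapc v0.
Proof. by move=> h; rewrite lt_min h; lra. Qed.

Lemma fourc_gt0 K v0 : 0 < fourc K v0.
Proof.
apply: ltr_pwDl => //; apply: divr_ge0; last exact: sqr_ge0.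
by apply: mulr_ge0 => //; exact: sqr_ge0.
Qed.

Lemma ballc_gt0 K v0 : 0 < v0 -> 0 < ballc K v0.
Proof. by move=> h; rewrite lt_min invr_gt0 fourc_gt0 divr_gt0 ?kapc_gt0. Qed.

Lemma ballc_le1 K v0 : ballc K v0 <= 1.
Proof.
have : kapc v0 <= 1 / 2 by rewrite ge_min lexx orbT.
have : ballc K v0 <= kapc v0 / 2 by rewrite ge_min lexx orbT.
lra.
Qed.

Lemma alphac_gt0 K : 0 < K -> 0 < alphac K.
Proof. by move=> K0; rewrite invr_gt0 mulr_gt0. Qed.

Lemma sqexpc_gt0 K : 0 < K -> 0 < sqexpc K.
Proof.
move=> K0; rewrite mulr_gt0 ?expR_gt0// divr_gt0// subr_gt0 expR_lt1 oppr_lt0.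
by rewrite divr_gt0 ?alphac_gt0.
Qed.

Lemma mgfc_gt0 K : 0 < K -> 0 < mgfc K.
Proof.
move=> K0; have a0 := alphac_gt0 K0; have s0 := sqexpc_gt0 K0.
by apply: divr_gt0; [exact: mulr_gt0|apply: exprn_gt0; exact: divr_gt0].
Qed.

Lemma lin_scale (t : R) l y : lin (fun j => t * l j) y = t * lin l y.
Proof.
elim: y l => [|x y IH] l /=; first by rewrite mulr0.
by rewrite mulrDr mulrA -IH.
Qed.

Lemma lnorm_scale (t : R) l n : lnorm (fun j => t * l j) n = t ^+ 2 * lnorm l n.
Proof.
elim: n l => [|n IH] l /=; first by rewrite mulr0.
by rewrite mulrDr exprMn -IH.
Qed.

Context (V : finType) (P : fdist R V) (b : V -> R) (K v0 : R).
Hypothesis lawb : entry_law P b K v0.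
Let K0 : 0 < K := entry_K lawb.
Let v00 : 0 < v0 := entry_v0 lawb.

(* Paley-Zygmund: [min q 1 >= t q - t^2 q^2 / 4] for [0 <= t <= 1], with [t] of order
   the inverse of the second moment *)
Lemma small_ball n H : qnorm H n = 1 ->
  ballc K v0 <= Ex P n (fun s => Num.min `|quad H (map b s)| 1).
Proof.
move=> H1.
set s2 := ev P (fun v => b v ^+ 2); pose tau := s2 * qtrace H n.
set Y := fun s => quad H (map b s).
pose m2 := Ex P n (fun s => Y s ^+ 2).
have YE s : Y s = tau + quad0 P b H n (map b s) by rewrite /quad0 -/s2 addrC subrK.
have kap0 := kapc_gt0 v00; set kap := kapc v0 in kap0.
have F0 := fourc_gt0 K v0; set C1 := fourc K v0 in F0.
have m2E : m2 = tau ^+ 2 + Ex P n (fun s => quad0 P b H n (map b s) ^+ 2).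
  transitivity (Ex P n (fun s => tau ^+ 2 + 2 * tau * quad0 P b H n (map b s) +
      quad0 P b H n (map b s) ^+ 2)).
    by apply: Ex_ext => s _; rewrite YE; ring.
  by rewrite !ExD Ex_cst ExZ (quad0_mean lawb) mulr0 addr0.
have m2k : tau ^+ 2 + kap <= m2.
  by rewrite m2E lerD2l; have := quad0_var_ge lawb n H; rewrite H1 mulr1.
have m4 : Ex P n (fun s => Y s ^+ 4) <= C1 * m2 ^+ 2.
  apply: (@le_trans _ _ (Ex P n (fun s => 8 * tau ^+ 4 + 8 * quad0 P b H n (map b s) ^+ 4))).
    apply: Ex_le => s _; rewrite YE.
    suff gen (x y : R) : (y + x) ^+ 4 <= 8 * y ^+ 4 + 8 * x ^+ 4 by exact: gen.
    have : 0 <= (x - y) ^+ 2 * (7 * x ^+ 2 + 7 * y ^+ 2 + 10 * x * y).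
      rewrite mulr_ge0 ?sqr_ge0//.
      by have := sqr_ge0 (x + y); have := sqr_ge0 x; have := sqr_ge0 y; nra.
    lra.
  rewrite ExD Ex_cst ExZ; have := quad0_fourth lawb n H; rewrite H1 mulr1.
  set A := (320 * K ^+ 2) ^+ 2 => hA.
  apply: (@le_trans _ _ (C1 * (tau ^+ 4 + kap ^+ 2))).
    rewrite /C1 /fourc -/A -/kap.
    have -> : (8 + 8 * A / kap ^+ 2) * (tau ^+ 4 + kap ^+ 2) =
        8 * tau ^+ 4 + 8 * A + 8 * kap ^+ 2 + 8 * A / kap ^+ 2 * tau ^+ 4.
      by field; rewrite gt_eqF.
    have : 0 <= 8 * A / kap ^+ 2 * tau ^+ 4.
      by rewrite mulr_ge0 ?exprn_even_ge0// divr_ge0 ?sqr_ge0// mulr_ge0 ?sqr_ge0.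
    have := sqr_ge0 kap; lra.
  rewrite ler_pM2l//; have t0 := sqr_ge0 tau.
  have : (tau ^+ 2 + kap) ^+ 2 <= m2 ^+ 2 by apply: lerXn2r => //; rewrite nnegrE; lra.
  have : 0 <= tau ^+ 2 * kap by apply: mulr_ge0 => //; exact: ltW.
  have -> : tau ^+ 4 = (tau ^+ 2) ^+ 2 by rewrite -exprM.
  nra.
have key t : 0 <= t <= 1 -> t * m2 - t ^+ 2 / 4 * (C1 * m2 ^+ 2) <=
    Ex P n (fun s => Num.min `|Y s| 1).
  move=> /andP[t0 t1].
  apply: (@le_trans _ _ (Ex P n (fun s => t * Y s ^+ 2 - t ^+ 2 / 4 * Y s ^+ 4))).
    by rewrite ExB !ExZ lerB// ler_wpM2l// divr_ge0 ?sqr_ge0.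
  apply: Ex_le => s _; have -> : Y s ^+ 4 = (Y s ^+ 2) ^+ 2 by rewrite -exprM.
  set q := Y s ^+ 2; have q0 : 0 <= q by exact: sqr_ge0.
  have qN : q = `|Y s| ^+ 2 by rewrite real_normK ?num_real.
  have y0 := normr_ge0 (Y s); set y := `|Y s| in qN y0 *.
  rewrite le_min; apply/andP; split; last by have := sqr_ge0 (1 - t * q / 2); nra.
  case: (lerP y 1) => y1.
    have : t * q <= q by rewrite ler_piMl.
    have : q <= y by rewrite qN; nra.
    have : 0 <= t ^+ 2 / 4 * q ^+ 2 by rewrite mulr_ge0 ?sqr_ge0// divr_ge0 ?sqr_ge0.
    lra.
  by have := sqr_ge0 (1 - t * q / 2); nra.
have m20 : 0 < m2 by have := sqr_ge0 tau; lra.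
(* The parabola in [t] peaks at [2 / (C1 * m2)] with value [C1^-1]. If the peak lies beyond 1,
   [t = 1] still gives [m2 / 2 >= kap / 2]. *)
case: (lerP (C1 * m2) 2) => h.
  apply: le_trans (key 1 _); last by lra.
  apply: (@le_trans _ _ (kap / 2)); first by rewrite ge_min lexx orbT.
  have : C1 * m2 * m2 <= 2 * m2 by rewrite ler_pM2r.
  have := sqr_ge0 tau; rewrite expr2 expr1n; nra.
apply: le_trans (key (2 / (C1 * m2)) _); last first.
  have C0 : 0 < C1 * m2 by exact: mulr_gt0.
  apply/andP; split; first by rewrite divr_ge0// ltW.
  by rewrite ler_pdivrMr// mul1r ltW.
have -> : 2 / (C1 * m2) * m2 - (2 / (C1 * m2)) ^+ 2 / 4 * (C1 * m2 ^+ 2) = C1^-1.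
  by field; rewrite !gt_eqF.
by rewrite ge_min lexx.
Qed.

Lemma lin_sqexp n l : lnorm l n <= 4 ->
  Ex P n (fun s => expR (alphac K / 4 * lin l (map b s) ^+ 2)) <= sqexpc K.
Proof.
move=> l4; set al := alphac K.
have al0 : 0 < al by exact: alphac_gt0.
set L := fun s => lin l (map b s).
pose M := (\max_(t : n.-tuple V) (Num.truncn `|L t|)).+1.
pose T k (s : seq V) := expR (- (al * k%:R ^+ 2 / 2)) *
  (expR (al * k%:R * L s) + expR (- (al * k%:R) * L s)).
(* [expR (al / 4 * L ^+ 2)] is dominated by the single term [k = floor |L|], and each term
   only involves the moment generating function of [L]. *)
apply: (@le_trans _ _ (Ex P n (fun s => expR (al / 2) * \sum_(k < M) T k s))).
  apply: Ex_le => s sn.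
  pose k := Num.truncn `|L s|.
  have kM : (k < M)%N.
    rewrite ltnS /k; have -> : s = Tuple (introT eqP sn) by [].
    exact: (@leq_bigmax _ (fun t : n.-tuple V => Num.truncn `|L t|)).
  have T0 j : 0 <= T j s by rewrite mulr_ge0 ?addr_ge0 ?expR_ge0.
  apply: (@le_trans _ _ (expR (al / 2) * T k s)); last first.
    rewrite ler_pM2l ?expR_gt0// (bigD1 (Ordinal kM))//= lerDl.
    by apply: sumr_ge0 => j _.
  have /andP[k1 k2] := truncn_itv (normr_ge0 (L s)).
  rewrite -/k in k1 k2.
  have Lk : expR (al * k%:R * `|L s|) <=
      expR (al * k%:R * L s) + expR (- (al * k%:R) * L s).
    have e1 := expR_ge0 (al * k%:R * L s).
    have e2 := expR_ge0 (- (al * k%:R) * L s).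
    case: (ger0P (L s)) => _; first lra.
    by rewrite mulrN -mulNr; lra.
  (* As [k <= |L| <= k + 1], the exponents compare by [(k + 1) ^+ 2 / 4 <= 1 / 2 + k ^+ 2 / 2]; this
     is the origin of the prefactor [expR (al / 2)]. *)
  apply: (@le_trans _ _ (expR (al / 2) * (expR (- (al * k%:R ^+ 2 / 2)) *
      expR (al * k%:R * `|L s|)))).
    rewrite -!expRD ler_expR.
    have : L s ^+ 2 <= (k%:R + 1) ^+ 2.
      rewrite -real_normK ?num_real// natr1; apply: lerXn2r; rewrite ?nnegrE//.
      exact: ltW.
    have : k%:R * k%:R <= k%:R * `|L s| by rewrite ler_wpM2l.
    have := sqr_ge0 (k%:R - 1 : R).
    move=> h0 h1 h2.
    have := ler_wpM2l (ltW al0) h1; have := ler_wpM2l (ltW al0) h2.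
    have := ler_wpM2l (ltW al0) h0.
    by rewrite -/(L s); lra.
  by rewrite ler_pM2l ?expR_gt0// ler_pM2l ?expR_gt0.
rewrite ExZ /sqexpc -/al ler_pM2l ?expR_gt0// Ex_sum.
set q := expR (- (al / 4)).
have q1 : q < 1 by rewrite expR_lt1 oppr_lt0 divr_gt0.
have q0 : 0 <= q by exact: expR_ge0.
apply: (@le_trans _ _ (\sum_(k < M) 2 * q ^+ k)).
  apply: ler_sum => k _; rewrite ExZ ExD.
  have bd (t : R) : Ex P n (fun s => expR (t * L s)) <= expR (8 * K * t ^+ 2).
    apply: (@le_trans _ _ (expR (2 * K * lnorm (fun j => t * l j) n))).
      apply: le_trans (lin_mgf lawb n (fun j => t * l j)).
      by apply: Ex_le => s _; rewrite lin_scale.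
    rewrite ler_expR lnorm_scale.
    have := ler_wpM2l (mulr_ge0 (ltW K0) (sqr_ge0 t)) l4; lra.
  have h1 := bd (al * k%:R); have h2 := bd (- (al * k%:R)).
  rewrite sqrrN in h2.
  apply: (@le_trans _ _ (expR (- (al * k%:R ^+ 2 / 2)) *
      (2 * expR (8 * K * (al * k%:R) ^+ 2)))).
    by rewrite ler_pM2l ?expR_gt0//; lra.
  rewrite mulrCA ler_pM2l// -expRD -expRM_natr ler_expR.
  have alK : 8 * K * (al * k%:R) ^+ 2 = al * k%:R ^+ 2 / 4.
    by rewrite /al /alphac; field; rewrite gt_eqF.
  rewrite alK.
  have kk : (k : nat)%:R <= (k : nat)%:R ^+ 2 :> R.
    by rewrite -natrX ler_nat; case: (k : nat) => // j; rewrite expnS expn1 leq_pmulr.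
  have := ler_wpM2l (ltW al0) kk; lra.
rewrite -mulr_sumr ler_pM2l// -[leRHS]mul1r ler_pdivlMr ?subr_gt0//.
rewrite mulrC -[1 - q]opprB mulNr -subrX1 opprB.
by rewrite gerBl exprn_ge0.
Qed.

(** Averaging over the sign cancels the first-order term, so the excess over 1 is of order
    [(th * Y) ^+ 2 * expR (th * Y)]. Since [th <= c / 2], the factors [Y ^+ 2] and [expR (th * Y)]
    each cost one [expR (c / 2 * Y)], and [lin_sqexp] concludes. *)
Lemma sign_square_mgf n l th : lnorm l n <= 4 -> 0 <= th -> th <= alphac K / 8 ->
  Ex P n (fun s => (expR (th * lin l (map b s) ^+ 2) +
                    expR (- th * lin l (map b s) ^+ 2)) / 2) <= expR (mgfc K * th ^+ 2).
Proof.
move=> l4 th0 th8; set c := alphac K / 4.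
have c0 : 0 < c by rewrite divr_gt0 ?alphac_gt0.
apply: (@le_trans _ _ (Ex P n (fun s => 1 + 32 / c ^+ 2 * th ^+ 2 *
    expR (c * lin l (map b s) ^+ 2)))); last first.
  rewrite ExD Ex_cst ExZ; apply: le_trans (expR_ge1Dx _); rewrite lerD2l.
  rewrite /mgfc -/c; have := lin_sqexp l4; rewrite -/c => h.
  have := ler_wpM2l (_ : 0 <= 32 / c ^+ 2 * th ^+ 2) h.
  rewrite mulr_ge0 ?sqr_ge0 ?divr_ge0 ?sqr_ge0// => /(_ isT); lra.
apply: Ex_le => s _; set Y := lin _ _ ^+ 2.
have Y0 : 0 <= Y by exact: sqr_ge0.
have tY : 0 <= th * Y by rewrite mulr_ge0.
have e1 : 1 <= expR (th * Y) by have := expR_ge1Dx (th * Y); lra.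
apply: (@le_trans _ _ (1 + 2 * (th * Y) ^+ 2 * expR (th * Y))).
  case: (lerP (th * Y) 1) => h1.
    have := expR_le_quadratic h1.
    have := @expR_le_quadratic _ (- th * Y) _.
    have hm : - th * Y <= 1 by rewrite mulNr; lra.
    move=> /(_ hm); have := ler_wpM2l (sqr_ge0 (th * Y)) e1; lra.
  have : expR (- th * Y) <= 1 by rewrite expR_le1 mulNr oppr_le0.
  have : 1 * expR (th * Y) <= (th * Y) ^+ 2 * expR (th * Y).
    by rewrite ler_wpM2r ?expR_ge0//; nra.
  lra.
rewrite lerD2l.
have h2 := @exprn_le_expR R 1 (c / 2 * Y) (mulr_ge0 (divr_ge0 (ltW c0) (ler0n _ 2)) Y0).
have hY : Y ^+ 2 <= 16 / c ^+ 2 * expR (c / 2 * Y).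
  rewrite mulrAC ler_pdivlMr ?exprn_gt0//.
  by rewrite exprMn expr_div_n in h2; lra.
apply: (@le_trans _ _ (2 * th ^+ 2 * (16 / c ^+ 2 * expR (c / 2 * Y)) * expR (c / 2 * Y))).
  have -> : 2 * (th * Y) ^+ 2 * expR (th * Y) = 2 * th ^+ 2 * Y ^+ 2 * expR (th * Y) by ring.
  apply: ler_pM; [by nonneg|exact: expR_ge0|apply: ler_wpM2l => //; by nonneg|].
  by rewrite ler_expR ler_wpM2r// /c; lra.
have -> : expR (c * Y) = expR (c / 2 * Y) * expR (c / 2 * Y).
  by rewrite -expRD; congr expR; lra.
lra.
Qed.

End SmallBall.

(** * Positive semidefinite matrices and rounding of vectors *)

Section QuadraticForms.
Context (R : realType) (n : nat).
Implicit Types (W S G H : 'M[R]_n) (f g v : 'I_n -> R).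

Definition bf W f g : R := \sum_i \sum_j f i * W i j * g j.
Definition mdot W H : R := \sum_i \sum_j W i j * H i j.
Definition delta (i : 'I_n) : 'I_n -> R := fun j => (j == i)%:R.
Definition sqn f : R := \sum_j f j ^+ 2.

Lemma sqn_ge0 f : 0 <= sqn f.
Proof. by apply: sumr_ge0 => j _; exact: sqr_ge0. Qed.

Lemma bf_ext W f f' g g' : f =1 f' -> g =1 g' -> bf W f g = bf W f' g'.
Proof. by move=> ff gg; apply: eq_bigr => i _; apply: eq_bigr => j _; rewrite ff gg. Qed.

Lemma bfDl W f f' g : bf W (fun i => f i + f' i) g = bf W f g + bf W f' g.
Proof.
rewrite -big_split; apply: eq_bigr => i _; rewrite -big_split; apply: eq_bigr => j _ /=.
by ring.
Qed.

Lemma bfDr W f g g' : bf W f (fun i => g i + g' i) = bf W f g + bf W f g'.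
Proof.
rewrite -big_split; apply: eq_bigr => i _; rewrite -big_split; apply: eq_bigr => j _ /=.
by ring.
Qed.

Lemma bfZl W c f g : bf W (fun i => c * f i) g = c * bf W f g.
Proof.
rewrite mulr_sumr; apply: eq_bigr => i _; rewrite mulr_sumr; apply: eq_bigr => j _.
by rewrite !mulrA.
Qed.

Lemma bfZr W c f g : bf W f (fun i => c * g i) = c * bf W f g.
Proof.
rewrite mulr_sumr; apply: eq_bigr => i _; rewrite mulr_sumr; apply: eq_bigr => j _.
by ring.
Qed.

Lemma bf_sym W f g : W^T = W -> bf W f g = bf W g f.
Proof.
move=> WT; rewrite /bf exchange_big; apply: eq_bigr => i _; apply: eq_bigr => j _ /=.
by rewrite -[in LHS]WT mxE; ring.
Qed.

Lemma sum_delta (F : 'I_n -> R) i : \sum_j delta i j * F j = F i.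
Proof.
rewrite (bigD1 i)//= /delta eqxx mul1r big1 ?addr0// => j /negbTE ->.
by rewrite mul0r.
Qed.

Lemma bf_deltal W i g : bf W (delta i) g = \sum_j W i j * g j.
Proof.
rewrite /bf -(sum_delta (fun i => \sum_j W i j * g j)); apply: eq_bigr => l _.
by rewrite mulr_sumr; apply: eq_bigr => j _; rewrite mulrA.
Qed.

Lemma bf_delta W i j : bf W (delta i) (delta j) = W i j.
Proof.
by rewrite bf_deltal -(sum_delta (W i)); apply: eq_bigr => l _; rewrite mulrC.
Qed.

Lemma bf_shift W v i d : W^T = W ->
  bf W (fun j => v j + d * delta i j) (fun j => v j + d * delta i j) =
  bf W v v + 2 * d * bf W (delta i) v + d ^+ 2 * W i i.
Proof.
move=> WT; rewrite bfDl !bfDr !bfZl !bfZr bf_delta (bf_sym v)//; ring.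
Qed.

Lemma bfB W H f g : bf (W - H) f g = bf W f g - bf H f g.
Proof.
rewrite -sumrB; apply: eq_bigr => i _; rewrite -sumrB; apply: eq_bigr => j _.
by rewrite !mxE; ring.
Qed.

Lemma psdP S : psd S <-> S^T = S /\ forall v, 0 <= bf S v v.
Proof.
have E (u : 'cV[R]_n) : (u^T *m S *m u) ord0 ord0 = bf S (fun i => u i ord0) (fun i => u i ord0).
  rewrite mxE /bf exchange_big; apply: eq_bigr => j _; rewrite mxE mulr_suml.
  by apply: eq_bigr => i _; rewrite mxE.
split=> -[ST S0]; split=> // v; last by rewrite E.
have := S0 (\col_i v i); rewrite E.
by rewrite (@bf_ext S _ v _ v)// => i; rewrite mxE.
Qed.

Lemma psd_diag_ge0 S i : psd S -> 0 <= S i i.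
Proof. by move=> /psdP[_ /(_ (delta i))]; rewrite bf_delta. Qed.

Lemma psd_diag0 S i : psd S -> S i i = 0 -> forall j, S i j = 0.
Proof.
move=> /psdP[ST S0] Sii j; apply/eqP; apply/negP => /negP Sij.
(* As [S i i = 0], the form is affine in the coefficient of [delta i]; this coefficient makes it
   equal to -1. *)
have := S0 (fun l => delta j l + (- (S j j + 1) / (2 * S i j)) * delta i l).
rewrite bf_shift// !bf_delta Sii mulr0 addr0.
have -> : S j j + 2 * (- (S j j + 1) / (2 * S i j)) * S i j = -1 by field.
by rewrite ler0N1.
Qed.

(** Minimizing the form of [S] over shifts of [v] along [delta i] yields the form of the Schur
    complement at [v]. *)
Lemma psd_schur_complement S i : psd S -> 0 < S i i ->
  psd (S - \matrix_(j, l) (S i j * S i l / S i i)).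
Proof.
move=> pS Si; have /psdP[ST S0] := pS; apply/psdP; split.
  by rewrite linearB /= ST; congr (_ - _); apply/matrixP => j l; rewrite !mxE (mulrC (S i l)).
move=> v; have := S0 (fun j => v j + (- bf S (delta i) v / S i i) * delta i j).
rewrite bf_shift// bfB.
set B := bf S (delta i) v.
have -> : bf (\matrix_(j, l) (S i j * S i l / S i i)) v v = B ^+ 2 / S i i.
  rewrite /B bf_deltal expr2 mulr_suml mulr_suml; apply: eq_bigr => j _.
  rewrite mulr_sumr mulr_suml; apply: eq_bigr => l _; rewrite mxE; ring.
have -> : bf S v v + 2 * (- B / S i i) * B + (- B / S i i) ^+ 2 * S i i =
  bf S v v - B ^+ 2 / S i i by field; rewrite gt_eqF.
by [].
Qed.

(** Cholesky by induction on the number of nonzero diagonal entries: a Schur complement clears the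
    entry [i], and by [psd_diag0] the zero ones stay zero. *)
Lemma psd_sum_outer S : psd S ->
  exists r : seq ('I_n -> R), forall i j, S i j = \sum_(w <- r) w i * w j.
Proof.
have [c] := ubnP #|[pred i | S i i != 0]|; elim: c S => // c IH S; rewrite ltnS => Sc pS.
have /psdP[ST S0] := pS.
have [S00|] := boolP [forall i, S i i == 0].
  exists [::] => i j; rewrite big_nil; apply: psd_diag0 => //.
  by apply/eqP; move/forallP: S00.
rewrite negb_forall => /existsP[i Si].
have Si0 : 0 < S i i by rewrite lt_def Si psd_diag_ge0.
have pS' := psd_schur_complement pS Si0; set S' := S - _ in pS'.
have [||r rE] := IH S' => //.
  apply: leq_trans Sc; apply: proper_card; apply/properP; split.
    apply/fintype.subsetP => j; rewrite !inE; apply: contraNN => /eqP Sj.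
    rewrite /S' !mxE Sj sub0r oppr_eq0 -{1}ST mxE psd_diag0//.
    by rewrite !mul0r.
  exists i; rewrite !inE//.
  by rewrite negbK /S' !mxE mulfK ?subrr.
exists ((fun j => S i j / Num.sqrt (S i i)) :: r) => j l.
rewrite big_cons -rE /S' !mxE mulrACA -invfM -expr2 sqr_sqrtr ?ltW//.
by rewrite [RHS]addrC subrK.
Qed.

(* Moving coordinate [i] by [d] changes the form by [2 d b + d ^+ 2 * W i i] for some [b];
   rounding up or down according to the sign of [b] makes the first term nonnegative. *)
Lemma round_coordinates W v (h : R) (r : seq 'I_n) : W^T = W -> 0 < h -> uniq r ->
  exists v', [/\ forall j, j \notin r -> v' j = v j,
    forall j, j \in r -> exists2 t : int, v' j = h * t%:~R & `|v' j - v j| <= h &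
    bf W v v <= bf W v' v' + \sum_(j <- r) `|W j j| * h ^+ 2].
Proof.
move=> WT h0; elim: r => [|i r IH] /=.
  by move=> _; exists v; split=> //; rewrite big_nil addr0.
move=> /andP[ir ur]; have [v1 [v1o v1r v1W]] := IH ur.
set be := bf W (delta i) v1.
pose fl := Num.floor (v1 i / h).
have fl1 : h * fl%:~R <= v1 i by rewrite mulrC -ler_pdivlMr// ge_floor.
have fl2 : v1 i < h * (fl + 1)%:~R by rewrite mulrC -ltr_pdivrMr// floorD1_gt.
rewrite intrD mulrDr mulr1 in fl2.
have [d [t dt [dh db]]] : exists d, exists2 t : int, v1 i + d = h * t%:~R &
    `|d| <= h /\ 0 <= d * be.
  case: (lerP be 0) => hb.
    exists (h * fl%:~R - v1 i), fl; first by rewrite addrC subrK.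
    by split; [rewrite ler_norml; apply/andP; split; lra|nra].
  exists (h * fl%:~R + h - v1 i), (fl + 1).
    by rewrite intrD mulrDr mulr1 addrC subrK.
  by split; [rewrite ler_norml; apply/andP; split; lra|nra].
exists (fun j => v1 j + d * delta i j); split.
- move=> j; rewrite inE negb_or => /andP[ji jr].
  by rewrite /delta (negbTE ji) mulr0 addr0 v1o.
- move=> j; rewrite inE => /orP[/eqP->|jr].
    exists t; rewrite /delta eqxx mulr1//.
    by rewrite (v1o i ir) addrC addKr.
  have ji : (j == i) = false by apply: contraNF ir => /eqP <-.
  by rewrite /delta ji mulr0 addr0; exact: v1r.
- rewrite big_cons bf_shift// -/be.
  apply: le_trans v1W _.
  have : d ^+ 2 * W i i >= - (`|W i i| * h ^+ 2).
    have hW := ler_norm (- W i i); rewrite normrN in hW.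
    have dd : d ^+ 2 <= h ^+ 2.
      by rewrite -(real_normK (num_real d)); apply: lerXn2r => //; rewrite nnegrE// ltW.
    have := ler_wpM2l (sqr_ge0 d) hW; have := ler_wpM2r (normr_ge0 (W i i)) dd; lra.
  move: db; lra.
Qed.

End QuadraticForms.

(** * Net of sparse vectors and duality with the cone *)

Section SparseNet.
Context (R : realType) (n k : nat).
Implicit Types (W S G H : 'M[R]_n) (v : 'I_n -> R) (Om : {set 'I_n}).

(* Grid vectors supported on at most [k] coordinates: [(f l).1] is a position and
   [(f l).2 - (n + 1)] the integer coordinate in units of [1 / sqrt k]. *)
Definition netraw (f : {ffun 'I_k -> 'I_n * 'I_(2 * n).+3}) : 'I_n -> R := fun j =>
  \sum_(l < k) (if (f l).1 == j then (Num.sqrt k%:R)^-1 * ((f l).2%:R - n.+1%:R) else 0).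

(** Overlong grid vectors are replaced by 0, so that the net is indexed by a plain finite function
    type with an obvious cardinality. *)
Definition netvec f : 'I_n -> R := if sqn (netraw f) <= 4 then netraw f else fun=> 0.

(** Polarization recovers the entry [(i, j)] from the two signs, so the largest entry is controlled
    by finitely many quadratic forms. *)
Definition pairvec (p : 'I_n * 'I_n * bool) : 'I_n -> R :=
  fun l => delta R p.1.1 l + sg R p.2 * delta R p.1.2 l.

Definition low_complexity (lam C : R) H : Prop := exists Om S G,
  [/\ #|Om| = k, psd S, forall i j, i \notin Om -> S i j = 0 &
      [/\ \tr S <= C, lam * mnorm1 G <= C & H = S + G]].

Lemma sqn_netvec f : sqn (netvec f) <= 4.
Proof.
rewrite /netvec; case: ifP => // _; rewrite /sqn big1 // => j _; by rewrite expr0n.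
Qed.

Lemma sqn_delta (i : 'I_n) : sqn (delta R i) = 1.
Proof.
rewrite /sqn (bigD1 i)//= /delta eqxx expr1n big1 ?addr0// => j /negbTE ->.
by rewrite expr0n.
Qed.

Lemma sqnD_le v v' : sqn (fun j => v j + v' j) <= 2 * sqn v + 2 * sqn v'.
Proof.
rewrite /sqn !mulr_sumr -big_split; apply: ler_sum => j _ /=.
by have := sqr_ge0 (v j - v' j); nra.
Qed.

Lemma sqn_pairvec p : sqn (pairvec p) <= 4.
Proof.
apply: le_trans (sqnD_le _ _) _; rewrite sqn_delta.
have -> : sqn (fun l => sg R p.2 * delta R p.1.2 l) = 1.
  rewrite -(sqn_delta p.1.2); apply: eq_bigr => j _; rewrite exprMn.
  by case: p.2; rewrite /sg ?sqrrN expr1n mul1r.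
by lra.
Qed.

Lemma entry_polarization W B i j : W^T = W ->
  (forall p, `|bf W (pairvec p) (pairvec p)| <= B) -> `|W i j| <= B.
Proof.
move=> WT WB; have := WB (i, j, true); have := WB (i, j, false).
rewrite /pairvec /= !bf_shift// !bf_delta.
have -> : W j i = W i j by rewrite -{1}WT mxE.
move=> /ler_normlP[h1 h2] /ler_normlP[h3 h4]; apply/ler_normlP; split; lra.
Qed.

(** Rounding [v] on [Om] with step [1 / sqrt k] moves it by at most 1 in squared norm, whence the 4
    in [netvec]. The rounding direction never lowers the form except through the diagonal, and that
    loss sums to at most [B]; the net bound therefore enters with factor 1. *)
Lemma sparse_bf_le W Om v (A B : R) : W^T = W -> (0 < k)%N -> #|Om| = k ->
  (forall j, j \notin Om -> v j = 0) -> sqn v <= 1 ->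
  (forall f, bf W (netvec f) (netvec f) <= A) -> (forall j, `|W j j| <= B) ->
  bf W v v <= A + B.
Proof.
move=> WT k0 Omk vO v1 WA WB.
set h := (Num.sqrt k%:R : R)^-1.
have sk0 : 0 < Num.sqrt k%:R :> R by rewrite sqrtr_gt0 ltr0n.
have h0 : 0 < h by rewrite invr_gt0.
have h2 : h ^+ 2 = k%:R^-1 by rewrite exprVn sqr_sqrtr.
have kn : (k <= n)%N by rewrite -Omk -[leqRHS]card_ord max_card.
have [v' [v'o v'r v'W]] := round_coordinates v WT h0 (enum_uniq (mem Om)).
have {}v'o j : j \notin Om -> v' j = 0 by move=> jO; rewrite v'o ?vO// mem_enum.
have {}v'r j : j \in Om -> exists2 t : int, v' j = h * t%:~R & `|v' j - v j| <= h.
  by move=> jO; apply: v'r; rewrite mem_enum.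
have sumO : \sum_(j <- enum (mem Om)) `|W j j| * h ^+ 2 <= B.
  apply: (@le_trans _ _ (\sum_(j <- enum (mem Om)) B * h ^+ 2)).
    by apply: ler_sum => j _; rewrite ler_wpM2r ?sqr_ge0.
  rewrite big_enum /= sumr_const Omk h2 -(mulr_natr (B / k%:R)) -mulrA mulVf ?mulr1//.
  by rewrite pnatr_eq0 -lt0n.
have v'2 : sqn v' <= 4.
  apply: (@le_trans _ _ (2 * sqn v + 2 * sqn (fun j => v' j - v j))).
    have -> : sqn v' = sqn (fun j => v j + (v' j - v j)).
      by apply: eq_bigr => j _; rewrite addrC subrK.
    exact: sqnD_le.
  have : sqn (fun j => v' j - v j) <= 1.
    rewrite /sqn (bigID (mem Om))/= [X in _ + X]big1 ?addr0; last first.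
      by move=> j jO; rewrite v'o// vO// subrr expr0n.
    apply: (@le_trans _ _ (\sum_(j in Om) h ^+ 2)).
      apply: ler_sum => j jO; have [_ _ hj] := v'r j jO.
      rewrite -(real_normK (num_real _)); apply: lerXn2r => //; rewrite nnegrE//.
      exact: ltW.
    by rewrite sumr_const Omk h2 -(mulr_natr k%:R^-1) mulVf// pnatr_eq0 -lt0n.
  lra.
have v1j j : `|v j| <= 1.
  have : v j ^+ 2 <= 1.
    apply: le_trans v1; rewrite /sqn (bigD1 j)//= lerDl.
    by apply: sumr_ge0 => i _; exact: sqr_ge0.
  by move=> vj; rewrite -ler_sqr ?nnegrE// expr1n real_normK ?num_real.
suff [f fE] : exists f, netraw f =1 v'.
  have sf : sqn (netraw f) = sqn v' by apply: eq_bigr => j _; rewrite fE.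
  apply: le_trans v'W _; apply: lerD => //; apply: le_trans (WA f).
  by rewrite /netvec sf v'2 (bf_ext _ fE fE).
(* The integer coordinates lie between [- (n + 1)] and [n + 1], because [|v j| <= 1] and
   [sqrt k <= n]; shifted by [n + 1] they are below [2 * n + 3]. *)
pose tt j : nat := if pselect (exists t : int, v' j = h * t%:~R) is left e
  then absz (projT1 (cid e) + n.+1%:Z) else 0%N.
have ttP j : j \in Om -> (tt j < (2 * n).+3)%N /\ v' j = h * ((tt j)%:R - n.+1%:R).
  move=> jO; rewrite /tt; case: pselect => [e|]; last first.
    by case; have [t ->] := v'r j jO; exists t.
  case: (cid e) => t /= tE.
  have [_ _ hj] := v'r j jO.
  have ht : `|t%:~R| <= n.+1%:R :> R.
    have : `|h * t%:~R| <= 1 + h.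
      rewrite -tE -[v' j](subrK (v j)) (le_trans (ler_normD _ _))// addrC.
      by rewrite lerD.
    rewrite normrM (gtr0_norm h0) => hh.
    have : `|t%:~R| <= Num.sqrt k%:R + 1 :> R.
      rewrite -(ler_pM2l h0); apply: le_trans hh _.
      by rewrite mulrDr mulVf ?gt_eqF// mulr1.
    move=> /le_trans; apply; rewrite -natr1 lerD2r.
    apply: (@le_trans _ _ k%:R); last by rewrite ler_nat.
    rewrite -[leRHS](ger0_norm (ler0n _ k)) -sqrtr_sqr ler_sqrt ?exprn_ge0//.
    by rewrite -natrX ler_nat expnS expn1 leq_pmulr.
  rewrite -intr_norm -[n.+1%:R]/(n.+1%:Z%:~R) ler_int in ht.
  have [t1 t2] : 0 <= t + n.+1%:Z /\ t <= n.+1%:Z by lia.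
  split; first by lia.
  rewrite tE; congr (_ * _); rewrite natr_absz ger0_norm// intrD.
  by rewrite [n.+1%:Z%:~R]/(n.+1%:R) addrK.
have kOm : k = #|Om| by [].
pose e (l : 'I_k) : 'I_n := enum_val (cast_ord kOm l).
exists [ffun l => (e l, inord (tt (e l)) : 'I_(2 * n).+3)].
move=> j; rewrite /netraw (reindex (cast_ord Omk)) /=; last first.
  by exists (cast_ord kOm) => l _; apply: val_inj.
transitivity (\sum_(l < #|Om|)
    (if enum_val l == j then h * ((tt (enum_val l))%:R - n.+1%:R) else 0)).
  apply: eq_bigr => l _; rewrite ffunE /= /e (_ : cast_ord _ _ = l); last exact: val_inj.
  by rewrite inordK//; have [] := ttP _ (enum_valP l).
rewrite -(big_enum_val (fun i => if i == j then h * ((tt i)%:R - n.+1%:R) else 0)) /=.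
have [jO|jO] := boolP (j \in Om).
  rewrite (bigD1 j)//= eqxx big1 ?addr0; first by have [_ <-] := ttP j jO.
  by move=> i /andP[_ /negbTE ->].
rewrite big1 ?v'o// => i iO; case: eqP => // ij.
by rewrite -ij iO in jO.
Qed.

(** Duality. [S] is a sum of [w w^T] with [w] supported on [Om], so pairing it with [W] costs
    [A + B] per unit of trace; [G] is paired entrywise. The extra [C * B] is absorbed in
    [C / lam * B] as [lam <= 1]. *)
Lemma mdot_le W H lam C (A B : R) : W^T = W -> (0 < k)%N -> 0 < lam <= 1 -> 0 <= C ->
  low_complexity lam C H ->
  (forall f, bf W (netvec f) (netvec f) <= A) ->
  (forall p, `|bf W (pairvec p) (pairvec p)| <= B) ->
  mdot W H <= C * A + 2 * C / lam * B.
Proof.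
move=> WT k0 /andP[lam0 lam1] C0 [Om [S [G [Omk pS SO [trS mG ->]]]]] WA WB.
have Wij i j : `|W i j| <= B by exact: entry_polarization.
have qle v : (forall j, j \notin Om -> v j = 0) -> sqn v <= 1 -> bf W v v <= A + B.
  by move=> vO v1; apply: (sparse_bf_le WT k0 Omk).
have AB0 : 0 <= A + B.
  have := qle (fun=> 0) (fun _ _ => erefl).
  rewrite (_ : bf W _ _ = 0); last first.
    by rewrite /bf big1// => i _; rewrite big1// => j _; rewrite mulr0.
  by apply; rewrite /sqn big1// => i _; rewrite expr0n.
have B0 : 0 <= B.
  have k1 : (0 < #|Om|)%N by rewrite Omk.
  have [i _] := card_gt0P k1; exact: le_trans (normr_ge0 _) (Wij i i).
have [r rS] := psd_sum_outer pS.
pose r' := [seq (fun i => if i \in Om then w i else 0) | w <- r].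
have rS' i j : S i j = \sum_(w <- r') w i * w j.
  rewrite big_map; have [iO|iO] := boolP (i \in Om); last first.
    by rewrite SO// big1// => w _; rewrite mul0r.
  have [jO|jO] := boolP (j \in Om); first by rewrite rS.
  have /psdP[ST _] := pS.
  by rewrite -ST mxE SO// big1// => w _; rewrite mulr0.
have rq w : bf W (fun i => if i \in Om then w i else 0) (fun i => if i \in Om then w i else 0)
    <= (A + B) * sqn (fun i => if i \in Om then w i else 0).
  set u := fun i => _; have uO j : j \notin Om -> u j = 0 by rewrite /u => /negbTE ->.
  have [u0|un0] := eqVneq (sqn u) 0.
    rewrite u0 mulr0 /bf big1// => i _; rewrite big1// => j _.
    suff -> : u i = 0 by rewrite !mul0r.
    apply/eqP; rewrite -sqrf_eq0; move/eqP: u0; rewrite psumr_eq0.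
      by move=> /allP/(_ i); rewrite mem_index_enum => /(_ isT).
    by move=> l _; exact: sqr_ge0.
  have up : 0 < sqn u by rewrite lt_def un0 sqn_ge0.
  pose c := (Num.sqrt (sqn u))^-1.
  have c2 : c ^+ 2 = (sqn u)^-1 by rewrite exprVn sqr_sqrtr ?ltW.
  have := qle (fun j => c * u j) _ _.
  rewrite bfZl bfZr mulrA -expr2 c2 mulrC ler_pdivrMr//; apply.
    by move=> j jO; rewrite uO ?mulr0.
  rewrite (_ : sqn _ = c ^+ 2 * sqn u); first by rewrite c2 mulVf.
  by rewrite mulr_sumr; apply: eq_bigr => j _; rewrite exprMn.
have dS : mdot W S <= C * (A + B).
  have -> : mdot W S = \sum_(w <- r') bf W w w.
    rewrite /mdot /bf [RHS]exchange_big /=; apply: eq_bigr => i _.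
    rewrite [RHS]exchange_big /=; apply: eq_bigr => j _; rewrite rS' mulr_sumr.
    by apply: eq_bigr => w _; ring.
  apply: (@le_trans _ _ ((A + B) * \tr S)); last by rewrite mulrC ler_wpM2r.
  have -> : \tr S = \sum_(w <- r') sqn w.
    rewrite /mxtrace /sqn [RHS]exchange_big /=; apply: eq_bigr => i _.
    by rewrite rS'; apply: eq_bigr => w _; rewrite expr2.
  by rewrite mulr_sumr !big_map; apply: ler_sum => w _; exact: rq.
have dG : mdot W G <= B * mnorm1 G.
  rewrite /mdot /mnorm1 mulr_sumr; apply: ler_sum => i _.
  rewrite mulr_sumr; apply: ler_sum => j _.
  by apply: le_trans (ler_norm _) _; rewrite normrM ler_wpM2r.
have -> : mdot W (S + G) = mdot W S + mdot W G.
  rewrite -big_split; apply: eq_bigr => i _; rewrite -big_split; apply: eq_bigr => j _ /=.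
  by rewrite mxE mulrDr.
have G1 : B * mnorm1 G <= C / lam * B.
  by rewrite mulrC ler_wpM2r// ler_pdivlMr// mulrC.
have CB : C * B <= C / lam * B.
  by rewrite ler_wpM2r// ler_pdivlMr// ler_piMr.
lra.
Qed.

End SparseNet.

(** * Passage between forms on lists and forms indexed by ordinals *)

Section NatIndexing.
Context (R : realType).

Lemma linE (l : nat -> R) y : lin l y = \sum_(j < size y) l j * y`_j.
Proof.
elim: y l => [|x y IH] l /=; first by rewrite big_ord0.
by rewrite big_ord_recl /= IH.
Qed.

Lemma lnormE (l : nat -> R) n : lnorm l n = \sum_(j < n) l j ^+ 2.
Proof.
elim: n l => [|n IH] l /=; first by rewrite big_ord0.
by rewrite big_ord_recl /= IH.
Qed.

Lemma quadE (H : nat -> nat -> R) y : (forall i j, H i j = H j i) ->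
  quad H y = \sum_(i < size y) \sum_(j < size y) y`_i * H i j * y`_j.
Proof.
elim: y H => [|x y IH] H sH /=; first by rewrite big_ord0.
rewrite big_ord_recl big_ord_recl /= linE IH//.
under [X in _ = _ + X]eq_bigr do rewrite big_ord_recl /=.
rewrite big_split /=; set A := \sum_(j < size y) H 0%N j.+1 * y`_j.
set B := \sum_(i < size y) \sum_(j < size y) _; rewrite -/B.
have -> : \sum_(i < size y) x * H 0%N (bump 0 i) * y`_i = x * A.
  by rewrite mulr_sumr; apply: eq_bigr => i _; rewrite mulrA.
have -> : \sum_(i < size y) y`_i * H (bump 0 i) 0%N * x = x * A.
  by rewrite mulr_sumr; apply: eq_bigr => i _; rewrite (sH _ 0%N) -[bump 0 i]/(i.+1); ring.
by ring.
Qed.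

Lemma qnormE (H : nat -> nat -> R) n : (forall i j, H i j = H j i) ->
  qnorm H n = \sum_(i < n) \sum_(j < n) H i j ^+ 2.
Proof.
elim: n H => [|n IH] H sH /=; first by rewrite big_ord0.
rewrite big_ord_recl big_ord_recl /= lnormE IH//.
under [X in _ = _ + X]eq_bigr do rewrite big_ord_recl /=.
rewrite big_split /=.
have -> : \sum_(i < n) H (bump 0 i) 0%N ^+ 2 = \sum_(i < n) H 0%N (bump 0 i) ^+ 2.
  by apply: eq_bigr => i _; rewrite sH.
set A := \sum_(j < n) H 0%N j.+1 ^+ 2; rewrite -/A.
set B := \sum_(i < n) \sum_(j < n) _; rewrite -/B; ring.
Qed.

Definition natf n (f : 'I_n -> R) (j : nat) : R :=
  if insub j is Some i then f i else 0.

Definition natM n (H : 'M[R]_n) (i j : nat) : R :=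
  if insub i is Some i' then natf (H i') j else 0.

Lemma natfE n (f : 'I_n -> R) (j : 'I_n) : natf f j = f j.
Proof. by rewrite /natf valK. Qed.

Lemma natME n (H : 'M[R]_n) (i j : 'I_n) : natM H i j = H i j.
Proof. by rewrite /natM valK natfE. Qed.

Lemma natM_sym n (H : 'M[R]_n) : H^T = H -> forall i j, natM H i j = natM H j i.
Proof.
move=> HT i j; rewrite /natM /natf.
by case: insubP => [i' _ _|_]; case: insubP => [j' _ _|_] //; rewrite -[in LHS]HT mxE.
Qed.

Context (V : finType) (b : V -> R).

Definition vec n (x : n.-tuple V) : 'I_n -> R := fun j => b (tnth x j).

Lemma lin_vec n (f : 'I_n -> R) (x : n.-tuple V) :
  lin (natf f) (map b x) = \sum_j f j * vec x j.
Proof.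
rewrite linE size_map size_tuple; apply: eq_bigr => j _; rewrite natfE.
by rewrite (nth_map (tnth x j)) ?size_tuple// -tnth_nth.
Qed.

Lemma quad_vec n (H : 'M[R]_n) (x : n.-tuple V) : H^T = H ->
  quad (natM H) (map b x) = bf H (vec x) (vec x).
Proof.
move=> HT; rewrite quadE; last exact: natM_sym.
rewrite size_map size_tuple; apply: eq_bigr => i _; apply: eq_bigr => j _.
by rewrite natME !(nth_map (tnth x i)) ?size_tuple// -!tnth_nth.
Qed.

End NatIndexing.

(** * The uniform lower bound for discrete entries *)

Section DiscreteLowerBound.
Context (R : realType).

Lemma min_norm1_lipschitz (x y : R) :
  `|Num.min `|x| 1 - Num.min `|y| 1| <= `|x - y|.
Proof.
have := lerB_dist x y; have := lerB_dist y x; rewrite (distrC y x).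
set u := `|x|; set v := `|y|; set w := `|x - y| => h1 h2.
have w0 : 0 <= w by exact: normr_ge0.
by apply/ler_normlP; case: (leP u 1) => hu; case: (leP v 1) => hv; split; lra.
Qed.

Definition gram (V : finType) (b : V -> R) n (om : seq (n.-tuple V * bool)) : 'M[R]_n :=
  \matrix_(i, j) \sum_(p <- om) sg R p.2 * (vec b p.1 i * vec b p.1 j).

Section Gram.
Context (V : finType) (P : fdist R V) (b : V -> R) (n : nat).

Lemma gram_sym (om : seq (n.-tuple V * bool)) : (gram b om)^T = gram b om.
Proof.
by apply/matrixP => i j; rewrite !mxE; apply: eq_bigr => p _; rewrite (mulrC (vec b _ j)).
Qed.

Lemma bf_gram (om : seq (n.-tuple V * bool)) v :
  bf (gram b om) v v = \sum_(p <- om) sg R p.2 * (\sum_j v j * vec b p.1 j) ^+ 2.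
Proof.
rewrite /bf; under eq_bigr do under eq_bigr do rewrite mxE mulr_sumr mulr_suml.
under eq_bigr do rewrite exchange_big /=.
rewrite exchange_big /=; apply: eq_bigr => p _.
rewrite expr2 mulr_suml mulr_sumr; apply: eq_bigr => i _.
rewrite mulr_sumr mulr_sumr; apply: eq_bigr => j _; ring.
Qed.

Lemma mdot_gram (om : seq (n.-tuple V * bool)) H :
  mdot (gram b om) H = \sum_(p <- om) sg R p.2 * bf H (vec b p.1) (vec b p.1).
Proof.
rewrite /mdot; under eq_bigr do under eq_bigr do rewrite mxE mulr_suml.
under eq_bigr do rewrite exchange_big /=.
rewrite exchange_big /=; apply: eq_bigr => p _.
rewrite mulr_sumr; apply: eq_bigr => i _.
rewrite mulr_sumr; apply: eq_bigr => j _; ring.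
Qed.

Context (K v0 : R).
Hypothesis lawb : entry_law P b K v0.

(** The form is a sum of [m] independent signed squares, so the exponential moment is a power of the
    one in [sign_square_mgf]; the outer sign [e] merely swaps its two terms. *)
Lemma gram_mgf m (v : 'I_n -> R) (th : R) (e : bool) : sqn v <= 4 -> 0 <= th ->
  th <= alphac K / 8 ->
  Ex (sdist (tdist P n)) m (fun om => expR (th * (sg R e * bf (gram b om) v v)))
  <= expR (m%:R * (mgfc K * th ^+ 2)).
Proof.
move=> v4 th0 th1.
pose g (p : n.-tuple V * bool) :=
  expR (th * (sg R e * (sg R p.2 * (\sum_j v j * vec b p.1 j) ^+ 2))).
rewrite (@Ex_ext _ _ _ _ _ (fun om => \prod_(p <- om) g p)); last first.
  by move=> om _; rewrite bf_gram mulr_sumr mulr_sumr expR_sum.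
rewrite Ex_prod expRM_natl; apply: lerXn2r; rewrite ?nnegrE ?expR_ge0//.
  by apply: ev_ge0 => p; exact: expR_ge0.
rewrite ev_sdist.
have l4 : lnorm (natf v) n <= 4.
  by rewrite lnormE; under eq_bigr do rewrite natfE.
apply: le_trans (sign_square_mgf lawb l4 th0 th1).
rewrite -(@ev_tdist _ _ P n (fun s => (expR (th * lin (natf v) (map b s) ^+ 2) +
                    expR (- th * lin (natf v) (map b s) ^+ 2)) / 2)).
apply: ev_le => x; rewrite /g /= -lin_vec; set L := lin _ _ ^+ 2.
by clear g; case: e; rewrite /sg !mulN1r !mul1r ?opprK ?mulNr ?mulrN// addrC.
Qed.

Lemma form_small_ball (H : 'M[R]_n) : H^T = H -> \sum_i \sum_j H i j ^+ 2 = 1 ->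
  ballc K v0 <= ev (tdist P n) (fun x => Num.min `|bf H (vec b x) (vec b x)| 1).
Proof.
move=> HT H1; have := @small_ball _ _ P b K v0 lawb n (natM H).
rewrite qnormE; last exact: natM_sym.
under eq_bigr do under eq_bigr do rewrite natME.
move=> /(_ H1)/le_trans; apply.
rewrite -(@ev_tdist _ _ P n (fun s => Num.min `|quad (natM H) (map b s)| 1)).
by apply: ev_le => x; rewrite quad_vec.
Qed.

End Gram.

(** Absorbs the 5 of [net_size_le], so that one coordinate of a net vector costs [2 + 2 * ln n] in
    entropy. *)
Lemma five_le_expR2 : 5 <= expR 2 :> R.
Proof.
have -> : (2 : R) = 4%:R * (1 / 2) by lra.
rewrite expRM_natl; have := expR_ge1Dx (1 / 2 : R).
set e := expR _ => he; have h2 : 9 / 4 <= e ^+ 2 by nra.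
by rewrite (exprM e 2 2); nra.
Qed.

Lemma net_size_le n : (0 < n)%N -> (n * (2 * n).+3 <= 5 * (n * n))%N.
Proof.
by move=> n0; rewrite (mulnCA 5) leq_mul2l; apply/orP; right; lia.
Qed.

Lemma natr_le_expR_ln n : (0 < n)%N -> n%:R <= expR (ln n%:R) :> R.
Proof. by move=> n0; rewrite lnK// posrE ltr0n. Qed.

(** The first bound makes the exponential moments available, the second keeps the variance terms
    [6 * C * mgfc K * th * m] below [ballc * m / 8]. [samplec] then does the same for the entropy
    terms. *)
Definition thetac (K v0 C : R) : R := Num.min (alphac K / 8) (ballc K v0 / (48 * C * mgfc K)).
Definition samplec (K v0 C : R) : R := 96 * C / (thetac K v0 C * ballc K v0).

Lemma thetac_gt0 K v0 C : 0 < K -> 0 < v0 -> 0 < C -> 0 < thetac K v0 C.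
Proof.
move=> K0 v00 C0; rewrite lt_min divr_gt0 ?alphac_gt0//=.
have p0 := ballc_gt0 K v00; have M0 := mgfc_gt0 K0.
by apply: divr_gt0 => //; do 2!apply: mulr_gt0 => //.
Qed.

Lemma samplec_gt0 K v0 C : 0 < K -> 0 < v0 -> 0 < C -> 0 < samplec K v0 C.
Proof.
move=> K0 v00 C0; have p0 := ballc_gt0 K v00; have t0 := thetac_gt0 K0 v00 C0.
by apply: divr_gt0; exact: mulr_gt0.
Qed.

(** [mdot_le] leaves two finite maxima. The net maximum [A1] is taken at parameter [th], with
    entropy [k * (2 + 2 * ln n)], covered since [k * lam ^+ 2 <= 1]. The entry maximum [A2] carries
    a factor [1 / lam], hence the parameter [th * lam]: its variance term stays of order [th] and
    its entropy becomes [(2 + 2 * ln n) / lam ^+ 2]. *)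
Lemma expected_width (V : finType) (P : fdist R V) (b : V -> R) (K v0 C : R)
    (n k m : nat) (lam : R) (I : finType) (i0 : I) (Hs : I -> 'M[R]_n) :
  entry_law P b K v0 -> 0 < C -> (0 < k)%N -> (k <= n)%N -> 0 < lam ->
  k%:R * lam ^+ 2 <= 1 -> samplec K v0 C * ((1 + ln n%:R) / lam ^+ 2) <= m%:R ->
  (forall i, low_complexity k lam C (Hs i)) ->
  Ex (sdist (tdist P n)) m (fun om => fmax i0 (fun i => 0 +
     \sum_(p <- om) 2 * sg R p.2 * bf (Hs i) (vec b p.1) (vec b p.1)))
  <= m%:R * ballc K v0 / 4.
Proof.
move=> lawb C0 k0 kn lam0 klam mL HsC.
have K0 := entry_K lawb; have v00 := entry_v0 lawb.
have n0 : (0 < n)%N by exact: leq_trans kn.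
have lam1 : lam <= 1.
  rewrite leNgt; apply/negP => l1; have k1 : 1 <= k%:R :> R by rewrite ler1n.
  have := ler_wpM2r (sqr_ge0 lam) k1; nra.
set th := thetac K v0 C; have th0 : 0 < th by exact: thetac_gt0.
have th1 : th <= alphac K / 8 by rewrite ge_min lexx.
set M := mgfc K; have M0 : 0 < M by exact: mgfc_gt0.
set p0 := ballc K v0; have p00 : 0 < p0 by exact: ballc_gt0.
have th2 : 48 * C * M * th <= p0.
  rewrite mulrC -ler_pdivlMr; first by rewrite ge_min lexx orbT.
  by do 2!apply: mulr_gt0 => //.
pose j0 := Ordinal n0.
pose f0 : {ffun 'I_k -> 'I_n * 'I_(2 * n).+3} := [ffun=> (j0, ord0)].
pose A1 om := fmax f0 (fun f => bf (gram b om) (netvec R f) (netvec R f)).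
pose A2 om := fmax (j0, j0, true, true) (fun q : 'I_n * 'I_n * bool * bool =>
  sg R q.2 * bf (gram b om) (pairvec R q.1) (pairvec R q.1)).
pose L1 := k%:R * (2 + 2 * ln n%:R) : R; pose L2 := 2 + 2 * ln n%:R : R.
have n2 : expR L2 = expR 2 * expR (ln n%:R) ^+ 2 by rewrite expRD expRM_natl.
have n1 := natr_le_expR_ln n0; have n0' : 0 <= n%:R :> R by exact: ler0n.
have nn : n%:R ^+ 2 <= expR (ln n%:R) ^+ 2 :> R.
  by apply: lerXn2r => //; rewrite nnegrE ?expR_ge0.
have e5 := five_le_expR2.
have sqn5 : 5 * n%:R ^+ 2 <= expR L2.
  by rewrite n2; apply: ler_pM => //; rewrite ?sqr_ge0.
have EA1 : Ex (sdist (tdist P n)) m A1 <= (L1 + m%:R * (M * th ^+ 2)) / th.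
  apply: Ex_fmax_le => //.
    rewrite card_ffun card_prod !card_ord natrX /L1 expRM_natl.
    apply: lerXn2r; rewrite ?nnegrE ?expR_ge0//; apply: le_trans sqn5.
    by rewrite -natrX -natrM ler_nat expnS expn1 net_size_le.
  move=> f; apply: le_trans (gram_mgf lawb m true (sqn_netvec R f) (ltW th0) th1).
  by apply: Ex_le => om _; rewrite mul1r.
have th2' : 0 <= th * lam by rewrite mulr_ge0 ?ltW.
have EA2 : Ex (sdist (tdist P n)) m A2 <= (L2 + m%:R * (M * (th * lam) ^+ 2)) / (th * lam).
  apply: Ex_fmax_le; first by rewrite mulr_gt0.
    rewrite !card_prod !card_ord card_bool; apply: le_trans sqn5.
    by rewrite -natrX -natrM ler_nat expnS expn1 -mulnA mulnC leq_mul2r orbT.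
  move=> q; have thl : th * lam <= alphac K / 8.
    by apply: le_trans th1; rewrite ler_piMr// ltW.
  exact: (gram_mgf lawb m q.2 (sqn_pairvec R q.1) th2' thl).
apply: (@le_trans _ _ (Ex (sdist (tdist P n)) m (fun om =>
    2 * C * A1 om + 4 * C / lam * A2 om))).
  apply: Ex_le => om _; apply: fmax_le => i; rewrite add0r.
  have -> : \sum_(p <- om) 2 * sg R p.2 * bf (Hs i) (vec b p.1) (vec b p.1) =
      2 * mdot (gram b om) (Hs i).
    by rewrite mdot_gram mulr_sumr; apply: eq_bigr => p _; rewrite mulrA.
  have := @mdot_le R n k (gram b om) (Hs i) lam C (A1 om) (A2 om) (gram_sym b om) k0.
  rewrite lam0 lam1 => /(_ isT (ltW C0) (HsC i)).
  have a1 (f : {ffun 'I_k -> 'I_n * 'I_(2 * n).+3}) : bf (gram b om) (netvec R f) (netvec R f) <= A1 om.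
    exact: (fmax_ge f0 (fun f => bf (gram b om) (netvec R f) (netvec R f))).
  have a2 p : `|bf (gram b om) (pairvec R p) (pairvec R p)| <= A2 om.
    have a2' e : sg R e * bf (gram b om) (pairvec R p) (pairvec R p) <= A2 om.
      exact: (fmax_ge (j0, j0, true, true) (fun q : 'I_n * 'I_n * bool * bool =>
        sg R q.2 * bf (gram b om) (pairvec R q.1) (pairvec R q.1)) (p, e)).
    apply/ler_normlP; split; first by have := a2' false; rewrite mulN1r.
    by have := a2' true; rewrite mul1r.
  move=> /(_ a1 a2); lra.
rewrite ExD !ExZ.
set La := (1 + ln n%:R) / lam ^+ 2 in mL *.
have ln0 : 0 <= ln n%:R :> R by rewrite ln_ge0// ler1n.
have l20 : 0 < lam ^+ 2 by rewrite exprn_gt0.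
have L1a : L1 <= 2 * La.
  rewrite /L1 /La mulrA ler_pdivlMr// mulrAC.
  have -> : k%:R * lam ^+ 2 * (2 + 2 * ln n%:R) = (k%:R * lam ^+ 2) * (2 * (1 + ln n%:R)).
    by ring.
  rewrite -[leRHS]mul1r ler_wpM2r//; lra.
have L2a : L2 / lam ^+ 2 = 2 * La by rewrite /L2 /La; field; rewrite gt_eqF.
have mLa : 96 * C * La <= th * p0 * m%:R.
  move: mL; rewrite /samplec -/th -/p0 mulrAC ler_pdivrMr ?mulr_gt0//; lra.
have m0 : 0 <= m%:R :> R by exact: ler0n.
have h1 : 2 * C * Ex (sdist (tdist P n)) m A1 <= 2 * C * ((L1 + m%:R * (M * th ^+ 2)) / th).
  by rewrite ler_pM2l ?mulr_gt0.
have h2 : 4 * C / lam * Ex (sdist (tdist P n)) m A2 <=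
    4 * C / lam * ((L2 + m%:R * (M * (th * lam) ^+ 2)) / (th * lam)).
  by rewrite ler_pM2l ?divr_gt0 ?mulr_gt0.
apply: le_trans (lerD h1 h2) _.
have -> : 2 * C * ((L1 + m%:R * (M * th ^+ 2)) / th) +
  4 * C / lam * ((L2 + m%:R * (M * (th * lam) ^+ 2)) / (th * lam)) =
  (2 * C * L1 + 4 * C * (L2 / lam ^+ 2)) / th + 6 * C * M * th * m%:R.
  by field; rewrite !gt_eqF.
rewrite L2a.
have h3 : (2 * C * L1 + 4 * C * (2 * La)) / th <= p0 * m%:R / 8.
  rewrite ler_pdivrMr//; have := ler_wpM2l (ltW C0) L1a; lra.
have := ler_wpM2r m0 th2; lra.
Qed.

(** Every bad outcome [t] is itself an index of the maximum [Z], through its witness. There the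
    truncated means add up to at least [m * p0] and the truncated values to at most [m * p0 / 2], so
    [Z t >= m * p0 / 2]. As the mean of [Z] is at most [m * p0 / 4], bad outcomes lie in its tail
    with [tau = p0 / 4], and [tau ^+ 2 / 8 = p0 ^+ 2 / 128]. *)
Lemma discrete_lower_bound (V : finType) (P : fdist R V) (b : V -> R) (K v0 C : R)
    (n k m : nat) (lam : R) (bad : pred (m.-tuple (n.-tuple V))) :
  entry_law P b K v0 -> 0 < C -> (0 < k)%N -> (k <= n)%N -> 0 < lam ->
  k%:R * lam ^+ 2 <= 1 -> samplec K v0 C * ((1 + ln n%:R) / lam ^+ 2) <= m%:R ->
  (forall t, bad t -> exists H : 'M[R]_n,
     [/\ H^T = H, \sum_i \sum_j H i j ^+ 2 = 1, low_complexity k lam C H &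
         \sum_(x <- t) `|bf H (vec b x) (vec b x)| <= ballc K v0 / 2 * m%:R]) ->
  \sum_(t | bad t) \prod_(x <- t) \prod_(v <- x) P v <= expR (- (ballc K v0 ^+ 2 / 128 * m%:R)).
Proof.
move=> lawb C0 k0 kn lam0 klam mL badH.
have [t0 bad0|nobad] := pickP bad; last by rewrite big_pred0 ?expR_ge0.
have [Hc HcP] : {Hc : m.-tuple (n.-tuple V) -> 'M[R]_n & forall t, bad t ->
    [/\ (Hc t)^T = Hc t, \sum_i \sum_j Hc t i j ^+ 2 = 1, low_complexity k lam C (Hc t) &
        \sum_(x <- t) `|bf (Hc t) (vec b x) (vec b x)| <= ballc K v0 / 2 * m%:R]}.
  apply: (@choice _ _ (fun t H => bad t -> [/\ H^T = H, \sum_i \sum_j H i j ^+ 2 = 1,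
      low_complexity k lam C H &
      \sum_(x <- t) `|bf H (vec b x) (vec b x)| <= ballc K v0 / 2 * m%:R])) => t.
  by have [/badH[H HP]|//] := boolP (bad t); [exists H|exists 0].
(* Good outcomes are indices too and borrow the witness of [t0]. *)
pose Hs t := if bad t then Hc t else Hc t0.
have HsP t : [/\ (Hs t)^T = Hs t, \sum_i \sum_j Hs t i j ^+ 2 = 1 & low_complexity k lam C (Hs t)].
  by rewrite /Hs; case: ifP => [/HcP[]|_]//; have [] := HcP _ bad0.
set p0 := ballc K v0 in badH HcP *.
have p00 : 0 < p0 by exact: ballc_gt0 (entry_v0 lawb).
have p01 : p0 <= 1 by exact: ballc_le1.
pose phi (y : R) := Num.min `|y| 1.
pose h t (x : n.-tuple V) := bf (Hs t) (vec b x) (vec b x).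
pose Z (s : seq (n.-tuple V)) := fmax t0 (fun t => 0 +
  \sum_(x <- s) (ev (tdist P n) (fun u => phi (h t u)) - phi (h t x))).
have EZ : Ex (tdist P n) m Z <= m%:R * p0 / 4.
  apply: le_trans (symmetrization _ _ _ _ _ min_norm1_lipschitz) _.
  by apply: (expected_width t0 lawb C0 k0 kn lam0 klam mL) => t; have [] := HsP t.
have phi01 y : 0 <= phi y <= 1 by rewrite /phi le_min normr_ge0 ler01 ge_min lexx orbT.
have Zdiff s1 v v' s2 : (size s1 + size s2).+1 = m ->
    Z (s1 ++ v :: s2) - Z (s1 ++ v' :: s2) <= 1.
  move=> _; rewrite lerBlDl; apply: fmax_leD1 => t.
  rewrite !big_cat !big_cons /=; have /andP[] := phi01 (h t v); have /andP[] := phi01 (h t v').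
  lra.
have := @bounded_differences_tail _ _ (tdist P n) m Z (p0 / 4) _ Zdiff.
have -> : 0 <= p0 / 4 <= 1 by apply/andP; split; lra.
move=> /(_ isT) tail.
apply: (@le_trans _ _ (expR (- (m%:R * (p0 / 4) ^+ 2 / 8)))); last first.
  by rewrite ler_expR expr_div_n; lra.
apply: le_trans tail; rewrite Ex_tuple big_mkcond; apply: ler_sum => t _ /=.
have w0 : 0 <= \prod_(x <- t) \prod_(v <- x) P v.
  by apply: prodr_ge0 => x _; exact: tdist_ge0.
case: ifP => [bt|_]; last by rewrite mulr_ge0.
suff -> : Ex (tdist P n) m Z + m%:R * (p0 / 4) <= Z t by rewrite mulr1.
apply: (@le_trans _ _ (m%:R * p0 / 2)); first by lra.
apply: le_trans (fmax_ge t0 (fun i => 0 +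
  \sum_(x <- t) (ev (tdist P n) (fun u => phi (h i u)) - phi (h i x))) t).
rewrite add0r sumrB; have [HsT Hs1 _] := HsP t.
have [_ _ _ small] := HcP t bt.
have e0 := form_small_ball lawb HsT Hs1.
rewrite big_const_seq count_predT size_tuple iter_addr_0 -mulr_natl.
have s1 : \sum_(x <- t) phi (h t x) <= p0 / 2 * m%:R.
  apply: le_trans small; apply: ler_sum => x _; rewrite /phi /h /Hs bt.
  by rewrite ge_min lexx.
have := ler_wpM2l (ler0n R m) e0; rewrite -/p0 -/(phi _) -/(h t _); lra.
Qed.

End DiscreteLowerBound.

(** * Comparison of Frobenius and nuclear norms *)

Section NuclearNorm.
Context (R : realType) (n : nat).
Implicit Types (S A : 'M[R]_n) (z r x : 'I_n -> R).

Lemma frob_sqr A : frob A ^+ 2 = \sum_i \sum_j A i j ^+ 2.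
Proof.
rewrite /frob sqr_sqrtr// sumr_ge0// => i _; apply: sumr_ge0 => j _; exact: sqr_ge0.
Qed.

Lemma frob_ge0 A : 0 <= frob A. Proof. exact: sqrtr_ge0. Qed.

Lemma psd_minor S i j : psd S -> S i j ^+ 2 <= S i i * S j j.
Proof.
move=> pS; have := psd_diag_ge0 i pS; rewrite le_eqVlt => /orP[/eqP/esym Si|Si].
  by rewrite (psd_diag0 pS Si) Si mul0r expr0n.
have := psd_diag_ge0 j (psd_schur_complement pS Si).
by rewrite !mxE subr_ge0 ler_pdivrMr// -expr2 mulrC.
Qed.

Lemma psd_trace_ge0 S : psd S -> 0 <= \tr S.
Proof. by move=> pS; apply: sumr_ge0 => i _; exact: psd_diag_ge0. Qed.

(** The squared Frobenius norm of [A] is that of [S], and the minors give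
    [S i j ^+ 2 <= S i i * S j j], which sums to the squared trace. *)
Lemma frob_le_trace_sqrt S A : psd S -> S *m S = A^T *m A -> frob A <= \tr S.
Proof.
move=> pS SA; rewrite -ler_sqr ?nnegrE ?frob_ge0 ?psd_trace_ge0//.
have gramE (B : 'M[R]_n) : \tr (B^T *m B) = \sum_i \sum_j B i j ^+ 2.
  rewrite /mxtrace exchange_big; apply: eq_bigr => j _; rewrite mxE.
  by apply: eq_bigr => i _; rewrite mxE expr2.
have [ST _] := pS.
rewrite frob_sqr -gramE -SA -{1}ST gramE expr2 /mxtrace mulr_suml.
apply: ler_sum => i _; rewrite mulr_sumr; apply: ler_sum => j _; exact: psd_minor.
Qed.

(** Without a root, [xget] would return 0; hence the existence hypothesis. The bound holds for
    whichever root [xget] picks. *)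
Lemma frob_le_nucnorm A :
  (exists S, psd S /\ S *m S = A^T *m A) -> frob A <= nucnorm A.
Proof.
move=> [S [pS SA]]; rewrite /nucnorm; case: xgetP => [y _ [S' [pS' [SA' ->]]]|].
  exact: frob_le_trace_sqrt.
by move=> /(_ (\tr S)) []; exists S.
Qed.

(* With [Z = |z|^2] and [s = |r|^2], the matrix [D = z r^T + r z^T + r r^T] has rank two,
   nonzero eigenvalues with sum [s] and product [- Z s], hence
   [|D| = (D^2 + Z s Pi) / sqrt (s^2 + 4 Z s)] for [Pi] the projection on its range. *)
Lemma rank_two_psd_sqrt z r : \sum_i z i * r i = 0 ->
  let D := \matrix_(i, j) (z i * r j + r i * z j + r i * r j) in
  exists S : 'M[R]_n, psd S /\ S *m S = D^T *m D.
Proof.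
move=> zr D; pose Z := sqn z; pose s := sqn r.
have Z0 : 0 <= Z by exact: sqn_ge0.
have s0 : 0 <= s by exact: sqn_ge0.
have dotE a c a' c' : \sum_l (a * z l + c * r l) * (a' * z l + c' * r l) =
    a * a' * Z + c * c' * s.
  transitivity (\sum_l (a * a' * z l ^+ 2 + (a * c' + c * a') * (z l * r l) +
      c * c' * r l ^+ 2)); first by apply: eq_bigr => l _; ring.
  by rewrite !big_split /= -!mulr_sumr zr mulr0 addr0.
have DE i j : (D^T *m D) i j = r i * r j * Z + (z i + r i) * (z j + r j) * s.
  rewrite -dotE mxE; apply: eq_bigr => l _; rewrite !mxE; ring.
have [s_eq0|s_neq0] := eqVneq s 0.
  have r0 i : r i = 0.
    apply/eqP; rewrite -sqrf_eq0; move/eqP: s_eq0; rewrite psumr_eq0.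
      by move=> /allP/(_ i); rewrite mem_index_enum => /(_ isT).
    by move=> l _; exact: sqr_ge0.
  exists 0; split; last first.
    by apply/matrixP => i j; rewrite DE mul0mx mxE s_eq0 !r0; ring.
  apply/psdP; split=> [|v]; first by rewrite trmx0.
  by rewrite /bf big1// => i _; rewrite big1// => j _; rewrite mxE mulr0 mul0r.
have sp : 0 < s by rewrite lt_def s_neq0.
pose q := Num.sqrt (s ^+ 2 + 4 * Z * s).
have q2 : q ^+ 2 = s ^+ 2 + 4 * Z * s.
  by rewrite sqr_sqrtr// addr_ge0 ?sqr_ge0// !mulr_ge0.
have qp : 0 < q.
  by rewrite sqrtr_gt0 ltr_pwDl ?exprn_gt0// !mulr_ge0.
pose S : 'M[R]_n := \matrix_(i, j)
  ((2 * s * (z i * z j) + s * (r i * z j + z i * r j) + (2 * Z + s) * (r i * r j)) / q).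
exists S; split.
  apply/psdP; split=> [|v].
    by apply/matrixP => i j; rewrite !mxE; congr (_ / _); ring.
  pose a := \sum_i v i * z i; pose c := \sum_i v i * r i.
  have -> : bf S v v = (s * a ^+ 2 + s * (a + c) ^+ 2 + 2 * Z * c ^+ 2) / q.
    pose T (F : 'I_n -> 'I_n -> R) := \sum_i \sum_j F i j.
    have TD F F' : T F + T F' = T (fun i j => F i j + F' i j).
      by rewrite /T -big_split; apply: eq_bigr => i _; rewrite -big_split.
    have TZ c' F : c' * T F = T (fun i j => c' * F i j).
      by rewrite /T mulr_sumr; apply: eq_bigr => i _; rewrite mulr_sumr.
    have Tp p p' : (\sum_i v i * p i) * (\sum_i v i * p' i) =
        T (fun i j => (v i * p i) * (v j * p' j)).
      by rewrite /T mulr_suml; apply: eq_bigr => i _; rewrite mulr_sumr.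
    rewrite mulrC; transitivity (q^-1 * (2 * s * (a * a) + s * (c * a + a * c) +
        (2 * Z + s) * (c * c))); last by congr (_ * _); ring.
    rewrite /a /c !Tp !(TD, TZ); apply: eq_bigr => i _; apply: eq_bigr => j _.
    by rewrite mxE; ring.
  by apply: divr_ge0; nonneg.
apply/matrixP => i j; rewrite DE mxE.
transitivity ((\sum_l ((2 * s * z i + s * r i) * z l + (s * z i + (2 * Z + s) * r i) * r l) *
    ((2 * s * z j + s * r j) * z l + (s * z j + (2 * Z + s) * r j) * r l)) / q ^+ 2).
  rewrite mulr_suml; apply: eq_bigr => l _; rewrite !mxE; field; by rewrite gt_eqF.
rewrite dotE; apply/eqP; rewrite eq_sym -subr_eq0.
apply/eqP; rewrite q2; field; rewrite -q2 expf_neq0// gt_eqF//.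
Qed.

End NuclearNorm.

(** * The descent cone of the penalized trace *)

Section Cone.
Context (R : realType) (n : nat).
Implicit Types (f g u v : 'I_n -> R).

Lemma cauchy_schwarz_sum f g : (\sum_i f i * g i) ^+ 2 <= sqn f * sqn g.
Proof.
set c := \sum_i f i * g i.
have key t : 0 <= sqn f - 2 * t * c + t ^+ 2 * sqn g.
  have -> : sqn f - 2 * t * c + t ^+ 2 * sqn g = \sum_i (f i - t * g i) ^+ 2.
    rewrite /sqn /c !mulr_sumr -sumrB -big_split; apply: eq_bigr => i _ /=; ring.
  by apply: sumr_ge0 => i _; exact: sqr_ge0.
have g0 := sqn_ge0 g; have f0 := sqn_ge0 f.
move: g0; rewrite le_eqVlt => /orP[/eqP g0|g0].
  rewrite -g0 mulr0; have [->|c0] := eqVneq c 0; first by rewrite expr0n.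
  have := key ((sqn f + 1) / (2 * c)); rewrite -g0 mulr0 addr0.
  have -> : sqn f - 2 * ((sqn f + 1) / (2 * c)) * c = -1 by field.
  by rewrite ler0N1.
have := key (c / sqn g).
have -> : sqn f - 2 * (c / sqn g) * c + (c / sqn g) ^+ 2 * sqn g =
    sqn f - c ^+ 2 / sqn g by field; rewrite gt_eqF.
by rewrite subr_ge0 ler_pdivrMr.
Qed.

Lemma abs_sum_le f g (a b : R) : 0 <= a -> 0 <= b -> sqn f <= a ^+ 2 -> sqn g <= b ^+ 2 ->
  `|\sum_i f i * g i| <= a * b.
Proof.
move=> a0 b0 fa gb; rewrite -ler_sqr ?nnegrE ?mulr_ge0// real_normK ?num_real//.
apply: le_trans (cauchy_schwarz_sum f g) _; rewrite exprMn.
by apply: ler_pM => //; exact: sqn_ge0.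
Qed.

Lemma frobD_le (A B : 'M[R]_n) : frob (A + B) <= frob A + frob B.
Proof.
rewrite -ler_sqr ?nnegrE ?addr_ge0 ?frob_ge0// frob_sqr.
have -> : \sum_i \sum_j (A + B) i j ^+ 2 = frob A ^+ 2 + 2 * mdot A B + frob B ^+ 2.
  rewrite !frob_sqr /mdot mulr_sumr -!big_split; apply: eq_bigr => i _ /=.
  rewrite mulr_sumr -!big_split; apply: eq_bigr => j _ /=; rewrite mxE; ring.
suff : mdot A B <= frob A * frob B by rewrite sqrrD mulr_natl; lra.
pose ra (C : 'M[R]_n) i := Num.sqrt (sqn (C i)).
have raE (C : 'M[R]_n) : sqn (ra C) = frob C ^+ 2.
  by rewrite frob_sqr; apply: eq_bigr => i _; rewrite sqr_sqrtr ?sqn_ge0.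
apply: (@le_trans _ _ (\sum_i ra A i * ra B i)).
  apply: ler_sum => i _; apply: le_trans (ler_norm _) _.
  by apply: abs_sum_le; rewrite ?sqrtr_ge0// sqr_sqrtr ?sqn_ge0.
by apply: le_trans (ler_norm _) _; apply: abs_sum_le; rewrite ?frob_ge0// raE.
Qed.

Lemma low_complexity_scale k (lam C c : R) (H : 'M[R]_n) : 0 <= c ->
  low_complexity k lam C H -> low_complexity k lam (c * C) (c *: H).
Proof.
move=> c0 [Om [S [G [Ok pS SO [tS mG ->]]]]]; exists Om, (c *: S), (c *: G).
have [ST _] := pS; split => //.
- apply/psdP; split; first by rewrite linearZ /= ST.
  move=> v; suff -> : bf (c *: S) v v = c * bf S v v.
    by rewrite mulr_ge0//; have /psdP[_] := pS; apply.
  rewrite /bf mulr_sumr; apply: eq_bigr => i _; rewrite mulr_sumr.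
  by apply: eq_bigr => j _; rewrite mxE; ring.
- by move=> i j iO; rewrite mxE SO ?mulr0.
- split; first by rewrite linearZ /= ler_wpM2l.
    have -> : mnorm1 (c *: G) = c * mnorm1 G.
      rewrite /mnorm1 mulr_sumr; apply: eq_bigr => i _; rewrite mulr_sumr.
      by apply: eq_bigr => j _; rewrite mxE normrM ger0_norm.
    by rewrite mulrCA ler_wpM2l.
  by rewrite scalerDr.
Qed.

Lemma l2v_sqr f : l2v f ^+ 2 = sqn f.
Proof. by rewrite sqr_sqrtr// sqn_ge0. Qed.

(** The trace of [D] is [|r|^2] for the tail [r], which is also the Frobenius norm of [r r^T], the
    block of [D] off [Om]. *)
Lemma trace_tail_le_frob (x : 'I_n -> R) (Om : {set 'I_n}) :
  \tr (outer x - outer (restr x Om)) <= frob (outer x - outer (restr x Om)).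
Proof.
set D := outer x - _; pose r i := if i \in Om then 0 else x i.
have DE i j : r i * r j = (if (i \in Om) || (j \in Om) then 0 else D i j).
  by rewrite /D /r !mxE /restr; case: (i \in Om); case: (j \in Om);
    rewrite /= ?mul0r ?mulr0 ?subr0.
have -> : \tr D = sqn r.
  apply: eq_bigr => i _; rewrite /D !mxE /restr /r; case: (i \in Om); rewrite ?mulr0; ring.
rewrite -ler_sqr ?nnegrE ?frob_ge0 ?sqn_ge0// frob_sqr expr2 mulr_suml.
apply: ler_sum => i _; rewrite mulr_sumr; apply: ler_sum => j _.
rewrite -exprMn DE; case: ifP => // _; by rewrite expr0n sqr_ge0.
Qed.

(** The head and the tail of [x] have disjoint supports, hence are orthogonal, and
    [rank_two_psd_sqrt] supplies the root. *)
Lemma frob_tail_le_nucnorm (x : 'I_n -> R) (Om : {set 'I_n}) :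
  frob (outer x - outer (restr x Om)) <= nucnorm (outer x - outer (restr x Om)).
Proof.
apply: frob_le_nucnorm; pose r i := if i \in Om then 0 else x i.
have zr : \sum_i restr x Om i * r i = 0.
  by rewrite big1// => i _; rewrite /restr /r; case: ifP; rewrite ?mulr0 ?mul0r.
have := rank_two_psd_sqrt zr; rewrite /=.
suff -> : \matrix_(i, j) (restr x Om i * r j + r i * restr x Om j + r i * r j) =
  outer x - outer (restr x Om) by [].
apply/matrixP => i j; rewrite !mxE /restr /r.
by case: (i \in Om); case: (j \in Om); ring.
Qed.

End Cone.

Section DescentCone.
Context (R : realType) (n : nat).

Lemma sum_restrict_le (Om : {set 'I_n}) (v : 'I_n -> R) (a : R) : 0 <= a -> sqn v <= a ^+ 2 ->
  \sum_(i in Om) `|v i| <= Num.sqrt #|Om|%:R * a.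
Proof.
move=> a0 va.
have -> : \sum_(i in Om) `|v i| = \sum_i (if i \in Om then 1 else 0) * `|v i|.
  by rewrite big_mkcond; apply: eq_bigr => i _; case: ifP; rewrite ?mul1r ?mul0r.
apply: le_trans (ler_norm _) _; apply: abs_sum_le => //; rewrite ?sqrtr_ge0//.
  rewrite sqr_sqrtr// /sqn (eq_bigr (fun i => if i \in Om then 1 else 0)); last first.
    by move=> i _; case: ifP; rewrite ?expr1n ?expr0n.
  by rewrite -big_mkcond sumr_const.
by apply: le_trans va; apply: ler_sum => i _; rewrite real_normK ?num_real.
Qed.

(* [sgn z (sgn z)^T] is a subgradient of the entrywise l1 norm at [z z^T], and pairing it with
   a matrix gives a quadratic form.  Writing [Xh - z z^T = u v^T + v u^T + S] with [u = z / |z|]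
   and [S] the compression of [Xh] to the orthogonal of [u], that form is nonnegative on [S],
   while [lam] times its value on the rest is controlled by [lam sqrt k |u|_1 <= 1]. *)
Lemma descent_low_complexity k (lam : R) (x : 'I_n -> R) (Om : {set 'I_n}) (Xh : 'M[R]_n) :
  let z := restr x Om in let D := outer x - outer z in
  let F := frob (Xh - outer x) in
  #|Om| = k -> 0 < lam -> 0 < l2v z -> lam * Num.sqrt k%:R * l1v z <= l2v z ->
  psd Xh -> \tr Xh + lam * mnorm1 Xh <= \tr (outer x) + lam * mnorm1 (outer x) ->
  frob D + lam * mnorm1 D <= F ->
  low_complexity k lam (12 * F) (Xh - outer x).
Proof.
move=> z D F Omk lam0 z0 zlam pX opt DF.
have [XT _] := pX; have /psdP[_ X0] := pX.
have zO i : i \notin Om -> z i = 0 by rewrite /z /restr => /negbTE ->.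
have F0 : 0 <= F by exact: frob_ge0.
have fD0 : 0 <= frob D by exact: frob_ge0.
have mD0 : 0 <= mnorm1 D by do 2!(apply: sumr_ge0 => ? _).
have lmD0 : 0 <= lam * mnorm1 D by rewrite mulr_ge0// ltW.
pose u i := z i / l2v z.
have u1 : sqn u = 1.
  rewrite /sqn /u; under eq_bigr do rewrite expr_div_n.
  by rewrite -mulr_suml -/(sqn z) -l2v_sqr divff// expf_neq0// gt_eqF.
have uz f : \sum_i z i * f i = l2v z * \sum_i u i * f i.
  rewrite mulr_sumr; apply: eq_bigr => i _; rewrite /u; field; by rewrite gt_eqF.
pose Hm := Xh - outer z.
have HmT : Hm^T = Hm.
  by rewrite /Hm linearB /= XT; congr (_ - _); apply/matrixP => i j; rewrite !mxE mulrC.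
have HmE : Hm = (Xh - outer x) + D by rewrite /Hm /D addrA subrK.
have fHm : frob Hm <= 2 * F.
  by rewrite HmE; apply: le_trans (frobD_le _ _) _; rewrite -/F; lra.
pose al := bf Hm u u.
pose g i := \sum_j Hm i j * u j.
have gE f : \sum_i g i * f i = bf Hm f u.
  apply: eq_bigr => i _; rewrite mulrC mulr_sumr; apply: eq_bigr => j _; by rewrite mulrA.
have sg2 : sqn g <= (2 * F) ^+ 2.
  apply: (@le_trans _ _ (frob Hm ^+ 2)); last first.
    by apply: lerXn2r => //; rewrite nnegrE ?frob_ge0// mulr_ge0.
  rewrite frob_sqr; apply: ler_sum => i _.
  have := cauchy_schwarz_sum (Hm i) u; rewrite u1 mulr1; exact.
have alF : `|al| <= 2 * F.
  rewrite /al -gE -[leRHS]mulr1; apply: abs_sum_le => //; first by rewrite mulr_ge0.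
  by rewrite u1 expr1n.
(* This choice makes [S] vanish on [u], so its form at [f] is that of [Hm] at the projection of [f]
   orthogonal to [u]. *)
pose v i := g i - al / 2 * u i.
have vE f : \sum_i v i * f i = bf Hm f u - al / 2 * \sum_i u i * f i.
  rewrite -gE mulr_sumr -sumrB; apply: eq_bigr => i _; rewrite /v; ring.
have sv : sqn v <= (2 * F) ^+ 2.
  apply: le_trans sg2.
  have -> : sqn v = sqn g - al * (\sum_i g i * u i) + al ^+ 2 / 4 * sqn u.
    rewrite /sqn !mulr_sumr -sumrB -big_split; apply: eq_bigr => i _ /=; rewrite /v; lra.
  rewrite (gE u) -/al u1; have := sqr_ge0 al; nra.
pose S : 'M[R]_n := \matrix_(i, j) (Hm i j - u i * v j - v i * u j).
have Hms i j : Hm i j = Hm j i by rewrite -[in LHS]HmT mxE.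
have ST : S^T = S by apply/matrixP => i j; rewrite mxE [S j i]mxE [S i j]mxE (Hms j i); ring.
have bfS f : bf S f f = bf Hm f f - 2 * (\sum_i u i * f i) * (\sum_i v i * f i).
  transitivity (bf Hm f f - ((\sum_i u i * f i) * (\sum_i v i * f i) +
      (\sum_i v i * f i) * (\sum_i u i * f i))); last by ring.
  rewrite !mulr_suml -big_split -sumrB; apply: eq_bigr => i _ /=.
  rewrite !mulr_sumr -big_split -sumrB; apply: eq_bigr => j _ /=; rewrite mxE; ring.
have pS : psd S.
  apply/psdP; split=> // f; rewrite bfS (vE f).
  set t := \sum_i u i * f i.
  have -> : bf Hm f f - 2 * t * (bf Hm f u - al / 2 * t) =
      bf Hm (fun i => f i + - t * u i) (fun i => f i + - t * u i).
    by rewrite bfDl !bfDr !bfZl !bfZr (bf_sym u f HmT) -/al; field.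
  (* [h] is orthogonal to [z], so [Hm] and the psd matrix [Xh] have the same form at [h]. *)
  set h := fun i => f i + - t * u i; rewrite /Hm bfB.
  have -> : bf (outer z) h h = (\sum_i z i * h i) ^+ 2.
    rewrite expr2 mulr_suml; apply: eq_bigr => i _; rewrite mulr_sumr.
    by apply: eq_bigr => j _; rewrite mxE; ring.
  have -> : \sum_i z i * h i = 0.
    rewrite (uz h); have -> : \sum_i u i * h i = t - t * sqn u.
      transitivity (\sum_i (u i * f i + - t * u i ^+ 2)).
        by apply: eq_bigr => i _; rewrite /h; ring.
      by rewrite big_split /= -mulr_sumr mulNr.
    by rewrite u1 mulr1 subrr mulr0.
  by rewrite expr0n subr0.
have trS : \tr S = \tr Hm - al.
  have uv : \sum_i v i * u i = al / 2.
    rewrite (vE u) -/al; have -> : \sum_i u i * u i = 1.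
      by rewrite -u1; apply: eq_bigr => i _; rewrite expr2.
    lra.
  have -> : al = 2 * \sum_i v i * u i by rewrite uv; lra.
  rewrite mulr_sumr -sumrB; apply: eq_bigr => i _; rewrite mxE; ring.
pose s i : R := Num.sg (z i).
have s1 i : `|s i| <= 1 by rewrite normr_sg lern1 leq_b1.
have sz i : s i * z i = `|z i| by rewrite normrEsg.
have sO i : i \notin Om -> s i = 0 by move=> /zO; rewrite /s => ->; rewrite sgr0.
pose off i j := if (i \in Om) && (j \in Om) then 0 else `|Hm i j|.
pose OFF := \sum_i \sum_j off i j.
have OFF0 : 0 <= OFF.
  by do 2!(apply: sumr_ge0 => ? _); rewrite /off; case: ifP.
(* On [Om] times [Om] the subgradient [s s^T] bounds the entries from below; elsewhere [z z^T]
   vanishes and [Xh] equals [Hm]. *)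
have mX : l1v z ^+ 2 + bf Hm s s + OFF <= mnorm1 Xh.
  rewrite expr2 mulr_suml /mnorm1 -!big_split; apply: ler_sum => i _ /=.
  rewrite mulr_sumr -!big_split; apply: ler_sum => j _ /=.
  have XE : Xh i j = z i * z j + Hm i j by rewrite !mxE; ring.
  rewrite /off; have [iO|iO] := boolP (i \in Om); last first.
    by rewrite XE (zO i iO) (sO i iO) normr0 !mul0r !add0r.
  have [jO|jO] := boolP (j \in Om); last first.
    by rewrite XE (zO j jO) (sO j jO) normr0 !mulr0 !add0r.
  rewrite addr0; apply: (@le_trans _ _ (s i * s j * Xh i j)).
    by rewrite XE -!sz; lra.
  apply: le_trans (ler_norm _) _; rewrite !normrM ler_piMl//.
  by rewrite -[leRHS]mulr1; apply: ler_pM.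
have mx : mnorm1 (outer x) <= l1v z ^+ 2 + mnorm1 D.
  rewrite expr2 mulr_suml /mnorm1 -big_split; apply: ler_sum => i _ /=.
  rewrite mulr_sumr -big_split; apply: ler_sum => j _ /=; rewrite -normrM.
  have -> : outer x i j = z i * z j + D i j by rewrite /D !mxE; ring.
  exact: ler_normD.
have trx : \tr (outer x) = \tr (outer z) + \tr D by rewrite -linearD /= addrC subrK.
have trX : \tr Xh = \tr (outer z) + \tr Hm by rewrite -linearD /= addrC subrK.
have trD : \tr D <= frob D by exact: trace_tail_le_frob.
have us : \sum_i u i * s i = l1v z / l2v z.
  rewrite /l1v mulr_suml; apply: eq_bigr => i _; rewrite -sz /u; ring.
have us0 : 0 <= l1v z / l2v z.
  by rewrite divr_ge0 ?(ltW z0)// /l1v sumr_ge0.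
have lus : lam * (l1v z / l2v z) * Num.sqrt k%:R <= 1.
  by rewrite mulrA mulrAC ler_pdivrMr// mul1r mulrAC.
have vOm : \sum_(i in Om) `|v i| <= Num.sqrt k%:R * (2 * F).
  by rewrite -Omk; apply: sum_restrict_le => //; rewrite mulr_ge0.
have vs : `|\sum_i v i * s i| <= Num.sqrt k%:R * (2 * F).
  apply: le_trans vOm; rewrite [leRHS]big_mkcond; apply: le_trans (ler_norm_sum _ _ _) _.
  apply: ler_sum => i _; case: ifP => [_|/negbT iO]; last by rewrite sO// mulr0 normr0.
  by rewrite normrM ler_piMr.
have Hss : - (4 * F) <= lam * bf Hm s s.
  have := bfS s; have /psdP[_ /(_ s)] := pS; rewrite us.
  set w := \sum_i v i * s i in vs *; set uu := l1v z / l2v z in us0 lus * => S0 E.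
  have hw : - (Num.sqrt k%:R * (2 * F)) <= w by move: vs => /ler_normlP[]; lra.
  have h1 := ler_wpM2l (mulr_ge0 (ltW lam0) us0) hw.
  have F2 : 0 <= 2 * F by rewrite mulr_ge0.
  have h2 := ler_wpM2r F2 lus.
  have h3 : 0 <= lam * bf S s s by rewrite mulr_ge0// ltW.
  have h4 : lam * bf S s s = lam * bf Hm s s - 2 * (lam * uu * w) by rewrite E; ring.
  lra.
have tS0 := psd_trace_ge0 pS.
have lOFF0 : 0 <= lam * OFF by rewrite mulr_ge0// ltW.
(* Here 7 is [1 + 2 + 4]: approximation error, [- al], subgradient term. *)
have main : \tr S + lam * OFF <= 7 * F.
  have h1 := ler_wpM2l (ltW lam0) mX; have h2 := ler_wpM2l (ltW lam0) mx.
  have := ler_norm (- al); rewrite normrN => al1.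
  rewrite trS; rewrite trx trX in opt; lra.
pose S' : 'M[R]_n := \matrix_(i, j) (if (i \in Om) && (j \in Om) then S i j else 0).
exists Om, S', (Xh - outer x - S'); split => //.
- apply/psdP; split.
    have Ss i j : S i j = S j i by rewrite -[in LHS]ST mxE.
    by apply/matrixP => i j; rewrite mxE [S' j i]mxE [S' i j]mxE andbC Ss.
  move=> f; suff -> : bf S' f f = bf S (fun i => if i \in Om then f i else 0)
      (fun i => if i \in Om then f i else 0) by have /psdP[_] := pS; apply.
  apply: eq_bigr => i _; apply: eq_bigr => j _; rewrite [in LHS]mxE.
  by case: (i \in Om); case: (j \in Om); rewrite /= ?mulr0 ?mul0r.
- by move=> i j iO; rewrite mxE (negbTE iO).
split; last by rewrite [RHS]addrC subrK.
  apply: (@le_trans _ _ (\tr S)); last by lra.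
  apply: ler_sum => i _; rewrite [S' i i]mxE andbb; case: ifP => // _.
  exact: psd_diag_ge0.
(* The constant 12 is [1 + 7 + 4]: [D], the entries off [Om], and the two products of [|u|_1] with
   the l1 norm of [v] on [Om]. *)
pose uu i := if i \in Om then `|u i| else 0; pose vv i := if i \in Om then `|v i| else 0.
have mG : mnorm1 (Xh - outer x - S') <=
    mnorm1 D + OFF + ((\sum_i uu i) * (\sum_i vv i) + (\sum_i vv i) * (\sum_i uu i)).
  rewrite !mulr_suml /mnorm1 -!big_split; apply: ler_sum => i _ /=.
  rewrite !mulr_sumr -!big_split; apply: ler_sum => j _ /=.
  have -> : (Xh - outer x - S') i j = Hm i j - D i j - S' i j.
    have -> : Xh - outer x = Hm - D by rewrite HmE addrK.
    by rewrite mxE [(- S') i j]mxE [(Hm - D) i j]mxE [(- D) i j]mxE.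
  rewrite [S' i j]mxE /off /uu /vv.
  have Dm := ler_norm (D i j); have Dm' := ler_norm (- D i j); rewrite normrN in Dm'.
  case: (i \in Om); case: (j \in Om); rewrite /= ?mulr0 ?mul0r ?addr0 ?subr0; last 3 first.
  - by apply: le_trans (ler_normB _ _) _; lra.
  - by apply: le_trans (ler_normB _ _) _; lra.
  - by apply: le_trans (ler_normB _ _) _; lra.
  rewrite [S i j]mxE.
  have -> : Hm i j - D i j - (Hm i j - u i * v j - v i * u j) =
      - D i j + (u i * v j + v i * u j) by ring.
  apply: le_trans (ler_normD _ _) _; rewrite normrN lerD2l.
  by apply: le_trans (ler_normD _ _) _; rewrite !normrM.
have suu : \sum_i uu i = l1v z / l2v z.
  rewrite /l1v mulr_suml; apply: eq_bigr => i _; rewrite /uu /u.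
  case: ifP => [_|/negbT iO]; last by rewrite zO// normr0 mul0r.
  by rewrite normrM normfV (gtr0_norm z0).
have svv : \sum_i vv i <= Num.sqrt k%:R * (2 * F).
  by apply: le_trans vOm; rewrite [leRHS]big_mkcond.
rewrite suu in mG.
have h1 := ler_wpM2l (ltW lam0) mG.
have h2 := ler_wpM2l (mulr_ge0 (ltW lam0) us0) svv.
have F2 : 0 <= 2 * F by rewrite mulr_ge0.
have h3 := ler_wpM2r F2 lus.
have : lam * mnorm1 D <= F by lra.
have : lam * OFF <= 7 * F by lra.
lra.
Qed.

End DescentCone.

(** * Rounding of the entries to a grid *)

Section Grid.
Context (R : realType).

(* Cells of width [1 / N ^+ 2] on [[-N, N[]; [ord_max] collects the two tails. *)
Definition gidx N (x : R) : 'I_(2 * N ^ 3).+1 :=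
  if - N%:R <= x < N%:R then inord (Num.truncn ((x + N%:R) * N%:R ^+ 2)) else ord_max.

Definition gval N (v : 'I_(2 * N ^ 3).+1) : R :=
  if v == ord_max then 0 else v%:R / N%:R ^+ 2 - N%:R.

Lemma gidx_in N (x : R) : (0 < N)%N -> - N%:R <= x < N%:R ->
  let k := Num.truncn ((x + N%:R) * N%:R ^+ 2) in
  [/\ gidx N x = k :> nat, (k < 2 * N ^ 3)%N &
      k%:R <= (x + N%:R) * N%:R ^+ 2 < k.+1%:R].
Proof.
move=> N0 xN k; have N0' : 0 < N%:R :> R by rewrite ltr0n.
have /andP[x1 x2] := xN.
have t0 : 0 <= (x + N%:R) * N%:R ^+ 2 by rewrite mulr_ge0 ?sqr_ge0//; lra.
have kM : (k < 2 * N ^ 3)%N.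
  rewrite truncn_lt_nat// natrM natrX [N%:R ^+ 3]exprS mulrA ltr_pM2r ?exprn_gt0//; lra.
split => //; last exact: truncn_itv.
by rewrite /gidx xN inordK// ltnW.
Qed.

Lemma gidx_out N (x : R) : ~~ (- N%:R <= x < N%:R) -> gidx N x = ord_max.
Proof. by rewrite /gidx => /negbTE ->. Qed.

Lemma gidx_eq_max N (x : R) : (0 < N)%N -> (gidx N x == ord_max) = ~~ (- N%:R <= x < N%:R).
Proof.
move=> N0; have [xN|xN] := boolP (- N%:R <= x < N%:R); last by rewrite gidx_out// eqxx.
apply/negbTE; have [E kM _] := gidx_in N0 xN.
by rewrite -val_eqE /= E neq_ltn kM.
Qed.

Lemma gval_close N (x : R) : (0 < N)%N -> - N%:R <= x < N%:R ->
  `|gval (gidx N x) - x| <= (N%:R ^+ 2)^-1.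
Proof.
move=> N0 xN; have N0' : 0 < N%:R ^+ 2 :> R by rewrite exprn_gt0// ltr0n.
have := gidx_eq_max x N0; rewrite xN => ne.
rewrite /gval ne /=; have [-> kM /andP[k1 k2]] := gidx_in N0 xN.
set k := Num.truncn _ in k1 k2 *.
have h1 : k%:R / N%:R ^+ 2 <= x + N%:R by rewrite ler_pdivrMr.
have h2 : x + N%:R < k%:R / N%:R ^+ 2 + (N%:R ^+ 2)^-1.
  have -> : k%:R / N%:R ^+ 2 + (N%:R ^+ 2)^-1 = k.+1%:R / N%:R ^+ 2 :> R.
    by rewrite -natr1 mulrDl mul1r.
  by rewrite ltr_pdivlMr.
by rewrite ler_norml; apply/andP; split; lra.
Qed.

Lemma measurable_gidx N v : (0 < N)%N -> measurable (gidx N @^-1` [set v]).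
Proof.
move=> N0; have N0' : 0 < N%:R ^+ 2 :> R by rewrite exprn_gt0// ltr0n.
have [->|vm] := eqVneq v ord_max.
  rewrite (_ : _ @^-1` _ = ~` [set` `[(- N%:R : R), N%:R[]).
    by apply: measurableC; exact: measurable_itv.
  apply/seteqP; split => x /=; rewrite in_itv /=.
    by move=> /eqP; rewrite gidx_eq_max// => /negP.
  by move=> /negP h; apply/eqP; rewrite gidx_eq_max.
have vM : (v < 2 * N ^ 3)%N.
  by rewrite ltn_neqAle -ltnS ltn_ord andbT; apply: contraNneq vm => vE; apply/eqP/val_inj.
have vM' : v.+1%:R <= 2 * N%:R * N%:R ^+ 2 :> R.
  by rewrite -mulrA -exprS -natrX -natrM ler_nat.
rewrite (_ : _ @^-1` _ = [set` `[(v%:R / N%:R ^+ 2 - N%:R : R),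
    (v.+1%:R / N%:R ^+ 2 - N%:R)[]); first exact: measurable_itv.
apply/seteqP; split => x /=; rewrite in_itv /=.
  move=> vE; have xN : - N%:R <= x < N%:R.
    by have := gidx_eq_max x N0; rewrite vE (negbTE vm) => /esym/negbFE.
  have [E kM kx] := gidx_in N0 xN; move: E kx; rewrite vE => <-.
  by rewrite lerBlDr ler_pdivrMr// ltrBrDr ltr_pdivlMr.
rewrite lerBlDr ler_pdivrMr// ltrBrDr ltr_pdivlMr// => kx.
have /andP[k1 k2] := kx.
have xN : - N%:R <= x < N%:R.
  have h0 : 0 <= (x + N%:R) * N%:R ^+ 2 by apply: le_trans k1.
  have h1 := lt_le_trans k2 vM'.
  rewrite pmulr_lge0// in h0; rewrite ltr_pM2r// in h1.
  by apply/andP; split; lra.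
have [E _ _] := gidx_in N0 xN; apply: val_inj; rewrite /= E.
exact: truncn_def.
Qed.

End Grid.

Section FiniteQuantization.
Context (R : realType) (mu : probability R R).

Lemma Rintegral_comp_fin (V : finType) (idx : R -> V) (g : V -> R) :
  (forall v, measurable (idx @^-1` [set v])) ->
  mu.-integrable setT (EFin \o (g \o idx)) /\
  \int[mu]_x g (idx x) = \sum_v fine (mu (idx @^-1` [set v])) * g v.
Proof.
move=> mC.
pose f v x : \bar R := ((g v)%:E * (\1_(idx @^-1` [set v]) x)%:E)%E.
have fi v : mu.-integrable setT (f v).
  by apply: integrableZl => //; exact: integrable_indic.
have fE x : (g (idx x))%:E = (\sum_v f v x)%R.
  rewrite (bigD1 (idx x))//= /f indicE mem_set//= mule1 big1 ?adde0// => v vx.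
  by rewrite indicE memNset ?mule0//= => /eqP; rewrite eq_sym (negbTE vx).
split.
  rewrite (_ : EFin \o _ = fun x => (\sum_v f v x)%R); last by apply/funext => x; rewrite /= fE.
  exact: integrable_sum.
rewrite /Rintegral; under eq_integral do rewrite fE.
rewrite integral_sum// /f (_ : (\sum_v _)%R = (\sum_v fine (mu (idx @^-1` [set v])) * g v)%:E)//.
rewrite -sumEFin; apply: eq_bigr => v _.
rewrite integralZl//; last exact: integrable_indic.
rewrite integral_indic// setIT EFinM muleC fineK//.
by rewrite fin_num_measure.
Qed.

Lemma sum_le_Rintegral (V : finType) (idx : R -> V) (g : V -> R) (G : R -> R) :
  (forall v, measurable (idx @^-1` [set v])) -> mu.-integrable setT (EFin \o G) ->
  (forall x, g (idx x) <= G x) ->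
  \sum_v fine (mu (idx @^-1` [set v])) * g v <= \int[mu]_x G x.
Proof.
move=> mC iG gG; have [ig <-] := Rintegral_comp_fin g mC.
by apply: le_Rintegral => // x _; exact: gG.
Qed.

Lemma sum_ge_Rintegral (V : finType) (idx : R -> V) (g : V -> R) (G : R -> R) :
  (forall v, measurable (idx @^-1` [set v])) -> mu.-integrable setT (EFin \o G) ->
  (forall x, G x <= g (idx x)) ->
  \int[mu]_x G x <= \sum_v fine (mu (idx @^-1` [set v])) * g v.
Proof.
move=> mC iG gG; have [ig <-] := Rintegral_comp_fin g mC.
by apply: le_Rintegral => // x _; exact: gG.
Qed.

End FiniteQuantization.

Section Discretization.
Context (R : realType).

(** [(1 + x ^+ 2) ^+ 4] is the common majorant of all rounding errors; this makes it integrable. *)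
Lemma quartic_le_expR (K x : R) : 0 < K ->
  (1 + x ^+ 2) ^+ 4 <= (8 + 8 * 4 ^+ 4 * K ^+ 4) * expR (x ^+ 2 / K).
Proof.
move=> K0; set y := x ^+ 2; have y0 : 0 <= y by exact: sqr_ge0.
have yK : 0 <= y / K by rewrite divr_ge0// ltW.
have h := @exprn_le_expR R 3 (y / K) yK.
rewrite expr_div_n ler_pdivrMr ?exprn_gt0// in h.
have e1 : 1 <= expR (y / K) by have := expR_ge1Dx (y / K); lra.
have h2 : (1 + y) ^+ 4 <= 8 + 8 * y ^+ 4.
  have : 0 <= (y - 1) ^+ 2 * (7 * y ^+ 2 + 10 * y + 7).
    by rewrite mulr_ge0 ?sqr_ge0//; have := sqr_ge0 y; lra.
  lra.
apply: le_trans h2 _; rewrite [leRHS]mulrDl; apply: lerD; first by lra.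
have -> : 8 * 4 ^+ 4 * K ^+ 4 * expR (y / K) = 8 * (4 ^+ 4 * expR (y / K) * K ^+ 4) by ring.
by rewrite ler_pM2l.
Qed.

Lemma perturbed_powers (eps x y : R) : 0 <= eps <= 1 -> `|y - x| <= eps ->
  `|y ^+ 2 - x ^+ 2| <= 15 * eps * (1 + x ^+ 2) ^+ 4 /\
  `|y ^+ 4 - x ^+ 4| <= 15 * eps * (1 + x ^+ 2) ^+ 4.
Proof.
move=> /andP[e0 e1] yx; set d := y - x in yx *.
have yE : y = x + d by rewrite /d addrC subrK.
set q := 1 + x ^+ 2; have q1 : 1 <= q by rewrite /q; have := sqr_ge0 x; lra.
have a0 := normr_ge0 x; set a := `|x| in a0.
have aq : a <= q.
  have : a ^+ 2 = x ^+ 2 by rewrite real_normK ?num_real.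
  by rewrite /q => <-; have := sqr_ge0 (a - 1); nra.
have d1 : `|d| <= 1 by exact: le_trans e1.
have q2 : q <= q ^+ 2 by rewrite expr2 ler_peMl//; lra.
have q24 : q ^+ 2 <= q ^+ 4.
  by rewrite -[4%N]/(2 + 2)%N exprD ler_peMr ?sqr_ge0//; lra.
have q0 : 0 <= q by lra.
split.
  have -> : y ^+ 2 - x ^+ 2 = d * (2 * x + d) by rewrite yE; ring.
  rewrite normrM; apply: (@le_trans _ _ (eps * (3 * q ^+ 4))); last first.
    by have := mulr_ge0 e0 (exprn_ge0 4 q0); lra.
  apply: ler_pM => //; apply: le_trans (ler_normD _ _) _.
  by rewrite normrM ger0_norm// -/a; lra.
have -> : y ^+ 4 - x ^+ 4 = d * (4 * x ^+ 3 + 6 * x ^+ 2 * d + 4 * x * d ^+ 2 + d ^+ 3).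
  by rewrite yE; ring.
rewrite normrM; apply: (@le_trans _ _ (eps * (15 * q ^+ 4))); last first.
  by have := mulr_ge0 e0 (exprn_ge0 4 q0); lra.
apply: ler_pM => //.
have d2 : `|d| ^+ 2 <= 1 by rewrite expr_le1.
have d3 : `|d| ^+ 3 <= 1 by rewrite expr_le1.
have a2 : a ^+ 2 <= q by rewrite /q real_normK ?num_real//; lra.
have a3 : a ^+ 3 <= q ^+ 2 by rewrite exprS [q ^+ 2]expr2; apply: ler_pM; rewrite ?exprn_ge0.
have t1 : `|4 * x ^+ 3| <= 4 * q ^+ 4.
  by rewrite normrM normrX ger0_norm// ler_pM2l// -/a; lra.
have t2 : `|6 * x ^+ 2 * d| <= 6 * q ^+ 4.
  rewrite normrM normrM normrX ger0_norm// -/a -mulrA ler_pM2l//.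
  by rewrite -[leRHS]mulr1; apply: ler_pM => //; rewrite ?exprn_ge0//; lra.
have t3 : `|4 * x * d ^+ 2| <= 4 * q ^+ 4.
  rewrite normrM normrM normrX ger0_norm// -/a -mulrA ler_pM2l//.
  by rewrite -[leRHS]mulr1; apply: ler_pM => //; rewrite ?exprn_ge0//; lra.
have t4 : `|d ^+ 3| <= q ^+ 4 by rewrite normrX; lra.
apply: le_trans (ler_normD _ _) _; have := ler_normD (4 * x ^+ 3 + 6 * x ^+ 2 * d) (4 * x * d ^+ 2).
by have := ler_normD (4 * x ^+ 3) (6 * x ^+ 2 * d); lra.
Qed.

(** In the tails [1 <= eps * |x|]: one spare factor [|x|] buys a factor [eps], which is why the
    majorant has higher degree than the moments. *)
Lemma tail_powers (eps N x y : R) : 0 <= eps <= 1 -> 1 <= N -> N^-1 <= eps -> N <= `|x| ->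
  `|y| <= eps ->
  `|y ^+ 2 - x ^+ 2| <= 15 * eps * (1 + x ^+ 2) ^+ 4 /\
  `|y ^+ 4 - x ^+ 4| <= 15 * eps * (1 + x ^+ 2) ^+ 4.
Proof.
move=> /andP[e0 e1] N1 Ne Nx ye.
set q := 1 + x ^+ 2; have q1 : 1 <= q by rewrite /q; have := sqr_ge0 x; lra.
have q0 : 0 <= q by lra.
have a0 := normr_ge0 x; set a := `|x| in a0 Nx.
have a2E : a ^+ 2 = x ^+ 2 by rewrite real_normK ?num_real.
have aq : a <= q by rewrite /q -a2E; have := sqr_ge0 (a - 1); nra.
have a2 : a ^+ 2 <= q by rewrite /q a2E; lra.
have ea : 1 <= eps * a.
  have N0 : 0 < N by lra.
  have : N^-1 * N <= eps * a by apply: ler_pM => //; [rewrite invr_ge0|]; lra.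
  by rewrite mulVf// gt_eqF.
have eq0 : 0 <= eps * q ^+ 4 by rewrite mulr_ge0 ?exprn_ge0.
have q24 : q ^+ 2 <= q ^+ 4.
  have q21 : 1 <= q ^+ 2 by rewrite exprn_ege1.
  by rewrite -[4%N]/(2 + 2)%N exprD ler_peMr ?sqr_ge0.
have q34 : q ^+ 3 <= q ^+ 4 by rewrite [leRHS]exprS ler_peMl// exprn_ge0.
have q14 : 1 <= q ^+ 4 by rewrite exprn_ege1.
have x2 : x ^+ 2 <= eps * q ^+ 4.
  rewrite -a2E; apply: (@le_trans _ _ (eps * a * a ^+ 2)).
    by rewrite ler_peMl ?exprn_ge0.
  rewrite -mulrA ler_wpM2l//; apply: le_trans q24; rewrite [q ^+ 2]expr2.
  by apply: ler_pM; rewrite ?exprn_ge0.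
have x4 : x ^+ 4 <= eps * q ^+ 4.
  have -> : x ^+ 4 = (a ^+ 2) ^+ 2 by rewrite a2E -exprM.
  apply: (@le_trans _ _ (eps * a * (a ^+ 2) ^+ 2)).
    by rewrite ler_peMl ?exprn_ge0.
  rewrite -mulrA ler_wpM2l//; apply: le_trans q34; rewrite [q ^+ 3]exprS.
  by apply: ler_pM; rewrite ?exprn_ge0// lerXn2r ?nnegrE ?exprn_ge0.
have y1 : `|y| <= 1 by exact: le_trans e1.
have eq1 : eps <= eps * q ^+ 4 by rewrite ler_peMr.
have yp n : (0 < n)%N -> `|y ^+ n| <= eps * q ^+ 4.
  move=> n0; apply: le_trans eq1; rewrite normrX -(prednK n0) exprS.
  by apply: le_trans ye; rewrite ler_piMr// exprn_ile1.
split; apply: le_trans (ler_normB _ _) _.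
  have := yp 2%N isT; rewrite (ger0_norm (sqr_ge0 x)); lra.
have := yp 4%N isT; rewrite (ger0_norm (exprn_even_ge0 x (isT : ~~ odd 4))); lra.
Qed.

Context (mu : probability R R).

Lemma subgaussian_integrable (K : R) : 0 < K ->
  (\int[mu]_x (expR (x ^+ 2 / K))%:E <= 1 + 1)%E ->
  [/\ mu.-integrable setT (EFin \o (fun x => expR (x ^+ 2 / K))),
      \int[mu]_x expR (x ^+ 2 / K) <= 2 &
      forall (h : R -> R) c, measurable_fun setT h ->
        (forall x, `|h x| <= c * expR (x ^+ 2 / K)) -> mu.-integrable setT (EFin \o h)].
Proof.
move=> K0 intle.
have me : measurable_fun setT (fun x : R => expR (x ^+ 2 / K)).
  by apply: measurableT_comp => //; apply: measurable_funM.
have ie : mu.-integrable setT (EFin \o (fun x => expR (x ^+ 2 / K))).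
  apply/integrableP; split; first exact/measurable_EFinP.
  under eq_integral do rewrite /= ger0_norm ?expR_ge0//.
  by apply: le_lt_trans intle _; rewrite -EFinD ltry.
split => //.
  rewrite -lee_fin /Rintegral fineK; last exact: integrable_fin_num.
  by rewrite (_ : 2 = 1 + 1 :> R)// EFinD.
move=> h c mh hc.
apply: (le_integrable _ _ _ (integrableZl _ c ie)) => //; first exact/measurable_EFinP.
move=> x _ /=; rewrite lee_fin; apply: le_trans (hc x) _; exact: ler_norm.
Qed.

End Discretization.

Section PointwiseEstimates.
Context (R : realType).

Lemma expR_quarter_le : expR (1 / 4) <= 4 / 3 :> R.
Proof.
have h := expR_ge1Dx (- (1 / 4) : R).
have e : expR (- (1 / 4)) * expR (1 / 4) = 1 :> R by rewrite -expRD addNr expR0.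
have := ler_wpM2r (expR_ge0 (1 / 4 : R)) h; rewrite e; lra.
Qed.

(** Enlarging [K] to [16 * K] pays for rounding: the exponent is at most [1 / 4 + y / 8], and the
    resulting bound integrates to at most [7 / 6 + 2 / 6 <= 2]. *)
Lemma expR_square_le (K eps x z : R) : 0 < K -> eps <= 2 * K ->
  z ^+ 2 <= 2 * x ^+ 2 + 2 * eps ->
  expR (z ^+ 2 / (16 * K)) <= 7 / 6 + 1 / 6 * expR (x ^+ 2 / K).
Proof.
move=> K0 eK zx; set y := x ^+ 2 / K.
have y0 : 0 <= y by rewrite divr_ge0 ?sqr_ge0// ltW.
have h8 : 0 <= (1 / 8 : R) <= 1 by apply/andP; split; lra.
have e8 := expR_chord h8 y0.
apply: (@le_trans _ _ (expR (1 / 4) * expR (1 / 8 * y))).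
  rewrite -expRD ler_expR ler_pdivrMr ?mulr_gt0//.
  have -> : (1 / 4 + 1 / 8 * y) * (16 * K) = 4 * K + 2 * x ^+ 2.
    by rewrite /y; field; rewrite gt_eqF.
  lra.
have := ler_pM (expR_ge0 (1 / 4 : R)) (expR_ge0 (1 / 8 * y)) expR_quarter_le e8; lra.
Qed.

Lemma square_near (eps x z : R) : 0 <= eps <= 1 -> `|z - x| <= eps ->
  z ^+ 2 <= 2 * x ^+ 2 + 2 * eps.
Proof.
move=> /andP[e0 e1] zx.
have h1 : (z - x) ^+ 2 <= eps ^+ 2.
  by rewrite -(real_normK (num_real (z - x))); apply: lerXn2r.
have h2 : eps ^+ 2 <= eps by rewrite expr2 ler_piMl.
have := sqr_ge0 (z - 2 * x); lra.
Qed.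

Lemma square_small (eps x z : R) : 0 <= eps <= 1 -> `|z| <= eps ->
  z ^+ 2 <= 2 * x ^+ 2 + 2 * eps.
Proof.
move=> e01 ze; have := @square_near eps 0 z e01; rewrite subr0 => /(_ ze).
by have := sqr_ge0 x; rewrite expr0n /=; lra.
Qed.

(** The difference loses at most [3 * eta + eta ^+ 2 <= 4 * eta], that is, at most half of
    [m4 - 1]. *)
Lemma moments_near (m4 eta s2 s4 : R) : 0 <= eta -> eta <= 1 / 2 -> eta <= (m4 - 1) / 8 ->
  `|s2 - 1| <= eta -> `|s4 - m4| <= eta -> 1 / 2 <= s2 /\ (m4 - 1) / 2 <= s4 - s2 ^+ 2.
Proof.
move=> e0 e1 e2 /ler_normlP[a1 a2] /ler_normlP[a3 a4]; split; first by lra.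
have : s2 ^+ 2 <= (1 + eta) ^+ 2 by apply: lerXn2r; rewrite ?nnegrE; lra.
nra.
Qed.

Lemma notin_grid_norm N (x : R) : ~~ (- N%:R <= x < N%:R) -> N%:R <= `|x|.
Proof.
move=> xN; rewrite leNgt; apply: contra xN => /ltr_normlP[h1 h2].
by apply/andP; split; [lra|].
Qed.

Lemma pow_le_quartic (x : R) n : (n <= 4)%N -> (x ^+ 2) ^+ n <= (1 + x ^+ 2) ^+ 4.
Proof.
move=> n4; have x0 := sqr_ge0 x.
apply: (@le_trans _ _ ((1 + x ^+ 2) ^+ n)).
  by apply: lerXn2r; rewrite ?nnegrE ?addr_ge0// lerDr.
by apply: ler_weXn2l => //; rewrite lerDl.
Qed.

(** In the tails the error is [|x| <= x ^+ 4 / N ^+ 2]. The order [N ^- 2] makes the recentring as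
    small as the cells. *)
Lemma gval_near N (x : R) : (0 < N)%N ->
  `|gval R (gidx N x) - x| <= (N%:R ^+ 2)^-1 * (1 + x ^+ 2) ^+ 4.
Proof.
move=> N0; have N0' : 0 < N%:R :> R by rewrite ltr0n.
have N1 : 1 <= N%:R :> R by rewrite ler1n.
have [xN|xN] := boolP (- N%:R <= x < N%:R).
  apply: le_trans (gval_close N0 xN) _; rewrite ler_peMr ?invr_ge0 ?sqr_ge0//.
  by have := @pow_le_quartic x 0 isT; rewrite expr0.
rewrite gidx_out// /gval eqxx sub0r normrN mulrC ler_pdivlMr ?exprn_gt0//.
have Nx := notin_grid_norm xN.
have x2 : N%:R ^+ 2 <= x ^+ 2.
  by rewrite -(real_normK (num_real x)); apply: lerXn2r => //; rewrite nnegrE// ltW.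
apply: le_trans (@pow_le_quartic x 2 isT).
have xx : `|x| <= x ^+ 2.
  by rewrite -(real_normK (num_real x)) expr2 ler_peMl//; lra.
by rewrite expr2; apply: ler_pM => //; rewrite exprn_ge0// ltW.
Qed.

Lemma shifted_grid N (x be eps : R) : (0 < N)%N -> 0 <= eps <= 1 -> N%:R^-1 <= eps ->
  (N%:R ^+ 2)^-1 + `|be| <= eps ->
  [/\ `|(gval R (gidx N x) - be) ^+ 2 - x ^+ 2| <= 15 * eps * (1 + x ^+ 2) ^+ 4,
      `|(gval R (gidx N x) - be) ^+ 4 - x ^+ 4| <= 15 * eps * (1 + x ^+ 2) ^+ 4 &
      (gval R (gidx N x) - be) ^+ 2 <= 2 * x ^+ 2 + 2 * eps].
Proof.
move=> N0 e01 Ne be1.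
have N1 : 1 <= N%:R :> R by rewrite ler1n.
have NN0 : 0 <= (N%:R ^+ 2)^-1 :> R by rewrite invr_ge0 sqr_ge0.
have [xN|xN] := boolP (- N%:R <= x < N%:R).
  have near : `|gval R (gidx N x) - be - x| <= eps.
    rewrite -addrAC; apply: le_trans (ler_normB _ _) _; apply: le_trans be1.
    by rewrite lerD2r; exact: gval_close.
  by have [h1 h2] := perturbed_powers e01 near; split=> //; exact: square_near.
have small : `|gval R (gidx N x) - be| <= eps.
  by rewrite gidx_out// /gval eqxx sub0r normrN; lra.
have [h1 h2] := @tail_powers R eps N%:R x _ e01 N1 Ne (notin_grid_norm xN) small.
by split=> //; exact: square_small.
Qed.

End PointwiseEstimates.

Section DiscretizedLaw.
Context (R : realType) (mu : probability R R).

Lemma sum_near_Rintegral (V : finType) (idx : R -> V) (g : V -> R) (h e : R -> R) (c : R) :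
  (forall v, measurable (idx @^-1` [set v])) -> mu.-integrable setT (EFin \o h) ->
  mu.-integrable setT (EFin \o e) -> \int[mu]_x e x <= 2 -> 0 <= c ->
  (forall x, `|g (idx x) - h x| <= c * e x) ->
  `|\sum_v fine (mu (idx @^-1` [set v])) * g v - \int[mu]_x h x| <= 2 * c.
Proof.
move=> mC ih ie e2 c0 gh.
have ice a : mu.-integrable setT (EFin \o (fun x => a * e x)).
  by rewrite (_ : EFin \o _ = fun x => (a%:E * (EFin \o e) x)%E)//; exact: integrableZl.
have ihe a : mu.-integrable setT (EFin \o (fun x => h x + a * e x)).
  by rewrite (_ : EFin \o _ = (EFin \o h) \+ (EFin \o (fun x => a * e x)))//; exact: integrableD.
have E a : \int[mu]_x (h x + a * e x) = \int[mu]_x h x + a * \int[mu]_x e x.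
  by rewrite RintegralD// RintegralZl.
have u := @sum_le_Rintegral _ mu V idx g _ mC (ihe c).
have l := @sum_ge_Rintegral _ mu V idx g _ mC (ihe (- c)).
rewrite E in u; rewrite E in l.
have {}u := u (fun x => ltac:(have /ler_normlP[_ ?] := gh x; lra)).
have {}l := l (fun x => ltac:(have /ler_normlP[? _] := gh x; lra)).
have := ler_wpM2l c0 e2; move: u l; set S := \sum_v _; set I := \int[mu]_x h x.
set J := \int[mu]_x e x => u l cJ.
by rewrite ler_norml; apply/andP; split; lra.
Qed.

(** An error of order [N ^- 2] on entries of size up to [N] perturbs quadratic forms by order
    [1 / N], so every fixed precision is reached while [K], [v0] and [B] stay put. *)
Definition grid_law N (K v0 B : R) : Prop :=
  exists (P : fdist R 'I_(2 * N ^ 3).+1) (b : 'I_(2 * N ^ 3).+1 -> R),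
  [/\ entry_law P b K v0,
      forall v, mu (gidx N @^-1` [set v]) = (P v)%:E,
      P ord_max <= (N%:R ^+ 2)^-1 &
      forall x, gidx N x != ord_max -> `|x| <= N%:R /\ `|b (gidx N x) - x| <= B / N%:R ^+ 2].

Lemma grid_law_of_moments (K A m4 eta eps : R) N : (0 < N)%N ->
  let e := fun x => expR (x ^+ 2 / K) in let B := 1 + 2 * A in
  0 < K -> 0 < A -> (forall x, (1 + x ^+ 2) ^+ 4 <= A * e x) ->
  mu.-integrable setT (EFin \o e) -> \int[mu]_x e x <= 2 ->
  mu.-integrable setT (EFin \o (fun x : R => x)) -> \int[mu]_x x = 0 ->
  mu.-integrable setT (EFin \o (fun x : R => x ^+ 2)) -> \int[mu]_x (x ^+ 2) = 1 ->
  mu.-integrable setT (EFin \o (fun x : R => x ^+ 4)) -> \int[mu]_x (x ^+ 4) = m4 ->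
  0 < eta -> eta <= 1 / 2 -> eta <= (m4 - 1) / 8 ->
  eps = B / N%:R -> eps <= 1 -> 30 * A * eps <= eta -> eps <= 2 * K ->
  grid_law N (16 * K) ((m4 - 1) / 2) B.
Proof.
move=> N0 e B K0 A0 Ae ie e2 i1 r1 i2 r2 i4 r4 eta0 eta1 eta2 epsE eps1 epsA epsK.
have N0' : 0 < N%:R :> R by rewrite ltr0n.
have N1 : 1 <= N%:R :> R by rewrite ler1n.
have B1 : 1 <= B by rewrite /B lerDl mulr_ge0// ltW.
have B0 : 0 < B := lt_le_trans ltr01 B1.
have eps0 : 0 <= eps by rewrite epsE divr_ge0 ?ltW.
have e01 : 0 <= eps <= 1 by rewrite eps0.
have mC v := @measurable_gidx R N v N0.
pose w v := fine (mu (gidx N @^-1` [set v])).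
have w0 v : 0 <= w v by apply: fine_ge0.
have int_cst (c : R) : \int[mu]_x c = c.
  rewrite (Rintegral_cst mu measurableT) -[RHS]mulr1; congr (_ * _).
  exact: (congr1 fine (probability_setT mu)).
have w1 : \sum_v w v = 1.
  have [_] := Rintegral_comp_fin mu (fun=> 1) mC.
  rewrite int_cst => E; rewrite [RHS]E.
  by apply: eq_bigr => v _; rewrite mulr1.
pose P := FDist w0 w1.
have NN0 : 0 <= (N%:R ^+ 2)^-1 :> R by rewrite invr_ge0 sqr_ge0.
(* The bias created by rounding; subtracting it restores mean exactly zero. *)
pose be := ev P (@gval R N).
have beB : `|be| <= 2 * A / N%:R ^+ 2.
  have c0 : 0 <= (N%:R ^+ 2)^-1 * A by rewrite mulr_ge0// ltW.
  have := @sum_near_Rintegral _ _ (@gval R N) id e _ mC i1 ie e2 c0.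
  rewrite r1 subr0 [_^-1 * A]mulrC mulrA; apply=> x; rewrite [A / _]mulrC -mulrA.
  by apply: le_trans (gval_near x N0) _; rewrite ler_wpM2l.
have beE : (N%:R ^+ 2)^-1 + `|be| <= B / N%:R ^+ 2 by rewrite /B mulrDl mul1r lerD2l.
have BN : B / N%:R ^+ 2 <= eps.
  rewrite epsE ler_wpM2l ?(ltW B0)// lef_pV2 ?posrE ?exprn_gt0// expr2.
  by rewrite ler_peMl// ltW.
have beps := le_trans beE BN.
have Neps : N%:R^-1 <= eps by rewrite epsE ler_peMl ?invr_ge0 ?(ltW N0').
pose b (v : 'I_(2 * N ^ 3).+1) := gval R v - be.
have bP x := @shifted_grid R N x be eps N0 e01 Neps beps.
have c0 : 0 <= 15 * eps * A by rewrite !mulr_ge0// ltW.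
have qe x : 15 * eps * (1 + x ^+ 2) ^+ 4 <= 15 * eps * A * e x.
  by rewrite -[leRHS]mulrA ler_wpM2l// mulr_ge0.
have c2 : 2 * (15 * eps * A) <= eta.
  by rewrite (_ : 2 * (15 * eps * A) = 30 * A * eps)//; ring.
have near2 : `|ev P (fun v => b v ^+ 2) - 1| <= eta.
  apply: le_trans c2.
  have := @sum_near_Rintegral _ _ (fun v => b v ^+ 2) (fun x => x ^+ 2) e _ mC i2 ie e2 c0.
  by rewrite r2; apply=> x; apply: le_trans (qe x); have [] := bP x.
have near4 : `|ev P (fun v => b v ^+ 4) - m4| <= eta.
  apply: le_trans c2.
  have := @sum_near_Rintegral _ _ (fun v => b v ^+ 4) (fun x => x ^+ 4) e _ mC i4 ie e2 c0.
  by rewrite r4; apply=> x; apply: le_trans (qe x); have [] := bP x.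
have [v2 v4] := moments_near (ltW eta0) eta1 eta2 near2 near4.
exists P, b; split.
- split=> //.
  + by rewrite mulr_gt0.
  + by clear - eta0 eta2; lra.
  + by rewrite evB ev_cst subrr.
  + have ic : mu.-integrable setT (EFin \o (fun=> 7 / 6 : R)).
      exact: finite_measure_integrable_cst.
    have ie6 : mu.-integrable setT (EFin \o (fun x => 1 / 6 * e x)).
      by rewrite (_ : EFin \o _ = fun x => ((1 / 6)%:E * (EFin \o e) x)%E)//; exact: integrableZl.
    apply: (@le_trans _ _ (\int[mu]_x (7 / 6 + 1 / 6 * e x))); last first.
      by rewrite RintegralD// int_cst RintegralZl//; clear - e2; lra.
    apply: (@sum_le_Rintegral _ mu _ _ (fun v => expR (b v ^+ 2 / (16 * K)))) => //.
      by rewrite (_ : EFin \o _ = (EFin \o (fun=> 7 / 6 : R)) \+ (EFin \o (fun x => 1 / 6 * e x)))//;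
        exact: integrableD.
    by move=> x; apply: (expR_square_le K0 epsK); have [] := bP x.
- by move=> v; rewrite /= /w fineK// fin_num_measure.
- have ix2' : mu.-integrable setT (EFin \o (fun x : R => (N%:R ^+ 2)^-1 * x ^+ 2)).
    rewrite (_ : EFin \o _ = fun x : R => ((N%:R ^+ 2)^-1%:E * (EFin \o (fun x : R => (x ^+ 2)%R)) x)%E)//.
    exact: integrableZl.
  apply: (@le_trans _ _ (\int[mu]_x ((N%:R ^+ 2)^-1 * x ^+ 2))); last first.
    by rewrite RintegralZl// r2 mulr1.
  have -> : P ord_max = \sum_v w v * (v == ord_max)%:R.
    rewrite (bigD1 ord_max)//= eqxx mulr1 big1 ?addr0// => v /negbTE ->.
    by rewrite mulr0.
  apply: (@sum_le_Rintegral _ mu _ _ (fun v => (v == ord_max)%:R)) => // x.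
  rewrite gidx_eq_max//; have [xN|xN] := boolP (- N%:R <= x < N%:R) => /=.
    by rewrite mulr_ge0 ?sqr_ge0.
  rewrite mulrC ler_pdivlMr ?exprn_gt0// mul1r -(real_normK (num_real x)).
  by apply: lerXn2r; rewrite ?nnegrE ?(ltW N0')//; exact: notin_grid_norm.
- move=> x; rewrite gidx_eq_max// negbK => xN; split.
    by have /andP[x1 x2] := xN; rewrite ler_norml x1 ltW.
  rewrite /b -addrAC; apply: le_trans (ler_normB _ _) _; apply: le_trans beE.
  by rewrite lerD2r; exact: gval_close.
Qed.

Lemma discretization : subgaussian_entry_law mu ->
  exists K v0 B : R, [/\ 0 < K, 0 < v0 & 0 < B] /\
  exists N0 : nat, forall N, (N0 <= N)%N -> (0 < N)%N -> grid_law N K v0 B.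
Proof.
move=> [[K0 [K00 intle]] i1 ix1 ix2 ix4].
pose K := K0 ^+ 2; have Kp : 0 < K by rewrite exprn_gt0.
have [ie e2 dom] := subgaussian_integrable Kp intle.
set e := fun x => expR (x ^+ 2 / K) in ie e2 dom.
have [A A0 Ae] : exists2 A : R, 0 < A & forall x, (1 + x ^+ 2) ^+ 4 <= A * e x.
  exists (8 + 8 * 4 ^+ 4 * K ^+ 4); last by move=> x; exact: quartic_le_expR.
  by apply: ltr_pwDl => //; nonneg.
have i2 : mu.-integrable setT (EFin \o (fun x : R => x ^+ 2)).
  apply: (dom _ A); first exact: measurable_funX.
  by move=> x; apply: le_trans (Ae x); rewrite ger0_norm ?sqr_ge0//; exact: (@pow_le_quartic _ x 1).
have i4 : mu.-integrable setT (EFin \o (fun x : R => x ^+ 4)).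
  apply: (dom _ A); first exact: measurable_funX.
  move=> x; apply: le_trans (Ae x); rewrite ger0_norm ?exprn_even_ge0//.
  by have := @pow_le_quartic _ x 2 isT; rewrite -exprM.
have r1 : \int[mu]_x x = 0 by rewrite /Rintegral ix1.
have r2 : \int[mu]_x (x ^+ 2) = 1 by rewrite /Rintegral ix2.
pose m4 := \int[mu]_x (x ^+ 4).
have m41 : 1 < m4.
  by rewrite -lte_fin /m4 /Rintegral fineK//; exact: integrable_fin_num i4.
pose eta := Num.min (1 / 2) ((m4 - 1) / 8).
have m40 : 0 < m4 - 1 by rewrite subr_gt0.
have eta0 : 0 < eta by rewrite lt_min !divr_gt0.
pose B := 1 + 2 * A; have B0 : 0 < B by rewrite ltr_pwDl// mulr_ge0// ltW.
have B2K : 0 <= B / (2 * K) by rewrite divr_ge0 ?(ltW B0)// mulr_ge0// ltW.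
have BA : 0 <= 30 * A * B / eta.
  by rewrite divr_ge0 ?(ltW eta0)// mulr_ge0 ?(ltW B0)// mulr_ge0// ltW.
(* [N] above each of the three summands gives one of the three smallness conditions on
   [eps = B / N]. *)
pose T := B + 30 * A * B / eta + B / (2 * K).
exists (16 * K), ((m4 - 1) / 2), B; split; first by split; rewrite ?mulr_gt0 ?divr_gt0.
exists (Num.truncn T).+1 => N NT N0.
have N0' : 0 < N%:R :> R by rewrite ltr0n.
have T1 : T <= N%:R.
  by apply: le_trans (ltW (truncnS_gt T)) _; rewrite ler_nat.
have [TB TA TK] : [/\ B <= N%:R, 30 * A * B / eta <= N%:R & B / (2 * K) <= N%:R].
  move: T1 BA B2K (ltW B0); rewrite /T; clear.
  by set x := _ / eta; set y := B / (2 * K) => *; split; lra.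
apply: (@grid_law_of_moments K A m4 eta (B / N%:R)) => //.
- by rewrite ge_min lexx.
- by rewrite ge_min lexx orbT.
- by rewrite ler_pdivrMr// mul1r.
- by rewrite mulrA ler_pdivrMr// -[eta * _]mulrC -ler_pdivrMr.
- by rewrite ler_pdivrMr// -[2 * K * _]mulrC -ler_pdivrMr// mulr_gt0.
Qed.

End DiscretizedLaw.

(** * Transfer to the original sampling space *)

Section SamplingEvent.
Context (R : realType).

Lemma finite_union_le (d : measure_display) (T : measurableType d) (P : probability T R)
    (I : finType) (F : I -> set T) : (forall i, measurable (F i)) ->
  measurable (\bigcup_(i in [set: I]) F i) /\
  (P (\bigcup_(i in [set: I]) F i) <= \sum_i P (F i))%E.
Proof.
move=> mF.
have -> : \bigcup_(i in [set: I]) F i = \big[setU/set0]_(i <- index_enum I) F i.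
  by rewrite -bigcup_seq; congr bigcup; apply/seteqP; split => i //= _; rewrite mem_index_enum.
elim: (index_enum I) => [|i s [mU PU]]; first by rewrite !big_nil measure0.
rewrite !big_cons; split; first exact: measurableU.
by apply: le_trans (measureU2 _ _ _) _ => //; rewrite leeD2l.
Qed.

Lemma bf_perturb n (H : 'M[R]_n) (f g : 'I_n -> R) (N d : R) : 0 <= d ->
  \sum_i \sum_j H i j ^+ 2 = 1 ->
  (forall j, `|f j| <= N) -> (forall j, `|g j - f j| <= d) ->
  `|bf H g g| <= `|bf H f f| + n%:R ^+ 2 * ((2 * N + d) * d).
Proof.
move=> d0 H1 fN gf.
have H1' i j : `|H i j| <= 1.
  rewrite -ler_sqr ?nnegrE// expr1n real_normK ?num_real// -H1 (bigD1 i)//= (bigD1 j)//=.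
  rewrite -addrA lerDl addr_ge0// ?sumr_ge0// => l _; first exact: sqr_ge0.
  by apply: sumr_ge0 => ? _; exact: sqr_ge0.
rewrite -[bf H g g](subrK (bf H f f)) addrC; apply: le_trans (ler_normD _ _) _.
rewrite lerD2l /bf -sumrB; apply: le_trans (ler_norm_sum _ _ _) _.
have -> : n%:R ^+ 2 * ((2 * N + d) * d) = \sum_(i < n) \sum_(j < n) (2 * N + d) * d.
  set X := (2 * N + d) * d; rewrite !sumr_const !card_ord.
  by rewrite -[X *+ n *+ n]mulr_natl -[X *+ n]mulr_natl mulrA expr2.
apply: ler_sum => i _; rewrite -sumrB; apply: le_trans (ler_norm_sum _ _ _) _.
apply: ler_sum => j _.
have -> : g i * H i j * g j - f i * H i j * f j =
  H i j * ((g i - f i) * (g j - f j) + (g i - f i) * f j + f i * (g j - f j)) by ring.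
rewrite normrM -[leRHS]mul1r; apply: ler_pM => //.
have h1 : `|(g i - f i) * (g j - f j)| <= d * d by rewrite normrM ler_pM.
have h2 : `|(g i - f i) * f j| <= d * N by rewrite normrM ler_pM.
have h3 : `|f i * (g j - f j)| <= N * d by rewrite normrM ler_pM.
apply: le_trans (ler_normD _ _) _.
have := ler_normD ((g i - f i) * (g j - f j)) ((g i - f i) * f j); lra.
Qed.

(** Two exceptional sets of probability at most [del] each: [U1], where the rounded sample is bad,
    and [U2], where some entry falls in the tails of the grid. Off both, rounding costs the change
    from [p0 / 2] to [p0 / 4]. *)
Lemma sampling_event (mu : probability R R) (K v0 B : R) (N0 : nat) (C : R) :
  0 < K -> 0 < v0 -> 0 < B -> 0 < C ->
  (forall N, (N0 <= N)%N -> (0 < N)%N -> grid_law mu N K v0 B) ->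
  forall (n k m : nat) (lam : R), (0 < k)%N -> (k <= n)%N -> 0 < lam ->
    k%:R * lam ^+ 2 <= 1 -> samplec K v0 C * ((1 + ln n%:R) / lam ^+ 2) <= m%:R ->
  forall (d : measure_display) (T : measurableType d) (P : probability T R)
    (a : 'I_m -> 'I_n -> T -> R), iid_entries P a mu ->
  exists E : set T, measurable E /\
    (P E >= (1 - 2 * expR (- (ballc K v0 ^+ 2 / 128 * m%:R)))%:E)%E /\
    forall t, E t -> forall H : 'M[R]_n, H^T = H -> \sum_i \sum_j H i j ^+ 2 = 1 ->
      low_complexity k lam C H ->
      ballc K v0 / 4 * m%:R <= \sum_i `|bf H (fun j => a i j t) (fun j => a i j t)|.
Proof.
move=> K0 v00 B0 C0 grid n k m lam k0 kn lam0 klam mL d T P a [ma la ia].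
set p0 := ballc K v0; have p00 : 0 < p0 by exact: ballc_gt0.
set del := expR _; have del0 : 0 < del by exact: expR_gt0.
(* [N >= T1] keeps the perturbation of each form below [p0 / 4]; [N >= T2] brings the union bound
   [m * n / N ^+ 2] below [del]. *)
pose T1 := n%:R ^+ 2 * ((2 + B) * B) / (p0 / 4); pose T2 := m%:R * n%:R / del.
have T10 : 0 <= T1.
  apply: divr_ge0; last by rewrite divr_ge0// ltW.
  by apply: mulr_ge0; [exact: sqr_ge0|apply: mulr_ge0; [rewrite addr_ge0// ltW|exact: ltW]].
have T20 : 0 <= T2 by rewrite divr_ge0 ?(ltW del0)// mulr_ge0.
pose N := maxn N0 (Num.truncn (1 + T1 + T2)).+1.
have NN0 : (N0 <= N)%N by rewrite leq_maxl.
have Np : (0 < N)%N by rewrite (leq_trans _ (leq_maxr _ _)).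
have N0' : 0 < N%:R :> R by rewrite ltr0n.
have NT : 1 + T1 + T2 <= N%:R.
  by apply: le_trans (ltW (truncnS_gt _)) _; rewrite ler_nat leq_maxr.
have [N1 NT1 NT2] : [/\ 1 <= N%:R :> R, T1 <= N%:R & T2 <= N%:R].
  suff gen (x y z : R) : 1 + x + y <= z -> 0 <= x -> 0 <= y -> [/\ 1 <= z, x <= z & y <= z].
    exact: gen NT T10 T20.
  by clear; split; lra.
have [Pw [b [lawb muw wmax close]]] := grid N NN0 Np.
pose V := 'I_(2 * N ^ 3).+1.
pose out t : m.-tuple (n.-tuple V) := [tuple [tuple gidx N (a i j t) | j < n] | i < m].
pose bad (tau : m.-tuple (n.-tuple V)) : bool := `[< exists H : 'M[R]_n,
  [/\ H^T = H, \sum_i \sum_j H i j ^+ 2 = 1, low_complexity k lam C H &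
      \sum_(x <- tau) `|bf H (vec b x) (vec b x)| <= p0 / 2 * m%:R] >].
have badle : \sum_(tau | bad tau) \prod_(x <- tau) \prod_(v <- x) Pw v <= del.
  by apply: (discrete_lower_bound lawb C0 k0 kn lam0 klam mL) => tau /asboolP.
have mg v : measurable (gidx N @^-1` [set v] : set R) by exact: measurable_gidx.
have mag i j v : measurable (a i j @^-1` (gidx N @^-1` [set v])).
  by rewrite -[X in measurable X]setTI; exact: ma.
pose cyl (tau : m.-tuple (n.-tuple V)) : set T := \bigcap_(p in [set: 'I_m * 'I_n])
  (a p.1 p.2 @^-1` (gidx N @^-1` [set tnth (tnth tau p.1) p.2])).
have mcyl tau : measurable (cyl tau).
  by apply: fin_bigcap_measurable => // p _; exact: mag.
have Pcyl tau : P (cyl tau) = (\prod_(x <- tau) \prod_(v <- x) Pw v)%:E.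
  rewrite -[LHS]fineK ?fin_num_measure//; congr EFin.
  rewrite (ia (fun i j => gidx N @^-1` [set tnth (tnth tau i) j])); last by move=> i j; exact: mg.
  rewrite [RHS]big_tuple; apply: eq_bigr => i _; rewrite [RHS]big_tuple; apply: eq_bigr => j _.
  by rewrite la// muw.
pose F1 tau := if bad tau then cyl tau else set0.
pose F2 (p : 'I_m * 'I_n) := a p.1 p.2 @^-1` (gidx N @^-1` [set ord_max]).
have [mU1 PU1] : measurable (\bigcup_(tau in [set: _]) F1 tau) /\
    (P (\bigcup_(tau in [set: _]) F1 tau) <= \sum_tau P (F1 tau))%E.
  by apply: finite_union_le => tau; rewrite /F1; case: ifP.
have [mU2 PU2] : measurable (\bigcup_(p in [set: _]) F2 p) /\
    (P (\bigcup_(p in [set: _]) F2 p) <= \sum_p P (F2 p))%E.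
  by apply: finite_union_le => p; exact: mag.
set U1 := \bigcup_(tau in _) _ in mU1 PU1; set U2 := \bigcup_(p in _) _ in mU2 PU2.
have PU1' : (P U1 <= del%:E)%E.
  apply: le_trans PU1 _; rewrite (eq_bigr (fun tau => (if bad tau then
    \prod_(x <- tau) \prod_(v <- x) Pw v else 0)%:E)).
    by rewrite sumEFin lee_fin -big_mkcond.
  by move=> tau _; rewrite /F1; case: ifP => _; rewrite ?Pcyl ?measure0.
have PU2' : (P U2 <= del%:E)%E.
  apply: le_trans PU2 _; rewrite (eq_bigr (fun=> (Pw ord_max)%:E)); last first.
    by move=> p _; rewrite /F2 la// muw.
  rewrite sumEFin lee_fin sumr_const card_prod !card_ord -[leLHS]mulr_natl natrM.
  apply: (@le_trans _ _ (m%:R * n%:R * (N%:R ^+ 2)^-1)).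
    by rewrite ler_wpM2l// mulr_ge0.
  rewrite ler_pdivrMr ?exprn_gt0// [leRHS]mulrC -ler_pdivrMr//.
  by apply: le_trans NT2 _; rewrite expr2 ler_peMl// ltW.
exists (~` (U1 `|` U2)); split; first by apply: measurableC; exact: measurableU.
split.
  rewrite probability_setC; last exact: measurableU.
  rewrite EFinB leeB//; apply: le_trans (measureU2 _ mU1 mU2) _.
  by rewrite (_ : 2 * del = del + del); [rewrite EFinD leeD|rewrite mulr_natl].
move=> t Et H HT H1 HC; rewrite leNgt; apply/negP => small; apply: Et.
have [inU2|ninU2] := pselect (U2 t); first by right.
have notmax i j : gidx N (a i j t) != ord_max.
  by apply/negP => /eqP h; apply: ninU2; exists (i, j).
have outE i j : tnth (tnth (out t) i) j = gidx N (a i j t) by rewrite !tnth_mktuple.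
pose dd := B / N%:R ^+ 2.
have dd0 : 0 <= dd by rewrite divr_ge0 ?sqr_ge0// ltW.
have ddN : dd <= B * N%:R.
  rewrite ler_pdivrMr ?exprn_gt0// -mulrA ler_peMr ?(ltW B0)// -exprS.
  exact: exprn_ege1.
have err : n%:R ^+ 2 * ((2 * N%:R + dd) * dd) <= p0 / 4.
  have p40 : 0 < p0 / 4 by rewrite divr_gt0.
  apply: (@le_trans _ _ (n%:R ^+ 2 * ((2 + B) * B) / N%:R)); last first.
    by move: NT1; rewrite /T1 ler_pdivrMr// => h; rewrite ler_pdivrMr// [leRHS]mulrC.
  rewrite -mulrA ler_wpM2l ?sqr_ge0//.
  apply: (@le_trans _ _ ((2 * N%:R + B * N%:R) * dd)); first by rewrite ler_wpM2r// lerD2l.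
  rewrite /dd (_ : _ * _ = (2 + B) * B / N%:R)//.
  by field; rewrite gt_eqF.
left; exists (out t) => //; rewrite /F1.
suff -> : bad (out t) by move=> p _ /=; rewrite outE.
apply/asboolP; exists H; split => //; rewrite big_tuple.
apply: (@le_trans _ _ (\sum_(i < m) (`|bf H (fun j => a i j t) (fun j => a i j t)| + p0 / 4))).
  apply: ler_sum => i _.
  have fN j : `|a i j t| <= N%:R by have [] := close _ (notmax i j).
  have gf j : `|vec b (tnth (out t) i) j - a i j t| <= dd.
    by rewrite /vec outE; have [] := close _ (notmax i j).
  by apply: le_trans (bf_perturb dd0 H1 fN gf) _; rewrite lerD2l.
rewrite big_split /= sumr_const card_ord -[_ *+ m]mulr_natl.
by move: small; clear; set S := \sum_i _; lra.
Qed.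

End SamplingEvent.

(** * Deterministic recovery and the final choice of constants *)

Section Recovery.
Context (R : realType).

Lemma l2v_le_l1v n (x : 'I_n -> R) : l2v x <= l1v x.
Proof.
have l10 : 0 <= l1v x by apply: sumr_ge0.
rewrite -ler_sqr ?nnegrE ?sqrtr_ge0// l2v_sqr expr2 /l1v mulr_suml.
apply: ler_sum => i _; rewrite -(real_normK (num_real (x i))) expr2 ler_wpM2l//.
by rewrite (bigD1 i)//= lerDl sumr_ge0.
Qed.

Lemma l1v_ge0 n (x : 'I_n -> R) : 0 <= l1v x.
Proof. exact: sumr_ge0. Qed.

Lemma ratio_le1 n (x : 'I_n -> R) : l2v x / l1v x <= 1.
Proof.
have := l1v_ge0 x; rewrite le_eqVlt => /orP[/eqP <-|h]; first by rewrite invr0 mulr0 ler01.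
by rewrite ler_pdivrMr// mul1r l2v_le_l1v.
Qed.

Lemma psd_outer n (x : 'I_n -> R) : psd (outer x).
Proof.
apply/psdP; split; first by apply/matrixP => i j; rewrite !mxE mulrC.
move=> v; suff -> : bf (outer x) v v = (\sum_i v i * x i) ^+ 2 by exact: sqr_ge0.
rewrite expr2 mulr_suml; apply: eq_bigr => i _; rewrite mulr_sumr.
by apply: eq_bigr => j _; rewrite mxE; ring.
Qed.

Lemma Aop_outer m n (a : 'I_m -> 'I_n -> R) (x : 'I_n -> R) i :
  Aop a (outer x) i = inner (a i) x ^+ 2.
Proof.
rewrite /Aop /inner expr2 mulr_suml; apply: eq_bigr => j _; rewrite mulr_sumr.
by apply: eq_bigr => l _; rewrite mxE; ring.
Qed.

Lemma AopE m n (a : 'I_m -> 'I_n -> R) M i : Aop a M i = bf M (a i) (a i).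
Proof. by []. Qed.

(* Either [|Xh - x x^T|_F] is below the approximation error, or [Xh - x x^T] lies in the cone
   on which the measurements are bounded from below; they are at most [2 eps1] on it. *)
Lemma recovery_bound (m n k : nat) (lam p : R) (a : 'I_m -> 'I_n -> R) :
  (0 < m)%N -> 0 < lam -> 0 < p ->
  (forall H : 'M[R]_n, H^T = H -> \sum_i \sum_j H i j ^+ 2 = 1 ->
     low_complexity k lam 12 H -> p * m%:R <= \sum_i `|bf H (a i) (a i)|) ->
  forall (x : 'I_n -> R) (Om : {set 'I_n}), #|Om| = k -> 0 < l2v (restr x Om) ->
    lam * Num.sqrt k%:R * l1v (restr x Om) <= l2v (restr x Om) ->
  forall (eps1 : R) (eta : 'I_m -> R), 0 <= eps1 -> l1v eta <= eps1 ->
  forall Xh, is_minimizer a (fun i => inner (a i) x ^+ 2 + eta i) eps1 lam Xh ->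
  frob (Xh - outer x) <= (1 + 2 / p) *
    (nucnorm (outer x - outer (restr x Om)) + lam * mnorm1 (outer x - outer (restr x Om))
     + eps1 / m%:R).
Proof.
move=> m0 lam0 p0 lower x Om Omk z0 zlam eps1 eta e0 etae Xh [[pX fX] opt].
set D := outer x - _; set F := frob (Xh - outer x).
have m0' : 0 < m%:R :> R by rewrite ltr0n.
have F0 : 0 <= F by exact: frob_ge0.
have fD := frob_tail_le_nucnorm x Om; rewrite -/D in fD.
have fD0 : 0 <= frob D by exact: frob_ge0.
have mD0 : 0 <= lam * mnorm1 D.
  by rewrite mulr_ge0 ?(ltW lam0)//; do 2!(apply: sumr_ge0 => ? _).
have em0 : 0 <= eps1 / m%:R by rewrite divr_ge0// ltW.
have p20 : 0 <= 2 / p by rewrite divr_ge0// ltW.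
set q := nucnorm D + lam * mnorm1 D + eps1 / m%:R.
have dq : frob D + lam * mnorm1 D <= q.
  by rewrite -[leLHS]addr0; apply: lerD => //; rewrite lerD2r.
have q0 : 0 <= q by apply: le_trans dq; rewrite addr_ge0.
have [dF|Fd] := leP (frob D + lam * mnorm1 D) F; last first.
  apply: le_trans (ltW Fd) _; apply: le_trans dq _.
  by rewrite mulrDl mul1r lerDl mulr_ge0.
move: (F0); rewrite le_eqVlt => /orP[/eqP <-|Fp].
  by rewrite mulr_ge0// addr_ge0.
have [XT _] := pX; have [xT _] := psd_outer x.
have feas : feasible a (fun i => inner (a i) x ^+ 2 + eta i) eps1 (outer x).
  split; first exact: psd_outer.
  apply: le_trans etae; apply: ler_sum => i _.
  by rewrite Aop_outer addrC addKr.
have low := descent_low_complexity Omk lam0 z0 zlam pX (opt _ feas) dF.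
rewrite -/F in low.
have Fi0 : 0 <= F^-1 by rewrite invr_ge0.
have := low_complexity_scale Fi0 low.
rewrite mulrCA mulVf ?gt_eqF// mulr1 => low1.
have HT : (F^-1 *: (Xh - outer x))^T = F^-1 *: (Xh - outer x).
  by rewrite linearZ /= linearB /= XT xT.
have H1 : \sum_i \sum_j (F^-1 *: (Xh - outer x)) i j ^+ 2 = 1.
  transitivity (F^-1 ^+ 2 * \sum_i \sum_j (Xh - outer x) i j ^+ 2).
    rewrite mulr_sumr; apply: eq_bigr => i _; rewrite mulr_sumr.
    by apply: eq_bigr => j _; rewrite mxE exprMn.
  by rewrite -frob_sqr -/F -exprMn mulVf ?expr1n// gt_eqF.
have := lower _ HT H1 low1.
have bfZ i : `|bf (F^-1 *: (Xh - outer x)) (a i) (a i)| =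
    F^-1 * `|bf (Xh - outer x) (a i) (a i)|.
  suff -> : bf (F^-1 *: (Xh - outer x)) (a i) (a i) = F^-1 * bf (Xh - outer x) (a i) (a i).
    by rewrite normrM ger0_norm.
  rewrite /bf mulr_sumr; apply: eq_bigr => j _; rewrite mulr_sumr.
  by apply: eq_bigr => l _; rewrite mxE; ring.
under eq_bigr do rewrite bfZ.
rewrite -mulr_sumr => /(ler_wpM2l F0); rewrite mulVKf ?gt_eqF// => lowF.
have up : \sum_i `|bf (Xh - outer x) (a i) (a i)| <= 2 * eps1.
  apply: (@le_trans _ _ (\sum_i (`|inner (a i) x ^+ 2 + eta i - Aop a Xh i| + `|eta i|))).
    apply: ler_sum => i _; rewrite bfB -!AopE Aop_outer.
    have -> : Aop a Xh i - inner (a i) x ^+ 2 =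
      eta i - (inner (a i) x ^+ 2 + eta i - Aop a Xh i) by ring.
    by rewrite [leRHS]addrC; exact: ler_normB.
  rewrite big_split /= mulr_natl mulr2n; exact: lerD.
have Fe : F <= 2 / p * (eps1 / m%:R).
  rewrite mulrACA -invfM ler_pdivlMr ?mulr_gt0//.
  exact: le_trans lowF up.
apply: le_trans Fe _; rewrite [leRHS]mulrDl mul1r.
apply: (@le_trans _ _ (2 / p * q)); last by rewrite lerDr.
by rewrite ler_wpM2l// /q lerDr addr_ge0// (le_trans fD0).
Qed.

(** For [n >= 2], [1 <= 2 * ln n] turns [1 + ln n] into [3 * ln n]. For [n = 1] the logarithm
    vanishes, but [lam >= 1] and [C <= m] suffices. *)
Lemma sample_size_le (n m : nat) (lam C : R) : (0 < n)%N -> n%:R^-1 <= lam -> 0 < C ->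
  C <= m%:R -> 3 * C * ln n%:R / lam ^+ 2 < m%:R ->
  C * ((1 + ln n%:R) / lam ^+ 2) <= m%:R.
Proof.
move=> n0 lamn C0 Cm mlam.
have lam0 : 0 < lam by apply: lt_le_trans lamn; rewrite invr_gt0 ltr0n.
have l20 : 0 < lam ^+ 2 by rewrite exprn_gt0.
have [n1|n2] := leqP n 1.
  have nE : n = 1%N by apply/eqP; rewrite eqn_leq n1.
  rewrite nE invr1 in lamn; rewrite nE ln1 addr0.
  apply: le_trans Cm; rewrite ler_piMr ?(ltW C0)// ler_pdivrMr// mul1r.
  exact: exprn_ege1.
have l2 : 1 <= 2 * ln n%:R :> R.
  have h : (1 / 2 : R) <= ln 2.
    have := expR_ge1Dx (- ln 2 : R); rewrite expRN lnK ?posrE//; lra.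
  have : ln 2 <= ln n%:R :> R by rewrite ler_ln ?posrE ?ltr0n// ler_nat.
  lra.
apply: le_trans (ltW mlam); rewrite mulrA ler_pM2r ?invr_gt0//.
have := ler_wpM2l (ltW C0) l2; lra.
Qed.

End Recovery.

Theorem theorem4 (R : realType) (mu : probability R R) :
  subgaussian_entry_law mu ->
  exists C0 C1 C2 c0 : R, [/\ 0 < C0, 0 < C1, 0 < C2 & 0 < c0] /\
  forall (n k m : nat) (rho lam : R),
    (0 < k)%N -> (k <= n)%N -> 0 < rho ->
    n%:R^-1 <= lam -> lam <= rho / Num.sqrt k%:R ->
    C2 * ln n%:R / lam ^+ 2 < m%:R ->
  forall (d : measure_display) (T : measurableType d) (P : probability T R)
         (a : 'I_m -> 'I_n -> T -> R),
    iid_entries P a mu ->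
  exists E : set T, measurable E /\
    (P E >= (1 - C0 * expR (- c0 * m%:R))%:E)%E /\
    forall t, E t ->
    forall (x : 'I_n -> R) (Om : {set 'I_n}), best_ksupport k x Om ->
      l2v (restr x Om) / l1v (restr x Om) >= rho ->
    forall (eps1 : R) (eta : 'I_m -> R), 0 <= eps1 -> l1v eta <= eps1 ->
    let y := fun i => (inner (fun j => a i j t) x) ^+ 2 + eta i in
    forall Xh : 'M[R]_n, is_minimizer (fun i j => a i j t) y eps1 lam Xh ->
      frob (Xh - outer x) <=
        C1 * (nucnorm (outer x - outer (restr x Om))
              + lam * mnorm1 (outer x - outer (restr x Om)) + eps1 / m%:R).
Proof.
move=> /discretization[K [v0 [B [[K0 v00 B0] [N0 grid]]]]].
set p := ballc K v0 / 4; set c := ballc K v0 ^+ 2 / 128.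
have p0 : 0 < p by rewrite divr_gt0// ballc_gt0.
have c0 : 0 < c by rewrite divr_gt0// exprn_gt0// ballc_gt0.
set C3 := samplec K v0 12; have C30 : 0 < C3 by exact: samplec_gt0.
(* The 2 counts the two exceptional sets; [expR (c * C3)] makes the probability claim void for
   [m < C3], where the empty event is taken. *)
exists (2 + expR (c * C3)), (1 + 2 / p), (3 * C3), c; split.
  split; [|by rewrite addr_gt0// divr_gt0|exact: mulr_gt0|exact: c0].
  by apply: addr_gt0 => //; exact: expR_gt0.
move=> n k m rho lam k0 kn rho0 lamn lamk mlam d T P a iid.
have n0 : (0 < n)%N by exact: leq_trans kn.
have lam0 : 0 < lam by apply: lt_le_trans lamn; rewrite invr_gt0 ltr0n.
have ec0 : 0 < expR (- c * m%:R) by exact: expR_gt0.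
have [mC|Cm] := ltP m%:R C3.
  exists set0; split=> //; split=> [|t []]; rewrite measure0 lee_fin subr_le0 mulrDl.
  apply: (@le_trans _ _ (expR (c * C3) * expR (- c * m%:R))).
    by rewrite -expRD mulNr -mulrBr -[leLHS]expR0 ler_expR mulr_ge0 ?(ltW c0)// subr_ge0 ltW.
  by rewrite lerDr mulr_ge0// ltW.
(* No [x] meets the ratio condition when [rho > 1]; otherwise [lam * sqrt k <= rho <= 1]. *)
have [rho1|rho1] := ltP 1 rho.
  exists setT; split=> //; split.
    by rewrite probability_setT lee_fin gerBl mulr_ge0 ?(ltW ec0)// addr_ge0// expR_ge0.
  move=> t _ x Om _ h; exfalso.
  by have := le_trans h (ratio_le1 (restr x Om)); rewrite leNgt rho1.
have sk0 : 0 < Num.sqrt k%:R :> R by rewrite sqrtr_gt0 ltr0n.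
have lsk : lam * Num.sqrt k%:R <= rho by rewrite -ler_pdivlMr.
have klam : k%:R * lam ^+ 2 <= 1.
  have -> : k%:R * lam ^+ 2 = (lam * Num.sqrt k%:R) ^+ 2.
    by rewrite exprMn sqr_sqrtr// mulrC.
  rewrite expr_le1// ?(le_trans lsk)// mulr_ge0 ?(ltW lam0)//; exact: ltW.
have m0 : (0 < m)%N by rewrite -(ltr_nat R) (lt_le_trans C30).
have twelve : 0 < 12 :> R by [].
have [E [mE [PE lower]]] := sampling_event K0 v00 B0 twelve grid k0 kn lam0 klam
  (sample_size_le n0 lamn C30 Cm mlam) iid.
exists E; split=> //; split.
  apply: le_trans PE; rewrite lee_fin lerD2l lerN2 -/c mulNr ler_pM2r ?expR_gt0//.
  by rewrite lerDl expR_ge0.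
move=> t Et x Om [Omk _] ratio eps1 eta e0 etae y Xh minX.
(* Division by zero yields 0, so a vanishing [restr x Om] would have ratio [0 < rho]. *)
have l10 : 0 < l1v (restr x Om).
  rewrite lt_def l1v_ge0 andbT; apply/eqP => l1; move: ratio.
  by rewrite l1 invr0 mulr0 leNgt rho0.
have rl : rho * l1v (restr x Om) <= l2v (restr x Om) by rewrite -ler_pdivlMr.
apply: (recovery_bound m0 lam0 p0 (lower t Et) Omk) etae _ minX => //.
  by apply: lt_le_trans rl; rewrite mulr_gt0.
by apply: le_trans rl; rewrite ler_wpM2r ?l1v_ge0.
Qed.
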